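(* Let $\varphi : [1,\infty) \to [0,\infty)$ be a concave increasing function such that $\Phi(s) := \int_1^s \frac{\mathrm{d}u}{\varphi(u)}$ is finite for all $s > 1$, let $\Psi := \Phi^{-1}$ be the inverse function, and let $G(t,u) := \Psi(\Phi(u)+t)$ for $t \geq 0$, $u \geq 1$. Let $X = (X(t),\, t \geq 0)$ be a semimartingale and a stochastically ordered Markov process on $\mathbb{R}_+ = [0,\infty)$ with transition kernel $P^t(x,\cdot)$. Let $V : \mathbb{R}_+ \to [1,\infty)$ be a $\varphi$-Lyapunov function for $X$, and let $U, h : \mathbb{R}_+ \to \mathbb{R}_+$ be nondecreasing functions such that $$h(t)\,U(x) \leq G(t, V(x)) \quad \text{for all } t, x \geq 0.$$ Then the following hold: (a) For two copies of $X$ starting from $x_1$ and $x_2$ with $0 \leq x_1 \leq x_2$, $$\lVert P^t(x_1,\cdot) - P^t(x_2,\cdot)\rVert_U \leq \frac{2}{h(t)}\,V(x_2),\quad t \geq 0.$$ (b) For two copies of $X$ starting from probability distributions $\rho_1$ and $\rho_2$ on $\mathbb{R}_+$ (so that their distributions at time $t$ are $\rho_1P^t$ and $\rho_2P^t$), $$\lVert \rho_1 P^t - \rho_2 P^t\rVert_U \leq \frac{2}{h(t)}\,(\rho_1\vee\rho_2, V),\quad t \geq 0.$$ (c) If $X$ starts from $X(0)\sim\rho$ with $(\rho, V) < \infty$, and $X$ has a unique stationary distribution $\pi$ with $(\pi, V) < \infty$, then $$\lVert \rho P^t - \pi\rVert_U \leq \frac{2}{h(t)}\,(\pi\vee\rho,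 V),\quad t \geq 0.$$
   Context: All processes are defined on a filtered probability space $(\Omega,\mathcal{F},(\mathcal{F}_t)_{t\ge 0},\mathbb{P})$. $X$ has transition kernel $P^t(x,A) = \mathbb{P}(X(t)\in A \mid X(0)=x)$, and a copy of it can be constructed from any initial value or distribution. The right-hand sides are read as $+\infty$ when $h(t)=0$. Stochastic ordering: a family $(Q_x)_{x\ge 0}$ of Borel measures on $\mathbb{R}_+$ is stochastically ordered if $Q_x([z,\infty)) \le Q_y([z,\infty))$ for $0\le x\le y$ and $z \ge 0$. The process $X$ is stochastically ordered if for every $t \geq 0$ the family $(P^t(x,\cdot))_{x\ge 0}$ is stochastically ordered. $\varphi$-Lyapunov function: a function $V : \mathbb{R}_+\to[1,\infty)$ such that the process $$V(X(t\wedge\tau_0)) + \int_0^{t\wedge\tau_0}\varphi(V(X(s)))\,\mathrm{d}s,\quad t\ge 0,$$ is a local $(\mathcal{F}_t)_{t\ge 0}$-supermartingale, where $\tau_0 := \inf\{t\ge 0 : X(t) = 0\}$ is the hitting time of $0$. Notation: for a signed measure $\nu$ on $\mathbb{R}_+$ and a function $f:\mathbb{R}_+\to\mathbb{R}$, $(\nu,f) := \int_0^\infty f(x)\,\nu(\mathrm{d}x)$. Further, $\lVert\nu\rVert_U := \sup_{|f|\le U}|(\nu,f)|$, the supremum being over functions $f:\mathbb{R}_+\to\mathbb{R}$ with $|f(x)|\le U(x)$ for all $x$. For a probability measure $\rho$, $\rho P^t(B) := \int_0^\infty P^t(x,B)\,\rho(\mathrm{d}x)$. The stochastic maximum $\rho_1\vee\rho_2$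 of two probability measures on $\mathbb{R}_+$ is the probability measure with $(\rho_1\vee\rho_2)((x,\infty)) = \max\{\rho_1((x,\infty)),\rho_2((x,\infty))\}$ for $x\ge 0$. A probability measure $\pi$ is a stationary distribution of $X$ if $\pi P^t = \pi$ for all $t> 0$. Since $\varphi$ is concave, $\Phi(\infty) = \infty$, so $\Psi$ is defined on $[0,\infty)$.
   Formalization: ''Markov process'' is read as strong Markov process, with τ_0 a stopping time, and φ(V(x)) > 0 is assumed for x > 0 (automatic unless φ(1) = 0); the claim fails without strong Markov or without φ(V) > 0. V is taken Borel measurable. *)

(* Defs.v *)
(* MathComp-Analysis, over an arbitrary realType R.                           *)
(* The half-line R_+ = [0, oo[ is the subset `[0, +oo[ of R: times, states    *)
(* and the functions U, V, h are over R, only their restrictions to           *)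
(* `[0, +oo[ being constrained and used; likewise phi on `[1, +oo[.           *)
From HB Require Import structures.
From mathcomp Require Import all_boot all_order all_algebra.
From mathcomp Require Import all_classical all_reals all_analysis measurable_realfun.

Set Implicit Arguments.
Unset Strict Implicit.
Unset Printing Implicit Defensive.

Import Order.TTheory GRing.Theory Num.Theory.
Import numFieldNormedType.Exports.

Local Open Scope classical_set_scope.
Local Open Scope ring_scope.

Section stochastic_processes.
Context d (Om : measurableType d) (R : realType).
Implicit Types (Pr : probability Om R) (F : R -> set (set Om)).
Implicit Types (X : R -> Om -> R) (Y : R -> Om -> \bar R) (tau : Om -> \bar R).

Definition filtration F : Prop :=
  (forall t, 0 <= t -> sigma_algebra setT (F t)) /\
  (forall t, 0 <= t -> F t `<=` measurable) /\
  (forall s t, 0 <= s -> s <= t -> F s `<=` F t).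

Definition measurable_wrt (G : set (set Om)) (Z : Om -> \bar R) : Prop :=
  forall B : set (\bar R), measurable B -> G (Z @^-1` B).

(* Z is a version of E[Y | G]. *)
Definition cond_exp Pr (G : set (set Om)) (Y Z : Om -> \bar R) : Prop :=
  [/\ Pr.-integrable setT Y, measurable_wrt G Z, Pr.-integrable setT Z &
      forall A, G A ->
        (\int[Pr]_(w in A) Z w = \int[Pr]_(w in A) Y w)%E].

Definition adapted F Y : Prop :=
  forall t, 0 <= t -> measurable_wrt (F t) (Y t).

Definition supermartingale Pr F Y : Prop :=
  [/\ adapted F Y,
      forall t, 0 <= t -> Pr.-integrable setT (Y t) &
      forall s t, 0 <= s -> s <= t ->
        exists2 Z, cond_exp Pr (F s) (Y t) Z &
                   {ae Pr, forall w, (Z w <= Y s w)%E}].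

Definition martingale Pr F Y : Prop :=
  [/\ adapted F Y,
      forall t, 0 <= t -> Pr.-integrable setT (Y t) &
      forall s t, 0 <= s -> s <= t -> cond_exp Pr (F s) (Y t) (Y s)].

Definition stopping_time F tau : Prop :=
  (forall w, (0 <= tau w)%E) /\
  forall t, 0 <= t -> F t [set w | (tau w <= t%:E)%E].

Definition stop_min (t : R) tau (w : Om) : R := fine (mine t%:E (tau w)).

Definition stopped (T : Type) (Y : R -> Om -> T) tau : R -> Om -> T :=
  fun t w => Y (stop_min t tau w) w.

Definition localizing Pr F (tau : nat -> Om -> \bar R) : Prop :=
  (forall n, stopping_time F (tau n)) /\
  {ae Pr, forall w, nondecreasing_seq (tau ^~ w) /\
                    (tau ^~ w) @ \oo --> +oo%E}.

Definition local_supermartingale Pr F Y : Prop :=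
  exists2 tau, localizing Pr F tau &
               forall n, supermartingale Pr F (stopped Y (tau n)).

Definition local_martingale Pr F Y : Prop :=
  exists2 tau, localizing Pr F tau &
               forall n, martingale Pr F (stopped Y (tau n)).

Definition cadlag (x : R -> R) : Prop :=
  (forall t, 0 <= t -> x @ t^'+ --> x t) /\
  (forall t, 0 < t -> cvg (x @ t^'-)).

Definition cadlag_adapted F X : Prop :=
  adapted F (fun t w => (X t w)%:E) /\ forall w, cadlag (X ^~ w).

Definition semimartingale Pr F X : Prop :=
  cadlag_adapted F X /\
  exists M A : R -> Om -> R,
    [/\ cadlag_adapted F M,
        local_martingale Pr F (fun t w => (M t w)%:E),
        cadlag_adapted F A,
        forall w t, 0 <= t -> bounded_variation 0 t (A ^~ w) &
        {ae Pr, forall w, forall t, 0 <= t -> X t w = X 0 w + M t w + A t w}].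

Definition stopped_sigma_algebra F tau : set (set Om) :=
  [set A | measurable A /\
           forall t, 0 <= t -> F t (A `&` [set w | (tau w <= t%:E)%E])].

(* The Markov property with transition kernel P, at every stopping time tau   *)
(* (deterministic times included): on {tau < oo}, the conditional law of      *)
(* X (tau + t) given F_tau is P^t (X tau).                                    *)
Definition strong_markov Pr F
    (P : R -> R.-pker (measurableTypeR R) ~> (measurableTypeR R)) X : Prop :=
  forall tau, stopping_time F tau ->
  forall t, 0 <= t -> forall B : set (measurableTypeR R), measurable B ->
    cond_exp Pr (stopped_sigma_algebra F tau)
      (fun w => (\1_[set w | (tau w < +oo)%E /\
                             B (X (fine (tau w) + t) w)] w)%:E)
      (fun w => if (tau w < +oo)%E then P t (X (fine (tau w)) w) B else 0%E).

Definition hitting_time0 X : Om -> \bar R :=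
  fun w => ereal_inf [set t%:E | t in [set t | 0 <= t /\ X t w = 0]].

(* That hitting_time0 X is a stopping time is automatic for a filtration      *)
(* satisfying the usual conditions; it is required here since these are not   *)
(* assumed. The process is \bar R-valued because the integral may be +oo.     *)
Definition lyapunov Pr F (phi : R -> R) X (V : R -> R) : Prop :=
  let tau0 := hitting_time0 X in
  stopping_time F tau0 /\
  local_supermartingale Pr F (fun t w =>
    (V (X (stop_min t tau0 w) w))%:E +
    \int[lebesgue_measure]_(s in `[0%R, stop_min t tau0 w])
      (phi (V (X s w)))%:E)%E.

End stochastic_processes.

Section rate_function.
Context (R : realType).
Implicit Type phi : R -> R.

(* The inverse is that of \bar R, for which 0^-1 = +oo. *)
Definition ePhi phi (s : R) : \bar R :=
  (\int[lebesgue_measure]_(u in `[1%R, s]) (phi u)%:E^-1)%E.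

Definition Phi phi (s : R) : R := fine (ePhi phi s).

Definition Psi phi : R -> R := 'pinv_(fun=> 1) `[1, +oo[ (Phi phi).

Definition Gfun phi (t u : R) : R := Psi phi (Phi phi u + t).

End rate_function.

Section measures_on_the_half_line.
Context (R : realType).
Local Notation RR := (measurableTypeR R).
Local Notation Rp := (`[0%R, +oo[%classic : set RR).
Implicit Types (mu : {measure set RR -> \bar R}) (rho : probability RR R).

Definition on_half_line mu : Prop := mu (~` Rp) = 0%E.

Definition pairing mu (f : R -> R) : \bar R := (\int[mu]_(x in Rp) (f x)%:E)%E.

(* || mu1 - mu2 ||_U. Restricting to f integrable for both measures makes     *)
(* (mu1 - mu2, f) = (mu1, f) - (mu2, f) meaningful and loses nothing: the     *)
(* supremum is already reached, or +oo approached, along bounded f.           *)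
Definition wnorm_diff (U : R -> R) mu1 mu2 : \bar R :=
  ereal_sup [set `|pairing mu1 f - pairing mu2 f|%E | f in
    [set f : R -> R | [/\ measurable_fun Rp (f : RR -> RR),
       forall x, 0 <= x -> `|f x| <= U x,
       mu1.-integrable Rp (EFin \o f) & mu2.-integrable Rp (EFin \o f)]]].

Section action.
Context (k : R.-pker RR ~> RR) (rho : probability RR R).

(* rho k, the law obtained from rho after one transition of k *)
Definition kact (B : set RR) : \bar R := (\int[rho]_(x in Rp) k x B)%E.

Let kact0 : kact set0 = 0%E.
Proof. by rewrite /kact; under eq_integral do rewrite measure0; rewrite integral0. Qed.

Let kact_ge0 B : (0 <= kact B)%E.
Proof. by apply: integral_ge0. Qed.

Let kact_sigma_additive : semi_sigma_additive kact.
Proof.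
move=> B mB tB mUB; rewrite [X in _ --> X](_ : _ =
    (\int[rho]_(x in Rp) (\sum_(n <oo) k x (B n)))%E); last first.
  apply: eq_integral => x _; apply/esym/cvg_lim => //.
  exact: measure_semi_sigma_additive.
rewrite (integral_nneseries rho)//.
- apply: is_cvg_nneseries => n _ _; exact: kact_ge0.
- move=> n; apply: measurable_funS (measurable_kernel k _ (mB n)) => //.
Qed.

HB.instance Definition _ :=
  isMeasure.Build _ RR R kact kact0 kact_ge0 kact_sigma_additive.

End action.

Definition stationary (P : R -> R.-pker RR ~> RR) rho : Prop :=
  forall t, 0 < t -> forall B, measurable B -> kact (P t) rho B = rho B.

Definition stochastically_ordered (P : R -> R.-pker RR ~> RR) : Prop :=
  forall t : R, 0 <= t -> forall x y z : R, 0 <= x -> x <= y -> 0 <= z ->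
    (P t x `[z, +oo[%classic <= P t y `[z, +oo[%classic)%E.

(* rho = rho1 \/ rho2; this determines rho among the laws on R_+. *)
Definition is_stoch_max rho1 rho2 rho : Prop :=
  on_half_line rho /\
  forall x : R, 0 <= x ->
    rho `]x, +oo[%classic =
    maxe (rho1 `]x, +oo[%classic) (rho2 `]x, +oo[%classic).

End measures_on_the_half_line.

(* Main.v *)
(* For x1 <= x2 let X be the copy started from x2 and tau its hitting time of 0.
   By the Markov property at tau and the stochastic order, the law of X t
   restricted to {tau <= t} is dominated by P^t(x1, .): this plays the part of a
   coupling of the two copies that merge at tau. Hence the two laws at time t
   differ only through {t < tau}, up to a remainder that the order bounds by the
   same quantity, and the U-distance is at most 2 E[U(X t); t < tau].

   On the other hand E[G(t, V(X t)); t < tau] <= V(x2). No Ito formula is needed: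
   u -> G(t, u) has the supporting line of slope phi(G(t, u)) / phi(u) at u, so
   that the supermartingale property on a short interval controls the increment of
   s -> E[G(s, V(X s)); s < tau] by an error that vanishes after averaging in s.
   Since h U <= G(., V), this is (a).

   The laws rho1 and rho2 are coupled through their quantile functions, whose
   maximum is the quantile function of rho1 \/ rho2: this is (b), and (c) is the
   case of a stationary rho2. *)
Require Import Defs.
From HB Require Import structures.
From mathcomp Require Import all_boot all_order all_algebra.
From mathcomp Require Import all_classical all_reals all_analysis measurable_realfun.
From mathcomp Require Import ring lra.

Set Implicit Arguments.
Unset Strict Implicit.
Unset Printing Implicit Defensive.

Import Order.TTheory GRing.Theory Num.Theory.
Import numFieldNormedType.Exports.

Local Open Scope classical_set_scope.
Local Open Scope ring_scope.

(** * The rate function *)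

(** [V] is only measurable, so s -> V(X s) need not have any path regularity, and its drift phi(V(X
    s)) cannot be compared with its values just after s for every s. The comparison holds at
    Lebesgue points of the drift, which is why the increments of s -> E[G(s, V(X s)); s < tau] are
    integrated over s before the step tends to 0. The slope phi(G(t, V)) / phi(V) has phi(V) in its
    denominator; on {s < tau} the state is positive and so is phi(V(X s)).

    The stochastic order compares kernels at a fixed time and provides no joint law of two paths.
    The domination by P^t(x1, .) is therefore proved along time grids, on which tau is completed by
    deterministic lags, and then passed to the limit by right-continuity. It is obtained on
    intervals ]a, b], which is enough to subtract the two measures. *)

Lemma measurable_inv_ge0 d (T : measurableType d) (R : realType) (D : set T)
    (f : T -> R) : measurable_fun D f -> (forall x, D x -> 0 <= f x) ->
  measurable_fun D (fun x => (f x)^-1).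
Proof.
move=> mf f0; apply: (@eq_measurable_fun _ _ _ _ _ (fun x => f x `^ (-1))).
  by move=> x; rewrite inE => Dx; rewrite powR_inv1// f0.
exact: measurableT_comp (measurable_powR _) mf.
Qed.

(** Precomposition with [Num.max a] turns f into a function that is nondecreasing on the whole line.
    The same clamping serves throughout to pass from a half-line to R. *)
Lemma measurable_nondecreasing_on (R : realType) (a : R) (f : R -> R) :
  (forall x y, a <= x -> x <= y -> f x <= f y) ->
  measurable_fun (`[a, +oo[%classic : set (measurableTypeR R)) f.
Proof.
move=> fnd; apply: (@eq_measurable_fun _ _ _ _ _ (fun x => f (Num.max a x))).
  by move=> x; rewrite inE/= in_itv/= andbT => ax; rewrite max_r.
apply: nondecreasing_measurable => // x y xy; apply: fnd.
  by rewrite le_max lexx.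
by rewrite ge_max !le_max lexx/= xy orbT.
Qed.

Lemma measurable_comp_on d (T : measurableType d) (R : realType) (a : R)
    (f : R -> R) (g : T -> R) :
  measurable_fun (`[a, +oo[%classic : set (measurableTypeR R)) f ->
  measurable_fun setT g -> (forall x, a <= g x) ->
  measurable_fun setT (fun x => f (g x)).
Proof.
move=> mf mg ag.
have := @measurable_comp _ _ _ T (measurableTypeR R) (measurableTypeR R)
  `[a, +oo[%classic f setT g.
by apply => // _ [x _ <-]; rewrite /= in_itv/= andbT.
Qed.

Section rate_function_theory.
Context (R : realType) (phi : R -> R).
Hypothesis phi_ge0 : forall u : R, 1 <= u -> 0 <= phi u.
Hypothesis phi_concave :
  convex_function (`[1, +oo[%classic : set R) (fun u => - phi u).
Hypothesis phi_incr : forall u v : R, 1 <= u -> u <= v -> phi u <= phi v.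
Hypothesis Phi_fin : forall s : R, 1 < s -> (ePhi phi s < +oo)%E.

Let mu := @lebesgue_measure R.

(** Concavity cleared of its denominator: b is the barycentre of a and c with weights proportional
    to c - b and b - a. This form is linear in the values of phi and remains meaningful when a =
    c. *)
Lemma phi_three_points (a b c : R) : 1 <= a -> a <= b -> b <= c ->
  (c - b) * phi a + (b - a) * phi c <= (c - a) * phi b.
Proof.
move=> a1 ab bc; have [ca|ac] := leP c a.
  have -> : b = a by lra.
  have -> : c = a by lra.
  by rewrite !subrr !mul0r addr0.
pose t := (c - b) / (c - a).
have t0 : 0 <= t by rewrite divr_ge0//; lra.
have t1 : t <= 1 by rewrite ler_pdivrMr; lra.
have /= := @phi_concave (@Itv01 R t t0 t1) a c.
rewrite !inE/= !in_itv/= !andbT => /(_ a1 ltac:(lra)).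
have -> : conv (Itv01 t0 t1) (a : convex_lmodType R^o) c = b.
  by rewrite /conv/= /t/= /GRing.scale/= /unstable.onem; field; lra.
rewrite convRE/= /unstable.onem => H.
have E : (c - a) * t = c - b by rewrite /t; field; lra.
have E' : b - a = (c - a) * (1 - t) by rewrite mulrBr E; ring.
clearbody t; rewrite -E E' -!mulrA -mulrDr ler_wpM2l//; lra.
Qed.

(** A zero of phi at u > 1 would force phi = 0 on [1, u] by monotonicity, and the integrand of
    [ePhi] would be +oo on an interval of positive length. *)
Lemma phi_gt0 (u : R) : 1 < u -> 0 < phi u.
Proof.
move=> u1; rewrite lt_neqAle phi_ge0 ?ltW// andbT eq_sym.
apply/eqP => phiu; have := Phi_fin u1; rewrite /ePhi.
suff -> : (\int[mu]_(v in `[1%R, u]) (phi v)%:E^-1 = +oo)%E by rewrite ltxx.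
rewrite (eq_integral (cst +oo%E)); last first.
  move=> v; rewrite inE/= in_itv/= => /andP[v1 vu].
  have -> : phi v = 0.
    by apply/eqP; rewrite eq_le phi_ge0// andbT -phiu phi_incr.
  by rewrite inver eqxx.
rewrite integral_cst//= lebesgue_measure_itv/= lte_fin u1.
by rewrite -EFinD mulyr gtr0_sg ?mul1e// subr_gt0.
Qed.

(** Beyond 2 the graph of a concave function lies below the line through its points at 1 and 2. The
    constant is phi 2 since phi 1 may vanish. *)
Lemma phi_growth (u : R) : 1 <= u -> phi u <= phi 2 * u.
Proof.
move=> u1; have p2 := phi_gt0 (_ : 1 < 2).
have [u2|u2] := leP u 2.
  have := phi_incr u1 u2; have := p2 ltac:(lra); nra.
have := @phi_three_points 1 2 u (lexx _) ltac:(lra) (ltW u2).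
have := phi_ge0 (lexx 1); have := p2 ltac:(lra); nra.
Qed.

Lemma measurable_phi :
  measurable_fun (`[1, +oo[%classic : set (measurableTypeR R)) phi.
Proof. exact: measurable_nondecreasing_on. Qed.

Lemma measurable_phiV (A : set R) : measurable A -> A `<=` `[1, +oo[ ->
  measurable_fun A (fun u => (phi u)^-1).
Proof.
move=> mA A1; apply: measurable_inv_ge0.
  exact: measurable_funS measurable_phi.
by move=> x /A1/=; rewrite in_itv/= andbT; exact: phi_ge0.
Qed.

(** The inverses in [\bar R] and in R differ only at zeros of phi, and the only possible zero in
    [1, s] is the endpoint 1, a null set. *)
Lemma ePhiE (s : R) : 1 <= s ->
  ePhi phi s = (\int[mu]_(u in `[1%R, s]) ((phi u)^-1)%:E)%E.
Proof.
move=> s1; have invE : {in `]1%R, s]%classic,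
    (fun u => (phi u)%:E^-1)%E =1 (fun u => ((phi u)^-1)%:E)}.
  move=> u; rewrite inE/= in_itv/= => /andP[u1 _].
  by rewrite inver gt_eqF// phi_gt0.
have mV : measurable_fun `]1%R, s] (fun u => ((phi u)^-1)%:E).
  apply/measurable_EFinP; apply: measurable_phiV => [|u/=]; [exact: measurable_itv|]; rewrite !in_itv/= andbT.
  by case/andP=> /ltW.
rewrite /ePhi -!integral_itv_obnd_cbnd//; first exact: eq_integral.
by apply: eq_measurable_fun mV => u us; rewrite invE.
Qed.

Let itv1 (s : R) : `[1, s] `<=` `[1, +oo[.
Proof. by apply: subset_itvl; rewrite bnd_simp. Qed.

Let phiV_ge0 (s u : R) : `[1, s]%classic u -> (0 <= ((phi u)^-1)%:E)%E.
Proof.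
by rewrite /= in_itv/= => /andP[u1 _]; rewrite lee_fin invr_ge0 phi_ge0.
Qed.

Lemma ePhi_fin (s : R) : 1 <= s -> ePhi phi s \is a fin_num.
Proof.
move=> s1; rewrite ge0_fin_numE.
  move: s1; rewrite le_eqVlt => /predU1P[<-|/Phi_fin//].
  by rewrite /ePhi set_itv1 integral_set1.
rewrite ePhiE//; apply: integral_ge0 => u; exact: phiV_ge0.
Qed.

Lemma Phi1 : Phi phi 1 = 0.
Proof. by rewrite /Phi /ePhi set_itv1 integral_set1. Qed.

Lemma PhiB (a b : R) : 1 <= a -> a <= b ->
  ((Phi phi b - Phi phi a)%:E = \int[mu]_(u in `]a, b]) ((phi u)^-1)%:E)%E.
Proof.
move=> a1 ab; have b1 := le_trans a1 ab.
rewrite EFinB /Phi !fineK ?ePhi_fin// !ePhiE//.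
have U : `[1, b]%classic = `[1, a] `|` `]a, b].
  by apply: itv_bndbnd_setU; rewrite bnd_simp.
rewrite U ge0_integral_setU//=.
- by rewrite addeAC subee ?add0e// -ePhiE// ePhi_fin.
- by rewrite -U; apply/measurable_EFinP; exact: measurable_phiV.
- by move=> u; rewrite -[_ \/ _]/((`[1, a] `|` `]a, b]) u) -U; exact: phiV_ge0.
- apply/disj_setPRL => u/=; rewrite !in_itv/= => /andP[au _].
  by apply/negP; rewrite negb_and -!ltNge au orbT.
Qed.

Lemma PhiB_ge (a b : R) : 1 <= a -> a <= b -> 0 < phi b ->
  (b - a) / phi b <= Phi phi b - Phi phi a.
Proof.
move=> a1 ab pb; rewrite -lee_fin PhiB//.
have -> : ((b - a) / phi b)%:E = (\int[mu]_(u in `]a, b]) ((phi b)^-1)%:E)%E.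
  rewrite integral_cst//= lebesgue_measure_itv/= lte_fin.
  case: ltP => ab'; first by rewrite -EFinD -EFinM mulrC.
  by have -> : b = a by [lra|]; rewrite subrr mul0r mule0.
apply: ge0_le_integral => //.
- by move=> u _; rewrite lee_fin invr_ge0 ltW.
- apply/measurable_EFinP; apply: measurable_phiV => [|u/=]; [exact: measurable_itv|]; rewrite !in_itv/=.
  by case/andP => au _; rewrite andbT; lra.
- move=> u; rewrite /= in_itv/= => /andP[au ub]; rewrite lee_fin.
  by rewrite lef_pV2 ?posrE ?phi_incr ?phi_gt0//; lra.
Qed.

Lemma PhiB_le (a b : R) : 1 <= a -> a <= b -> 0 < phi a ->
  Phi phi b - Phi phi a <= (b - a) / phi a.
Proof.
move=> a1 ab pa; rewrite -lee_fin PhiB//.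
have -> : ((b - a) / phi a)%:E = (\int[mu]_(u in `]a, b]) ((phi a)^-1)%:E)%E.
  rewrite integral_cst//= lebesgue_measure_itv/= lte_fin.
  case: ltP => ab'; first by rewrite -EFinD -EFinM mulrC.
  by have -> : b = a by [lra|]; rewrite subrr mul0r mule0.
apply: ge0_le_integral => //.
- move=> u; rewrite /= in_itv/= => /andP[au _]; rewrite lee_fin invr_ge0.
  by rewrite phi_ge0//; lra.
- apply/measurable_EFinP; apply: measurable_phiV => [|u/=]; [exact: measurable_itv|]; rewrite !in_itv/=.
  by case/andP => au _; rewrite andbT; lra.
- move=> u; rewrite /= in_itv/= => /andP[au ub]; rewrite lee_fin.
  by rewrite lef_pV2 ?posrE ?pa ?phi_incr ?phi_gt0//; lra.
Qed.

Lemma Phi_lt (a b : R) : 1 <= a -> a < b -> Phi phi a < Phi phi b.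
Proof.
move=> a1 ab; have pb : 0 < phi b by rewrite phi_gt0//; lra.
rewrite -subr_gt0; apply: lt_le_trans (PhiB_ge a1 (ltW ab) pb).
by rewrite divr_gt0// subr_gt0.
Qed.

Lemma Phi_le (a b : R) : 1 <= a -> 1 <= b ->
  (Phi phi a <= Phi phi b) = (a <= b).
Proof.
move=> a1 b1; have [|ba] := leP a b.
  by rewrite le_eqVlt => /predU1P[->|/(Phi_lt a1)/ltW//]; rewrite lexx.
by apply/negbTE; rewrite -ltNge Phi_lt.
Qed.

Lemma Phi_ge0 (u : R) : 1 <= u -> 0 <= Phi phi u.
Proof. by move=> u1; rewrite -Phi1 Phi_le. Qed.

Lemma Phi_unbounded (y : R) : exists2 s, 1 <= s & y <= Phi phi s.
Proof.
have p2 : 0 < phi 2 by apply: phi_gt0; lra.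
(* Between 2^n and 2^(n+1) the function 1/phi is at least 1/(2^(n+1) phi 2). *)
have H n : n%:R / (2 * phi 2) <= Phi phi (2 ^+ n).
  elim: n => [|n IH]; first by rewrite mul0r expr0 Phi1.
  have n1 : 1 <= 2 ^+ n :> R by rewrite exprn_ege1//; lra.
  have nn : 2 ^+ n <= 2 ^+ n.+1 :> R by rewrite exprS; nra.
  have n2 : 1 < 2 ^+ n.+1 :> R by rewrite exprS; nra.
  have := PhiB_ge n1 nn (phi_gt0 n2).
  have := phi_growth (ltW n2); have := phi_gt0 n2.
  set q := phi (2 ^+ n.+1) => q0 qle.
  have -> : 2 ^+ n.+1 - 2 ^+ n = 2 ^+ n :> R by rewrite exprS; ring.
  suff : (2 * phi 2)^-1 <= 2 ^+ n / q.
    rewrite -[n.+1%:R]natr1 (mulrDl n%:R) mul1r.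
    by move: IH; set k := (2 * phi 2)^-1; lra.
  rewrite ler_pdivlMr// mulrC ler_pdivrMr ?mulr_gt0//.
  by move: qle; rewrite exprS; lra.
have [n ny] : exists n : nat, y * (2 * phi 2) <= n%:R.
  exists (Num.truncn (`|y * (2 * phi 2)|)).+1.
  apply: le_trans (ler_norm _) (ltW _); exact: truncnS_gt.
exists (2 ^+ n); first by rewrite exprn_ege1//; lra.
apply: le_trans (H n); rewrite ler_pdivlMr// mulr_gt0//.
Qed.

Lemma Phi_surj (y : R) : 0 <= y -> exists2 s, 1 <= s & Phi phi s = y.
Proof.
move=> y0; have [s s1 ys] := Phi_unbounded y.
have int_phiV : mu.-integrable `[1, s] (EFin \o (fun u => (phi u)^-1)).
  apply/integrableP; split.
    apply/measurable_EFinP; exact: measurable_phiV.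
  rewrite (_ : integral _ _ _ = ePhi phi s) ?ltey_eq ?ePhi_fin//.
  rewrite ePhiE//; apply: eq_integral => u; rewrite inE => /phiV_ge0 u0.
  by rewrite /= ger0_norm// -lee_fin.
have PhiE u : 1 <= u -> parameterized_integral mu 1 u (fun u => (phi u)^-1)
    = Phi phi u.
  by move=> u1; rewrite /parameterized_integral /Rintegral /Phi ePhiE.
have := IVT s1 (parameterized_integral_continuous s1 int_phiV) (v := y).
rewrite !PhiE// Phi1 min_l ?max_r ?Phi_ge0// y0 ys => /(_ isT)[c].
by rewrite in_itv/= => /andP[c1 _]; rewrite PhiE// => <-; exists c.
Qed.

(** [Phi phi] is injective on [1, +oo[ and maps it onto [0, +oo[, so for y >= 0 the default value of
    the partial inverse does not intervene. *)
Lemma Psi_ge1 (y : R) : 0 <= y -> 1 <= Psi phi y.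
Proof.
move=> /Phi_surj[s s1 <-].
have /= := @pinvKV _ _ (fun=> 1) `[1, +oo[%classic (Phi phi).
rewrite /Psi => ->//.
  move=> a b; rewrite !inE/= !in_itv/= !andbT => a1 b1 ab.
  by apply/eqP; rewrite eq_le -(Phi_le a1 b1) -(Phi_le b1 a1) ab lexx.
by rewrite inE/= in_itv/= andbT.
Qed.

Lemma PsiK (y : R) : 0 <= y -> Phi phi (Psi phi y) = y.
Proof.
move=> y0; rewrite /Psi pinvK// inE/=.
by have [s s1 <-] := Phi_surj y0; exists s; rewrite //= in_itv/= andbT.
Qed.

Section flow.
Variables (t u : R).
Hypotheses (t0 : 0 <= t) (u1 : 1 <= u).

Lemma Phi_G : Phi phi (Gfun phi t u) = Phi phi u + t.
Proof. by rewrite /Gfun PsiK// addr_ge0// Phi_ge0. Qed.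

Lemma G_ge1 : 1 <= Gfun phi t u.
Proof. by rewrite /Gfun Psi_ge1// addr_ge0// Phi_ge0. Qed.

Lemma G_ge : u <= Gfun phi t u.
Proof. by rewrite -Phi_le ?G_ge1// Phi_G lerDl. Qed.

End flow.

Lemma G_le (s t u v : R) : 0 <= s -> s <= t -> 1 <= u -> u <= v ->
  Gfun phi s u <= Gfun phi t v.
Proof.
move=> s0 st u1 uv; have v1 := le_trans u1 uv; have t0 := le_trans s0 st.
by rewrite -Phi_le ?G_ge1// !Phi_G// lerD// Phi_le.
Qed.

Lemma G0 (u : R) : 1 <= u -> Gfun phi 0 u = u.
Proof.
move=> u1; have g1 := G_ge1 (lexx 0) u1.
by apply/eqP; rewrite eq_le -(Phi_le g1 u1) -(Phi_le u1 g1) Phi_G// addr0 lexx.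
Qed.

(** The time derivative of G(., u) is phi(G(., u)), which is nondecreasing in time, so its value at
    the right end bounds the increment. [PhiB_ge] is the integrated form of this. *)
Lemma G_time (s d u : R) : 0 <= s -> 0 <= d -> 1 <= u ->
  Gfun phi (s + d) u <= Gfun phi s u + d * phi (Gfun phi (s + d) u).
Proof.
move=> s0 d0 u1; have sd0 : 0 <= s + d by rewrite addr_ge0.
have [d00|dn0] := eqVneq d 0; first by rewrite d00 mul0r !addr0.
have Gle : Gfun phi s u <= Gfun phi (s + d) u by rewrite G_le// lerDl.
(* Positivity of phi at G(s + d, u) needs this value to exceed 1; it does because d > 0, even if u =
   1. *)
have G1 : 1 < Gfun phi (s + d) u.
  rewrite ltNge; apply/negP => G1.
  have : Phi phi (Gfun phi (s + d) u) = 0.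
    by have -> : Gfun phi (s + d) u = 1; [apply/eqP; rewrite eq_le G1 G_ge1|exact: Phi1].
  by rewrite Phi_G// => H; have := Phi_ge0 u1; move/eqP: dn0; lra.
have := PhiB_ge (G_ge1 s0 u1) Gle (phi_gt0 G1).
rewrite !Phi_G// ler_pdivrMr ?phi_gt0//; nra.
Qed.

(* Any difference function whose increments are controlled on both sides by a
   bounded monotone rate q, up to a telescoping error, is nonnegative. *)
Lemma telescope_ge0 (D q : R -> R) (w : R) : 0 <= w ->
  (forall y z, 0 <= y -> y <= z -> z <= w ->
     (z - y) * (q z - q y) <= D z - D y) -> D 0 <= D w.
Proof.
move=> w0 H.
have step n : (w / n.+1%:R) * (q w - q 0) <= D w - D 0.
  pose x k : R := w * (k%:R / n.+1%:R).
  have n0 : 0 < n.+1%:R :> R by rewrite ltr0n.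
  have xS k : x k.+1 - x k = w / n.+1%:R.
    by rewrite /x -[in k.+1%:R]addn1 natrD; field; lra.
  have : forall k, (k <= n.+1)%N ->
      (w / n.+1%:R) * (q (x k) - q 0) <= D (x k) - D 0.
    elim=> [|k IH kn]; first by rewrite /x mul0r mulr0 !subrr mulr0.
    have x0 : 0 <= x k by rewrite mulr_ge0// divr_ge0.
    have xl : x k <= x k.+1 by rewrite -subr_ge0 xS divr_ge0// ltW.
    have xw : x k.+1 <= w.
      by rewrite ler_piMr// ler_pdivrMr// mul1r ler_nat.
    have := H _ _ x0 xl xw; rewrite xS; have := IH (ltnW kn).
    by move: (w / n.+1%:R) => e; rewrite !mulrBr; lra.
  move=> /(_ n.+1 (leqnn _)).
  by rewrite /x divff ?mulr1// gt_eqF.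
rewrite -subr_ge0 leNgt; apply/negP => Dn.
have [n nH] : exists n : nat, w * `|q w - q 0| / (D 0 - D w) < n.+1%:R.
  exists (Num.truncn (w * `|q w - q 0| / (D 0 - D w))).
  exact: truncnS_gt.
have := step n; move: nH; rewrite ltr_pdivrMr; last lra.
have n0 : 0 < n.+1%:R :> R by rewrite ltr0n.
rewrite mulrAC.
rewrite ler_pdivrMr//.
have := ler_norm (- (q w - q 0)); rewrite normrN.
nra.
Qed.

(** * Supporting lines of u -> G(t, u) *)

Section supporting_line.
Variables (t u a c : R).
Hypotheses (t0 : 0 <= t) (u1 : 1 <= u) (phiu : 0 < phi u).
Hypotheses (aE : a = Gfun phi t u) (cE : c * phi u = phi a).

Let a1 : 1 <= a. Proof. by rewrite aE G_ge1. Qed.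
Let ua : u <= a. Proof. by rewrite aE G_ge. Qed.
Let phia : 0 < phi a. Proof. exact: lt_le_trans phiu (phi_incr u1 ua). Qed.
Let c1 : 1 <= c. Proof. by rewrite -(ler_pM2r phiu) mul1r cE phi_incr. Qed.
Let Phia : Phi phi a = Phi phi u + t. Proof. by rewrite aE Phi_G. Qed.

Let right_le (z : R) : 0 <= z -> phi (a + c * z) <= c * phi (u + z).
Proof.
have [[a1' ua'] [c1' u1']] := ((a1, ua), (c1, u1)).
rewrite le_eqVlt => /predU1P[<-|z0]; first by rewrite mulr0 !addr0 cE.
have cz : z <= c * z by rewrite ler_peMl// ltW.
(* chord slopes of phi: [u, u+z] lies to the left of [a, a+cz] *)
have h1 := @phi_three_points u (u + z) (a + c * z) u1 ltac:(lra) ltac:(lra).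
have h2 := @phi_three_points u a (a + c * z) u1 ua ltac:(lra).
have := phi_incr u1 ua.
set P := phi (a + c * z) in h1 h2 *; set Q := phi (u + z) in h1 *.
move: h1 h2; rewrite -cE => h1 h2 h3.
pose L := a + c * z - u; have L0 : 0 < L by rewrite /L; lra.
have e1 : z * (P - phi u) <= L * (Q - phi u) by rewrite /L; lra.
have e2 : L * (P - c * phi u) <= c * z * (P - phi u) by rewrite /L; lra.
have e3 : L * (P - c * phi u) <= L * (c * (Q - phi u)).
  apply: (le_trans e2); have := ler_wpM2l (_ : 0 <= c) e1; move=> /(_ ltac:(lra)); lra.
by move: e3; rewrite ler_pM2l//; lra.
Qed.

(** Mirror image of [right_le]. The chord slopes are comparable as long as the point to the left of
    a has not passed the one to the left of u. *)
Let left_ge (z : R) : 0 <= z -> 1 <= u - z -> u - z <= a - c * z ->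
  c * phi (u - z) <= phi (a - c * z).
Proof.
have [[a1' ua'] [c1' u1']] := ((a1, ua), (c1, u1)).
rewrite le_eqVlt => /predU1P[<-|z0]; first by rewrite mulr0 !subr0 cE.
move=> uz1 uaz; have cz : z <= c * z by rewrite ler_peMl// ltW.
have h1 := @phi_three_points (u - z) u a uz1 ltac:(lra) ua.
have h2 := @phi_three_points (u - z) (a - c * z) a uz1 uaz ltac:(lra).
set P := phi (a - c * z) in h2 *; set Q := phi (u - z) in h1 h2 *.
move: h1 h2; rewrite -cE => h1 h2.
pose L := a - (u - z); have L0 : 0 < L by rewrite /L; lra.
have e1 : z * (c * phi u - Q) <= L * (phi u - Q) by rewrite /L; lra.
have e2 : L * (c * phi u - P) <= c * z * (c * phi u - Q) by rewrite /L; lra.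
have e3 : L * (c * phi u - P) <= L * (c * (phi u - Q)).
  apply: (le_trans e2); have := ler_wpM2l (_ : 0 <= c) e1; move=> /(_ ltac:(lra)); lra.
by move: e3; rewrite ler_pM2l//; lra.
Qed.

(** D y = Phi(a + c y) - Phi(u + y) equals t at y = 0 and does not decrease: by [right_le] the first
    term grows at least as fast as the second. At y = v - u this says Phi(a + c (v - u)) >= Phi v +
    t = Phi(G(t, v)), and Phi is increasing. *)
Let G_chord_right (v : R) : u <= v -> Gfun phi t v <= a + c * (v - u).
Proof.
have [[a1' ua'] [c1' u1']] := ((a1, ua), (c1, u1)).
move=> uv; have v1 := le_trans u1 uv.
have cvu : 0 <= c * (v - u) by apply: mulr_ge0; lra.
rewrite -Phi_le ?G_ge1//; last by lra.
rewrite Phi_G//.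
pose D y := Phi phi (a + c * y) - Phi phi (u + y).
have : D 0 <= D (v - u).
  apply: (@telescope_ge0 _ (fun y => (phi (u + y))^-1)); first lra.
  move=> y z y0 yz zw; rewrite /D.
  have pz : 0 < phi (u + z).
    by apply: lt_le_trans phiu _; apply: phi_incr; lra.
  have py : 0 < phi (u + y).
    by apply: lt_le_trans phiu _; apply: phi_incr; lra.
  have cy : 0 <= c * y by rewrite mulr_ge0//; lra.
  have cyz : c * y <= c * z by rewrite ler_wpM2l//; lra.
  have pcz : 0 < phi (a + c * z).
    by apply: lt_le_trans phia _; apply: phi_incr; lra.
  have h1 := @PhiB_ge (a + c * y) (a + c * z) ltac:(lra) ltac:(lra) pcz.
  have h2 := @PhiB_le (u + y) (u + z) ltac:(lra) ltac:(lra) py.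
  have h3 : (z - y) / phi (u + z) <= (a + c * z - (a + c * y)) / phi (a + c * z).
    rewrite ler_pdivrMr// mulrAC ler_pdivlMr//.
    have := right_le (le_trans y0 yz); nra.
  move: h2; have -> : u + z - (u + y) = z - y by ring.
  lra.
rewrite /D mulr0 !addr0 Phia; have -> : u + (v - u) = v by ring.
lra.
Qed.

Let G_chord_left (v : R) : 1 < v -> v <= u -> Gfun phi t v <= a + c * (v - u).
Proof.
have [[a1' ua'] [c1' u1']] := ((a1, ua), (c1, u1)).
move=> v1 vu; have [uva|] := leP v (a + c * (v - u)); last first.
(* The two rays from u and a would cross at a point p > v, forcing c = 1. *)
  move=> av; exfalso.
  have c1_lt : 1 < c.
    rewrite ltNge; apply/negP => cle; have cc : c = 1 by lra.
    by move: av; rewrite cc; lra.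
  pose z := (a - u) / (c - 1).
  have z0 : 0 <= z by rewrite divr_ge0//; lra.
  have zE : z * (c - 1) = a - u by rewrite /z divfK//; lra.
  have zw : z < u - v by rewrite /z ltr_pdivrMr; [nra|lra].
  have := @left_ge z z0 ltac:(lra) ltac:(lra).
  have -> : a - c * z = u - z by lra.
  have : 0 < phi (u - z) by apply: phi_gt0; lra.
  nra.
have b1 := G_ge1 t0 (ltW v1).
rewrite -Phi_le//; last by lra.
rewrite Phi_G//; last exact: ltW.
pose D y := Phi phi (a - c * y) - Phi phi (u - y).
have : D 0 <= D (u - v).
  apply: (@telescope_ge0 _ (fun y => - (phi (u - y))^-1)); first lra.
  move=> y z y0 yz zw; rewrite /D.
  have lin x : 0 <= x -> x <= u - v -> u - x <= a - c * x by move=> *; nra.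
  have pz : 0 < phi (u - z) by apply: phi_gt0; lra.
  have py : 0 < phi (u - y) by apply: phi_gt0; lra.
  have lz := lin z ltac:(lra) ltac:(lra).
  have cyz : c * y <= c * z by rewrite ler_wpM2l//; lra.
  have pcz : 0 < phi (a - c * z) by apply: phi_gt0; lra.
  have h1 := @PhiB_le (a - c * z) (a - c * y) ltac:(lra) ltac:(lra) pcz.
  have h2 := @PhiB_ge (u - z) (u - y) ltac:(lra) ltac:(lra) py.
  have h3 : (a - c * y - (a - c * z)) / phi (a - c * z) <= (z - y) / phi (u - z).
    rewrite ler_pdivrMr// mulrAC ler_pdivlMr//.
    have := @left_ge z ltac:(lra) ltac:(lra) lz; nra.
  move: h2; have -> : u - y - (u - z) = z - y by ring.
  lra.
rewrite /D mulr0 !subr0 Phia.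
have -> : u - (u - v) = v by ring.
have -> : a - c * (u - v) = a + c * (v - u) by ring.
lra.
Qed.

Lemma G_chord (v : R) : 1 <= v -> Gfun phi t v <= a + c * (v - u).
Proof.
have [[a1' ua'] [c1' u1']] := ((a1, ua), (c1, u1)).
move=> v1; have [/G_chord_right//|vu] := leP u v.
apply/ler_addgt0Pr => e e0.
(* For v = 1 phi v may be 0, so v is moved to a point w > v; a displacement of at most e / c raises
   the line by at most e. *)
pose w := Num.min u (v + e / c).
have c0 : 0 < c by lra.
have ec : 0 < e / c by rewrite divr_gt0.
have vw : v < w by rewrite lt_min vu ltrDl.
have wu : w <= u by rewrite ge_min lexx.
have we : w <= v + e / c by rewrite ge_min lexx orbT.
apply: (@le_trans _ _ (Gfun phi t w)).
  by apply: G_le => //; exact: ltW.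
apply: (le_trans (@G_chord_left w ltac:(lra) wu)).
have : c * w <= c * (v + e / c) by rewrite ler_pM2l.
have -> : c * (v + e / c) = c * v + e by rewrite mulrDr mulrCA divff ?mulr1// gt_eqF.
by rewrite !mulrBr; lra.
Qed.

End supporting_line.

(** Differentiating Phi(G(t, u)) = Phi u + t in u gives the slope phi(G(t, u)) / phi u; the
    inequality is the concavity of G(t, .). *)
Lemma G_supporting_line (t u v : R) : 0 <= t -> 1 <= u -> 0 < phi u -> 1 <= v ->
  Gfun phi t v <= Gfun phi t u + phi (Gfun phi t u) / phi u * (v - u).
Proof.
move=> t0 u1 phiu v1; apply: G_chord => //.
by rewrite divfK// gt_eqF.
Qed.

(** The supporting line is taken at 2, where phi is positive. Linear growth is what transfers the
    integrability of V(X s) to G(t, V(X s)). *)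
Lemma G_growth (t : R) : 0 <= t ->
  exists2 C, 0 <= C & forall v, 1 <= v -> Gfun phi t v <= C * v.
Proof.
move=> t0; have p2 : 0 < phi 2 by apply: phi_gt0; lra.
have G2 := @G_ge1 t 2 t0 ltac:(lra).
pose c := phi (Gfun phi t 2) / phi 2.
have c0 : 0 <= c by apply: divr_ge0; [exact: phi_ge0|exact: ltW].
exists (Gfun phi t 2 + c); first by lra.
move=> v v1; have := @G_supporting_line t 2 v t0 ltac:(lra) p2 v1.
rewrite -/c; nra.
Qed.

End rate_function_theory.

(** * Measurability and integration *)

Section measure_helpers.
Local Open Scope ereal_scope.
Context {R : realType}.

Import HBNNSimple.

(** Extension from indicators to nonnegative functions, by simple functions and monotone convergence
    under both integrals. With Dirac masses for l1 or l2 the same statement yields the transport of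
    integrals by push-forwards, by kernels and by the Markov property. *)
Lemma eq_ge0_integral_mixture d1 d2 d (Y1 : measurableType d1)
    (Y2 : measurableType d2) (Z : measurableType d)
    (m1 : {measure set Y1 -> \bar R}) (m2 : {measure set Y2 -> \bar R})
    (l1 : Y1 -> {measure set Z -> \bar R}) (l2 : Y2 -> {measure set Z -> \bar R})
    (D1 : set Y1) (D2 : set Y2) (f : Z -> \bar R) :
  measurable D1 -> measurable D2 ->
  (forall B, measurable B -> measurable_fun [set: Y1] (l1 ^~ B)) ->
  (forall B, measurable B -> measurable_fun [set: Y2] (l2 ^~ B)) ->
  (forall B, measurable B ->
     \int[m1]_(y in D1) l1 y B = \int[m2]_(y in D2) l2 y B) ->
  (forall z, 0 <= f z) -> measurable_fun [set: Z] f ->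
  \int[m1]_(y in D1) \int[l1 y]_z f z = \int[m2]_(y in D2) \int[l2 y]_z f z.
Proof.
move=> mD1 mD2 ml1 ml2 mE f0 mf.
have sE d0 (Y : measurableType d0) (m : {measure set Y -> \bar R})
    (l : Y -> {measure set Z -> \bar R}) (D : set Y) (g : {nnsfun Z >-> R}) :
    measurable D -> (forall B, measurable B -> measurable_fun [set: Y] (l ^~ B)) ->
    \int[m]_(y in D) \int[l y]_z (g z)%:E =
    \sum_(r \in range g) (r%:E * \int[m]_(y in D) l y (g @^-1` [set r])).
  move=> mD ml.
  under eq_integral do rewrite integralT_nnsfun sintegralE.
  rewrite ge0_integral_fsum//=; last 2 first.
  - move=> r; apply: measurable_funeM; apply: measurable_funTS.
    exact: ml.
  - move=> r y _; exact: nnsfun_mulemu_ge0.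
  apply: eq_fsbigr => r /[!inE] -[z _ <-].
  rewrite ge0_integralZl//; first by apply: measurable_funTS; exact: ml.
  by rewrite lee_fin.
pose f_ := nnsfun_approx measurableT mf.
have f_nd z : {homo (fun n => (f_ n z)%:E) : a b / (a <= b)%N >-> a <= b}.
  by move=> a b ab; rewrite lee_fin; exact/lefP/nd_nnsfun_approx.
have limE d0 (Y : measurableType d0) (m : {measure set Y -> \bar R})
    (l : Y -> {measure set Z -> \bar R}) (D : set Y) :
    measurable D -> (forall B, measurable B -> measurable_fun [set: Y] (l ^~ B)) ->
    \int[m]_(y in D) \int[l y]_z f z =
    lim ((\int[m]_(y in D) \int[l y]_z (f_ n z)%:E) @[n --> \oo]).
  move=> mD ml; rewrite -monotone_convergence//; last 3 first.
  - move=> n; apply: measurable_funTS; apply: measurable_fun_integral_kernel => //.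
      by move=> z; rewrite lee_fin.
    exact/measurable_EFinP.
  - by move=> n y _; apply: integral_ge0 => // z _; rewrite lee_fin.
  - move=> y _ a b ab; apply: ge0_le_integral => //.
    + by move=> z _; rewrite lee_fin.
    + exact/measurable_EFinP.
    + exact/measurable_EFinP.
    + by move=> z _; exact: f_nd.
  apply: eq_integral => y _; rewrite -monotone_convergence//; last 2 first.
  - by move=> n; exact/measurable_EFinP.
  - by move=> n z _; rewrite lee_fin.
  by apply: eq_integral => z _; apply/esym/cvg_lim => //=; exact: cvg_nnsfun_approx.
rewrite !limE//; congr (limn _); apply/funext => n; rewrite !sE//.
by apply: eq_fsbigr => r _; rewrite mE.
Qed.

(** The push-forward of the Lebesgue measure by a translation agrees with it on half-open intervals,
    hence everywhere. *)
Lemma ge0_integral_translation (a : R) (D : set R) (f : R -> \bar R) :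
  measurable (D : set (measurableTypeR R)) -> measurable_fun D f ->
  (forall x, D x -> 0 <= f x) ->
  \int[lebesgue_measure]_(x in D) f x =
  \int[lebesgue_measure]_(x in [set x | D (x + a)%R]) f (x + a)%R.
Proof.
move=> mD mf f0.
have ma : measurable_fun [set: measurableTypeR R]
    ((fun x => x + a)%R : _ -> measurableTypeR R).
  exact: measurable_funD.
rewrite -(@ge0_integral_pushforward _ _ _ _ _ _ ma lebesgue_measure D f)//;
  last by move=> x; rewrite inE; exact: f0.
apply: eq_measure_integral => B mB _.
apply: lebesgue_measure_unique => // _ [[b c] _ <-]/=.
rewrite /pushforward.
rewrite [X in _ = lebesgue_measure X](_ : _ = `]b - a, c - a]%classic)%R.
  rewrite !lebesgue_measure_itv/= !lte_fin ltrBrDr subrK.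
  by case: ifP => // _; rewrite -!EFinD; congr (_%:E); ring.
by apply/seteqP; split => x/=; rewrite !in_itv/= ltrBlDr lerBrDr.
Qed.

(** Tonelli on the region 0 <= y < c w, whose section at w has length c w. Measurability in y is
    part of the conclusion because the comparison of two such integrals requires it. *)
Lemma layer_cake d (T : measurableType d)
    (mu : {sigma_finite_measure set T -> \bar R}) (D : set T) (c : T -> R)
    (W : T -> \bar R) :
  measurable D -> measurable_fun [set: T] c -> (forall w, (0 <= c w)%R) ->
  measurable_fun [set: T] W -> (forall w, 0 <= W w) ->
  measurable_fun (`[0%R, +oo[%classic : set (measurableTypeR R))
    (fun y => \int[mu]_(w in D `&` [set w | (y < c w)%R]) W w) /\
  \int[mu]_(w in D) ((c w)%:E * W w) =
  \int[lebesgue_measure]_(y in `[0%R, +oo[)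
    \int[mu]_(w in D `&` [set w | (y < c w)%R]) W w.
Proof.
move=> mD mc c0 mW W0.
pose E := [set p : T * measurableTypeR R | D p.1] `&`
  [set p | (0 <= p.2)%R] `&` [set p | (p.2 < c p.1)%R].
have EE w y : ((w, y) \in E) = (w \in D) && ((0 <= y) && (y < c w))%R.
  apply/idP/idP; rewrite /E !inE/=; first by move=> [[/mem_set -> ->] ->].
  by move=> /and3P[/set_mem ? -> ->].
have mE : measurable E.
  apply: measurableI; first apply: measurableI.
  - by rewrite -[X in measurable X]setTI; exact: measurable_fst.
  - rewrite -[X in measurable X]setTI.
    have : measurable_fun [set: T * measurableTypeR R] (fun p => (0 <= p.2)%R).
      exact: measurable_fun_ler.
    by move=> /(_ measurableT [set true]); exact.
  - rewrite -[X in measurable X]setTI.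
    have : measurable_fun [set: T * measurableTypeR R] (fun p => (p.2 < c p.1)%R).
      by apply: measurable_fun_ltr => //; exact: measurableT_comp mc _.
    by move=> /(_ measurableT [set true]); exact.
pose f : T * measurableTypeR R -> \bar R := (W \o fst) \_ E.
have mf : measurable_fun setT f.
  by apply/(measurable_restrictT _ mE)/measurable_funTS/measurableT_comp.
have f0 p : 0 <= f p by apply: erestrict_ge0 => ? _; exact: W0.
have fE w y : f (w, y) = if (w \in D) && ((0 <= y) && (y < c w))%R
    then W w else 0 by rewrite /f patchE EE.
have FT := @fubini_tonelli _ _ T (measurableTypeR R) R mu lebesgue_measure f mf f0.
have fG y : (0 <= y)%R -> \int[mu]_x f (x, y) =
    \int[mu]_(w in D `&` [set w | (y < c w)%R]) W w.
  move=> y0; rewrite [RHS]integral_mkcond; apply: eq_integral => w _.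
  by rewrite fE y0/= patchE in_setI; congr (if _ && _ then _ else _);
    apply/idP/idP; rewrite inE.
split.
  have := measurable_fun_fubini_tonelli_G (m1 := mu) f mf f0.
  move=> mG; apply: (@eq_measurable_fun _ _ _ _ _ (fubini_G mu f)).
    by move=> y; rewrite inE/= in_itv/= andbT => y0; rewrite /fubini_G fG.
  exact: measurable_funTS.
transitivity (\int[mu]_x \int[lebesgue_measure]_y f (x, y)).
  rewrite [LHS]integral_mkcond; apply: eq_integral => w _.
  rewrite patchE; under [RHS]eq_integral do rewrite fE.
  case: ifPn => wD /=; last by apply/esym/integral0_eq.
  have -> : \int[lebesgue_measure]_y
      (if ((0 <= y) && (y < c w))%R then W w else 0) =
      \int[lebesgue_measure]_(y in `[0%R, c w[) W w.
    rewrite [RHS]integral_mkcond; apply: eq_integral => y _.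
    by rewrite patchE mem_setE in_itv.
  rewrite integral_cst//= lebesgue_measure_itv/= lte_fin sube0 muleC.
  case: ltP => // cw0; congr (_ * _); congr (_%:E).
  by apply/eqP; rewrite eq_le cw0 c0.
rewrite FT [RHS]integral_mkcond; apply: eq_integral => y _.
rewrite patchE mem_setE in_itv/= andbT; case: ifPn => y0; first exact: fG.
by apply: integral0_eq => w _; rewrite fE (negbTE y0) andbF.
Qed.

(** An inequality on all superlevel sets of c integrates to one weighted by c. This is how a weight
    known at time s enters a supermartingale inequality stated for events. *)
Lemma ge0_le_integral_weight d (T : measurableType d)
    (mu : {sigma_finite_measure set T -> \bar R}) (D : set T) (c : T -> R)
    (W1 W2 : T -> \bar R) :
  measurable D -> measurable_fun [set: T] c -> (forall w, (0 <= c w)%R) ->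
  measurable_fun [set: T] W1 -> measurable_fun [set: T] W2 ->
  (forall w, 0 <= W1 w) -> (forall w, 0 <= W2 w) ->
  (forall y : R, \int[mu]_(w in D `&` [set w | (y < c w)%R]) W1 w <=
                 \int[mu]_(w in D `&` [set w | (y < c w)%R]) W2 w) ->
  \int[mu]_(w in D) ((c w)%:E * W1 w) <= \int[mu]_(w in D) ((c w)%:E * W2 w).
Proof.
move=> mD mc c0 mW1 mW2 W10 W20 H.
have [mg1 ->] := layer_cake mu mD mc c0 mW1 W10.
have [mg2 ->] := layer_cake mu mD mc c0 mW2 W20.
apply: ge0_le_integral => //; first by move=> y _; exact: integral_ge0.
Qed.

Lemma measurable_fun_nat_indexed d d' (T : measurableType d)
    (S : measurableType d') (N : T -> nat) (f : nat -> T -> S) :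
  (forall k, measurable [set x | N x = k]) ->
  (forall k, measurable_fun [set: T] (f k)) ->
  measurable_fun [set: T] (fun x => f (N x) x).
Proof.
move=> mN mf _ B mB; rewrite setTI.
rewrite [X in measurable X](_ : _ =
    \bigcup_k ([set x | N x = k] `&` f k @^-1` B)).
  apply: bigcup_measurable => k _; apply: measurableI => //.
  by rewrite -[X in measurable X]setTI; exact: mf.
apply/seteqP; split => [x Bx|x [k _] [/= <- //]].
by exists (N x).
Qed.

(* X is the pointwise limit of its right-endpoint dyadic-like discretizations
   s |-> X ((floor (n s) + 1) / n). *)
Lemma measurable_right_continuous_process d (T : measurableType d)
    (X : R -> T -> R) :
  (forall t, (0 <= t)%R -> measurable_fun [set: T] (X t)) ->
  (forall w t, (0 <= t)%R -> X ^~ w @ t^'+ --> X t w) ->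
  measurable_fun [set: T * measurableTypeR R]
    (fun p => X (Num.max 0%R p.2) p.1).
Proof.
move=> mX cX.
pose N n (p : T * measurableTypeR R) := Num.truncn (Num.max 0 p.2 * n.+1%:R)%R.
pose h n p := X ((N n p).+1%:R / n.+1%:R)%R p.1.
apply: (@measurable_fun_cvg _ _ _ _ h).
  move=> n; apply: (@measurable_fun_nat_indexed _ _ _ _ (N n)
    (fun k (p : T * measurableTypeR R) => X (k.+1%:R / n.+1%:R)%R p.1)).
    move=> k; pose y (p : T * measurableTypeR R) := (Num.max 0 p.2 * n.+1%:R)%R.
    have my : measurable_fun setT y.
      by apply: measurable_funM => //; exact: measurable_maxr.
    rewrite [X in measurable X](_ : _ = [set p | (k%:R <= y p)%R] `&`
        [set p | (y p < k.+1%:R)%R]).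
      apply: measurableI; rewrite -[X in measurable X]setTI.
        have : measurable_fun setT (fun p => (k%:R <= y p)%R).
          exact: measurable_fun_ler.
        by move=> /(_ measurableT [set true]); exact.
      have : measurable_fun setT (fun p => (y p < k.+1%:R)%R).
        exact: measurable_fun_ltr.
      by move=> /(_ measurableT [set true]); exact.
    have y0 p : (0 <= y p)%R by rewrite mulr_ge0// le_max lexx.
    apply/seteqP; split => [p/= /eqP|p/= [h1 h2]].
      by rewrite truncn_eq ?y0// => /andP.
    by apply/eqP; rewrite truncn_eq ?y0//; apply/andP.
  by move=> k; apply: measurableT_comp measurable_fst => //; exact: mX.
move=> p _; set t := Num.max 0%R p.2.
have t0 : (0 <= t)%R by rewrite le_max lexx.
have n0 n : (0 < n.+1%:R :> R)%R by rewrite ltr0n.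
have Nlt n : (t < (N n p).+1%:R / n.+1%:R)%R.
  by rewrite ltr_pdivlMr// truncnS_gt.
have Nle n : ((N n p).+1%:R / n.+1%:R <= t + n.+1%:R^-1)%R.
  rewrite ler_pdivrMr// mulrDl mulVf ?gt_eqF// -[X in (X <= _)%R]natr1 lerD2r.
  by rewrite truncn_le mulr_ge0.
have /cvg_at_rightP := cX p.1 t t0; apply; split => //.
apply: (@squeeze_cvgr _ _ _ _ (cst t) (fun n => t + n.+1%:R^-1)%R).
- by apply: nearW => n; rewrite (ltW (Nlt n)) Nle.
- exact: cvg_cst.
- rewrite -[X in _ --> X]addr0; apply: cvgD; first exact: cvg_cst.
  exact: cvg_harmonic.
Qed.

Lemma measurable_section_integral d (T : measurableType d)
    (f : T * measurableTypeR R -> \bar R) (D : set R) :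
  measurable (D : set (measurableTypeR R)) ->
  measurable_fun [set: T * measurableTypeR R] f -> (forall p, 0 <= f p) ->
  measurable_fun [set: T] (fun w => \int[lebesgue_measure]_(r in D) f (w, r)).
Proof.
move=> mD mf f0.
pose E := [set p : T * measurableTypeR R | D p.2].
have mE : measurable E by rewrite -[X in measurable X]setTI; exact: measurable_snd.
have mfE : measurable_fun setT (f \_ E).
  exact/(measurable_restrictT _ mE)/measurable_funTS.
have := @measurable_fun_fubini_tonelli_F _ _ _ _ _ (@lebesgue_measure R) _ mfE.
move=> /(_ (fun p => erestrict_ge0 (fun q _ => f0 q) p)).
apply: eq_measurable_fun => w _; rewrite /fubini_F [RHS]integral_mkcond.
by apply: eq_integral => r _; rewrite !patchE; congr (if _ then _ else _);
  apply/idP/idP; rewrite !inE.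
Qed.

(** Replacing g by its maximum with f changes g on a null set only and makes the order hold
    everywhere. *)
Lemma ae_le_integral d (T : measurableType d) (mu : {measure set T -> \bar R})
    (D : set T) (f g : T -> \bar R) : measurable D ->
  mu.-integrable D f -> mu.-integrable D g ->
  {ae mu, forall x, D x -> f x <= g x} ->
  \int[mu]_(x in D) f x <= \int[mu]_(x in D) g x.
Proof.
move=> mD intf intg fg.
have mf := measurable_int _ intf; have mg := measurable_int _ intg.
rewrite [leRHS](_ : _ = \int[mu]_(x in D) maxe (f x) (g x)).
  apply: le_integral => //; last by move=> x _; rewrite le_max lexx.
  apply: (@le_integrable _ _ _ _ _ mD _ (fun x => `|f x| + `|g x|)) => //.
  - exact: measurable_maxe.
  - move=> x _; rewrite [leRHS]gee0_abs ?adde_ge0//.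
    by rewrite /maxe; case: ifP => _; [rewrite leeDr|rewrite leeDl].
  - by apply: integrableD => //; exact: integrable_abse.
apply: ae_eq_integral => //; first exact: measurable_maxe.
by apply: filterS fg => x h Dx; apply/esym/max_idPr; exact: h.
Qed.

Lemma fubini_tonelli_on d (T : measurableType d)
    (m : {sigma_finite_measure set T -> \bar R})
    (f : T * measurableTypeR R -> \bar R) (D : set R) :
  measurable (D : set (measurableTypeR R)) ->
  measurable_fun [set: T * measurableTypeR R] f -> (forall p, 0 <= f p) ->
  measurable_fun D (fun r => \int[m]_w f (w, r)) /\
  \int[lebesgue_measure]_(r in D) \int[m]_w f (w, r) =
  \int[m]_w \int[lebesgue_measure]_(r in D) f (w, r).
Proof.
move=> mD mf f0; split.
  by apply: measurable_funTS; exact: (measurable_fun_fubini_tonelli_G (m1 := m) f).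
pose E := [set p : T * measurableTypeR R | D p.2].
have mE : measurable E by rewrite -[X in measurable X]setTI; exact: measurable_snd.
have mfE : measurable_fun setT (f \_ E).
  exact/(measurable_restrictT _ mE)/measurable_funTS.
have EE w r : ((w, r) \in E) = (r \in D) by apply/idP/idP; rewrite !inE.
have := @fubini_tonelli _ _ _ _ _ m (@lebesgue_measure R) _ mfE.
move=> /(_ (fun p => erestrict_ge0 (fun q _ => f0 q) p)) FT.
transitivity (\int[lebesgue_measure]_y \int[m]_x (f \_ E) (x, y)).
  rewrite [LHS]integral_mkcond; apply: eq_integral => r _; rewrite patchE.
  under [RHS]eq_integral do rewrite patchE EE.
  by case: ifPn => // _; rewrite integral0.
rewrite -FT; apply: eq_integral => w _; rewrite [RHS]integral_mkcond.
by apply: eq_integral => r _; rewrite !patchE EE.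
Qed.

(* Averaging the increments k (s + h) - k s over s in [0, T - h] leaves only the
   two end intervals of length h. *)
Lemma averaged_increments (T h M a b : R) (k : R -> R) (e : R -> \bar R) :
  (0 < h)%R -> (2 * h <= T)%R ->
  measurable_fun (`[0%R, T]%classic : set (measurableTypeR R)) k ->
  (forall s, (0 <= s <= T)%R -> (0 <= k s <= M)%R) ->
  measurable_fun (`[0%R, T]%classic : set (measurableTypeR R)) e ->
  (forall s, 0 <= e s) ->
  (forall s, (0 <= s <= T - h)%R -> (k (s + h)%R)%:E <= (k s)%:E + h%:E * e s) ->
  (forall s, (0 <= s <= h)%R -> (k s <= a)%R) ->
  (forall s, (T - h <= s <= T)%R -> (b <= k s)%R) ->
  b%:E <= a%:E + \int[lebesgue_measure]_(s in `[0%R, T]) e s.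
Proof.
move=> h0 hT mk kM me e0 ke ka kb.
pose K (A : set R) := \int[lebesgue_measure]_(s in A) (k s)%:E.
have mkE (i : interval R) : [set` i] `<=` `[0%R, T] ->
    measurable_fun [set` i] (EFin \o k).
  by move=> iT; apply/measurable_EFinP; exact: measurable_funS mk.
have k0 (i : interval R) : [set` i] `<=` `[0%R, T] ->
    forall s, [set` i] s -> 0 <= (k s)%:E.
  by move=> iT s /iT/=; rewrite in_itv/= => /kM/andP[+ _]; rewrite lee_fin.
have KU (i j l : interval R) : [set` l] = [set` i] `|` [set` j] -> [disjoint [set` i] & [set` j]] ->
    [set` l] `<=` `[0%R, T] -> K [set` l] = K [set` i] + K [set` j].
  move=> lE ij lT; rewrite /K lE ge0_integral_setU//.
  - by rewrite -lE; exact: mkE.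
  - by move=> s ijs; apply: (k0 l lT); rewrite lE.
have len (x y c : R) (bx by_ : bool) : (x <= y)%R ->
    \int[lebesgue_measure]_(s in [set` Interval (BSide bx x) (BSide by_ y)]) c%:E =
    (c * (y - x))%:E.
  move=> xy; rewrite integral_cst//= lebesgue_measure_itv/= lte_fin.
  case: ltP => xy'; first by rewrite -EFinD -EFinM.
  by have -> : x = y; [lra|rewrite subrr mulr0 mule0].
have shift : K `[h, T]%classic = \int[lebesgue_measure]_(s in `[0%R, (T - h)%R]) (k (s + h))%:E.
  have hs : `[h, T] `<=` `[0%R, T] by apply: subset_itvr; rewrite bnd_simp; exact: ltW.
  rewrite /K (ge0_integral_translation h)//.
  - congr (integral _ _ _); apply/seteqP; split => s/=; rewrite !in_itv/=; lra.
  - exact: mkE.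
  - exact: k0.
have mks : measurable_fun (`[0%R, (T - h)%R]%classic : set (measurableTypeR R))
    (fun s => (k (s + h))%:E).
  apply/measurable_EFinP.
  apply: (@measurable_comp _ _ _ (measurableTypeR R) (measurableTypeR R)
    (measurableTypeR R) `[0%R, T]%classic k `[0%R, (T - h)%R]%classic
    (fun s => s + h)%R) => //.
  - by move=> _ [s + <-]/=; rewrite !in_itv/= => /andP[s0 sT]; rewrite addr_ge0 ?(ltW h0)//= -lerBrDr.
  - exact: measurable_funD.
have s1 : `[0%R, (T - h)%R] `<=` `[0%R, T].
  by apply: subset_itvl; rewrite bnd_simp; lra.
have e1 : K `[h, T]%classic <= K `[0%R, (T - h)%R]%classic + h%:E * \int[lebesgue_measure]_(s in `[0%R, T]) e s.
  apply: (@le_trans _ _ (K `[0%R, (T - h)%R]%classic +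
      h%:E * \int[lebesgue_measure]_(s in `[0%R, (T - h)%R]) e s)); last first.
    apply: leeD2l; apply: lee_wpmul2l; first by rewrite lee_fin ltW.
    exact: ge0_subset_integral.
  rewrite shift -ge0_integralZl//; last 2 first.
  - exact: measurable_funS me.
  - by rewrite lee_fin ltW.
  rewrite /K -ge0_integralD//; last 4 first.
  - exact: k0.
  - exact: mkE.
  - by move=> s _; rewrite mule_ge0// lee_fin ltW.
  - by apply: measurable_funeM; exact: measurable_funS me.
  apply: ge0_le_integral => //.
  - move=> s/=; rewrite in_itv/= => sT; rewrite lee_fin.
    by have /kM/andP[] : (0 <= s + h <= T)%R by lra.
  - apply: emeasurable_funD; first exact: mkE.
    by apply: measurable_funeM; exact: measurable_funS me.
have U1 : K `[h, T]%classic = K `[h, (T - h)%R]%classic + K `](T - h)%R, T]%classic.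
  apply: KU.
  - by apply: itv_bndbnd_setU; rewrite bnd_simp; lra.
  - apply/disj_setPRL => u/=; rewrite !in_itv/= => /andP[uT _].
    by apply/negP; rewrite negb_and -!ltNge uT orbT.
  - by apply: subset_itvr; rewrite bnd_simp ltW.
have U2 : K `[0%R, (T - h)%R]%classic = K `[0%R, h[%classic + K `[h, (T - h)%R]%classic.
  apply: KU => //.
  - by apply: itv_bndbnd_setU; rewrite bnd_simp; lra.
  - apply/disj_setPRL => u/=; rewrite !in_itv/= => /andP[hu _].
    by apply/negP; rewrite negb_and -!leNgt hu orbT.
have sub3 : `[h, (T - h)%R] `<=` `[0%R, T].
  by apply: subset_itv; rewrite bnd_simp; lra.
(* The middle piece occurs on both sides; finiteness allows its cancellation. *)
have fin : K `[h, (T - h)%R]%classic \is a fin_num.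
  rewrite ge0_fin_numE; last by apply: integral_ge0; exact: k0.
  apply: (@le_lt_trans _ _ (\int[lebesgue_measure]_(s in `[h, (T - h)%R]) M%:E)).
    apply: ge0_le_integral => //; [exact: k0|exact: mkE|].
    by move=> s /sub3/=; rewrite in_itv/= lee_fin => /kM/andP[].
  by rewrite len ?ltry//; lra.
have {}e1 : K `](T - h)%R, T]%classic <= K `[0%R, h[%classic +
    h%:E * \int[lebesgue_measure]_(s in `[0%R, T]) e s.
  by rewrite -(leeD2lE _ _ fin) -U1 addeA [X in X + _]addeC -U2.
(* b may be negative. Since k >= 0, its positive part is still a lower bound near T, and all
   integrands stay nonnegative. *)
pose b' := Num.max 0%R b.
have bk s : (T - h <= s <= T)%R -> (b' <= k s)%R.
  move=> sT; rewrite ge_max kb// andbT.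
  by have /kM/andP[] : (0 <= s <= T)%R by lra.
have lo : (b' * h)%:E <= K `](T - h)%R, T]%classic.
  have -> : (b' * h)%:E = \int[lebesgue_measure]_(s in `](T - h)%R, T]) b'%:E.
    by rewrite len; [congr (_%:E); ring|lra].
  apply: ge0_le_integral => //.
  - by move=> s _; rewrite lee_fin le_max lexx.
  - by apply: mkE; apply: subset_itvr; rewrite bnd_simp; lra.
  - by move=> s/=; rewrite in_itv/= => sT; rewrite lee_fin bk//; lra.
have hi : K `[0%R, h[%classic <= (a * h)%:E.
  have sub0 : `[0%R, h[ `<=` `[0%R, T] by apply: subset_itvl; rewrite bnd_simp; lra.
  have -> : (a * h)%:E = \int[lebesgue_measure]_(s in `[0%R, h[) a%:E.
    by rewrite len ?subr0//; exact: ltW.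
  apply: ge0_le_integral => //; [exact: k0|exact: mkE|].
  by move=> s/=; rewrite in_itv/= => sT; rewrite lee_fin ka//; lra.
have {lo hi e1}: (b' * h)%:E <= (a * h)%:E +
    h%:E * \int[lebesgue_measure]_(s in `[0%R, T]) e s.
  by apply: (le_trans lo); apply: (le_trans e1); exact: leeD2r.
have : 0 <= \int[lebesgue_measure]_(s in `[0%R, T]) e s by exact: integral_ge0.
case: (integral _ _ _) => [r| |]// r0.
  rewrite -EFinM -!EFinD !lee_fin (mulrC h) -mulrDl ler_pM2r// => H.
  by apply: le_trans H; rewrite le_max lexx orbT.
by move=> _; rewrite addey// leey.
Qed.

(** The interval [x, x + h[ lies in the ball of radius h around x and has half its measure, so it
    shrinks nicely in the sense of Lebesgue differentiation; its endpoints do not matter. *)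
Lemma ae_right_average (f : R -> R) (h : R^nat) :
  locally_integrable setT f -> (forall n, (0 < h n)%R) ->
  h n @[n --> \oo] --> (0%R : R) ->
  {ae lebesgue_measure, forall x,
    (h n)^-1%:E * \int[lebesgue_measure]_(y in `]x, (x + h n)%R]) (f y)%:E
      @[n --> \oo] --> (f x)%:E}.
Proof.
move=> locf h0 hc; have := lebesgue_differentiation locf.
apply: filterS; first exact: (ae_filter_ringOfSetsType lebesgue_measure).
move=> x fx.
pose E (y : R) n := `[y, (y + h n)%R[%classic.
have muE y n : lebesgue_measure (E y n) = (h n)%:E.
  by rewrite /E lebesgue_measure_itv/= lte_fin ltrDl h0 -EFinD addrAC subrr add0r.
have niceE y : nicely_shrinking y (E y).
  split=> [n|]; first exact: measurable_itv.
  exists (2%R, fun n => PosNum (h0 n)); split => //= [n z|n].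
    rewrite /E/= in_itv/= /ball/= ltr_distlC => /andP[yz ->].
    by rewrite (lt_le_trans _ yz)// ltrBlDr ltrDl.
  by rewrite (lebesgue_measure_ball _ (ltW _))// muE -EFinM lee_fin mulr_natl.
have := nice_lebesgue_differentiation niceE locf fx.
apply: cvg_trans; apply: near_eq_cvg; apply: nearW => n.
rewrite muE inver gt_eqF//; congr (_ * _).
have mf (i : interval R) : measurable_fun [set` i] (fun y => (f y)%:E).
  apply/measurable_EFinP; apply: measurable_funTS.
  by case: locf.
by rewrite integral_itv_bndoo// [RHS]integral_itv_bndoo.
Qed.

End measure_helpers.

(** * The Lyapunov estimate *)

Section stop_min_theory.
Context d (Om : measurableType d) (R : realType).
Implicit Types (tau : Om -> \bar R).

Lemma stop_min_lt tau (t : R) w : (t%:E < tau w)%E -> stop_min t tau w = t.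
Proof. by move=> tw; rewrite /stop_min min_l ?(ltW tw). Qed.

Lemma stop_min_ge tau (s t : R) w : s <= t -> (s%:E <= tau w)%E ->
  s <= stop_min t tau w.
Proof.
move=> st sw; rewrite /stop_min /mine; case: ifPn => [_//|].
by rewrite -leNgt; case: (tau w) sw.
Qed.

Lemma stop_min_ge_lt tau (t r : R) w : r <= t -> (r%:E < tau w)%E ->
  r <= stop_min t tau w.
Proof. by move=> rt /ltW; exact: stop_min_ge. Qed.

End stop_min_theory.

Section filtration_theory.
Context d (Om : measurableType d) (R : realType) (F : R -> set (set Om)).
Hypothesis F_filtration : filtration F.

Lemma filtration_measurable t A : 0 <= t -> F t A -> measurable A.
Proof. by move=> t0; have [_ [H _]] := F_filtration; exact: H. Qed.

Lemma filtration_mono s t A : 0 <= s -> s <= t -> F s A -> F t A.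
Proof. by move=> s0 st; have [_ [_ H]] := F_filtration; exact: H. Qed.

Lemma filtrationC t A : 0 <= t -> F t A -> F t (~` A).
Proof.
move=> t0; have [/(_ t t0)[_ H _] _] := F_filtration.
by move=> /H; rewrite setTD.
Qed.

Lemma filtrationU t A B : 0 <= t -> F t A -> F t B -> F t (A `|` B).
Proof.
move=> t0 FA FB; have [/(_ t t0)[_ _ H] _] := F_filtration.
by rewrite -bigcup2E; apply: H => -[|[|n]]//=; have [/(_ t t0)[]] := F_filtration.
Qed.

Lemma filtrationI t A B : 0 <= t -> F t A -> F t B -> F t (A `&` B).
Proof.
move=> t0 FA FB; rewrite -[A `&` B]setCK setCI.
by apply: filtrationC => //; apply: filtrationU => //; exact: filtrationC.
Qed.

Lemma filtrationT t : 0 <= t -> F t setT.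
Proof.
move=> t0; rewrite -setC0; apply: filtrationC => //.
by have [/(_ t t0)[]] := F_filtration.
Qed.

Lemma filtration_preimage (X : R -> Om -> R) t (B : set (measurableTypeR R)) :
  adapted F (fun t w => (X t w)%:E) -> 0 <= t -> measurable B ->
  F t (X t @^-1` B).
Proof.
move=> adX t0 mB; have := adX t t0 (EFin @` B) (measurable_image_EFin mB).
by congr (F t); apply/seteqP; split => w /=; [case=> y By [<-]|exists (X t w)].
Qed.

Lemma stopping_time_gt tau t : stopping_time F tau -> 0 <= t ->
  F t [set w | (t%:E < tau w)%E].
Proof.
move=> [_ st] t0; rewrite [X in F t X](_ : _ = ~` [set w | (tau w <= t%:E)%E]).
  by apply: filtrationC => //; exact: st.
by apply/seteqP; split => w /=; [rewrite ltNge => /negP|move/negP; rewrite -ltNge].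
Qed.

Lemma adapted_measurable (X : R -> Om -> R) t :
  adapted F (fun t w => (X t w)%:E) -> 0 <= t -> measurable_fun setT (X t).
Proof.
move=> adX t0 _ B mB; rewrite setTI.
by apply: (filtration_measurable t0); exact: filtration_preimage.
Qed.

End filtration_theory.

Section lyapunov_estimate.
Context (R : realType) (phi : R -> R).
Hypothesis phi_ge0 : forall u : R, 1 <= u -> 0 <= phi u.
Hypothesis phi_concave :
  convex_function (`[1, +oo[%classic : set R) (fun u => - phi u).
Hypothesis phi_incr : forall u v : R, 1 <= u -> u <= v -> phi u <= phi v.
Hypothesis Phi_fin : forall s : R, 1 < s -> (ePhi phi s < +oo)%E.
Context d (Om : measurableType d) (Pr : probability Om R).
Context (F : R -> set (set Om)) (F_filtration : filtration F).
Context (X : R -> Om -> R) (V : R -> R).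
Hypothesis X_ge0 : forall t w, 0 <= t -> 0 <= X t w.
Hypothesis X_cadlag : cadlag_adapted F X.
Hypothesis V_measurable : measurable_fun
  (`[0%R, +oo[%classic : set (measurableTypeR R))
  (V : measurableTypeR R -> measurableTypeR R).
Hypothesis V_ge1 : forall x : R, 0 <= x -> 1 <= V x.
Hypothesis V_lyapunov : lyapunov Pr F phi X V.
Hypothesis phiV_gt0 : forall x : R, 0 < x -> 0 < phi (V x).

Let mu := @lebesgue_measure R.
Let tau := hitting_time0 X.

Definition alive (s : R) := [set w | (s%:E < tau w)%E].

Let tau_stopping : stopping_time F tau. Proof. by case: V_lyapunov. Qed.

Lemma alive_filtration s : 0 <= s -> F s (alive s).
Proof. exact: stopping_time_gt. Qed.

Lemma measurable_alive s : 0 <= s -> measurable (alive s).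
Proof.
move=> s0; exact: (filtration_measurable F_filtration s0 (alive_filtration s0)).
Qed.

Lemma alive_anti s t : s <= t -> alive t `<=` alive s.
Proof. by move=> st w; apply: le_lt_trans; rewrite lee_fin. Qed.

Lemma alive_gt0 s w : 0 <= s -> alive s w -> 0 < X s w.
Proof.
move=> s0 sw; rewrite lt_neqAle X_ge0// andbT eq_sym; apply/eqP => Xs.
have : (tau w <= s%:E)%E by apply: ereal_inf_lbound; exists s.
by rewrite leNgt sw.
Qed.

Let mX t : 0 <= t -> measurable_fun setT (X t).
Proof. by case: X_cadlag => adX _; exact: (adapted_measurable F_filtration adX). Qed.

Let VX_measurable t : 0 <= t -> measurable_fun setT (fun w => V (X t w)).
Proof.
move=> t0; apply: measurable_comp_on V_measurable (mX t0) _ => w.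
exact: X_ge0.
Qed.

Let VX1 t w : 0 <= t -> 1 <= V (X t w).
Proof. by move=> t0; rewrite V_ge1 ?X_ge0. Qed.

(** Joint measurability comes from the right-continuity of X alone; [V] is applied afterwards as a
    measurable function. Negative times are clamped to 0. *)
Let VX_joint : measurable_fun [set: Om * measurableTypeR R]
  (fun p => V (X (Num.max 0 p.2) p.1)).
Proof.
have mXj : measurable_fun [set: Om * measurableTypeR R]
    (fun p => X (Num.max 0 p.2) p.1).
  apply: measurable_right_continuous_process => //.
  by move=> w t t0; case: X_cadlag => _ /(_ w)[+ _]; exact.
apply: measurable_comp_on V_measurable mXj _ => p.
by rewrite X_ge0// le_max lexx.
Qed.

(** For fixed w the indicator of s < tau w is right-continuous in s, the inequality being strict, so
    the criterion used for X applies again. *)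
Let alive_joint : measurable_fun [set: Om * measurableTypeR R]
  (fun p => \1_(alive (Num.max 0 p.2)) p.1 : R).
Proof.
apply: (@measurable_right_continuous_process _ _ _ (fun s => \1_(alive s))).
  by move=> t t0; exact/measurable_indic/measurable_alive.
move=> w t t0; apply: cvg_near_cst; rewrite !indicE.
have [tw|wt] := boolP (w \in alive t).
  move: tw; rewrite inE /alive/= => tw.
  have [r tr rw] : exists2 r : R, t < r & (r%:E <= tau w)%E.
    case E : (tau w) tw => [y| |]//=; first by rewrite lte_fin => ty; exists y.
    by move=> _; exists (t + 1); rewrite ?ltrDl ?leey.
  near=> s; rewrite indicE mem_set//=; apply: lt_le_trans rw; rewrite lte_fin.
  by near: s; exact: nbhs_right_lt.
near=> s; rewrite indicE memNset// => sw; move: wt; rewrite notin_setE; apply.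
by apply: alive_anti sw; apply: ltW; near: s; exact: nbhs_right_gt.
Unshelve. all: by end_near. Qed.

(** Killed at tau, so that it is integrated over deterministic time intervals in place of intervals
    ending at the minimum of t and tau. *)
Definition drift (p : Om * measurableTypeR R) : R :=
  phi (V (X (Num.max 0 p.2) p.1)) * \1_(alive (Num.max 0 p.2)) p.1.

Lemma driftE w r : 0 <= r -> alive r w -> drift (w, r) = phi (V (X r w)).
Proof.
by move=> r0 rw; rewrite /drift/= max_r// indicE mem_set// mulr1.
Qed.

Lemma drift_dead w r : 0 <= r -> ~ alive r w -> drift (w, r) = 0.
Proof.
by move=> r0 rw; rewrite /drift/= max_r// indicE memNset// mulr0.
Qed.

Lemma drift_ge0 p : 0 <= drift p.
Proof. by rewrite /drift mulr_ge0// phi_ge0// VX1// le_max lexx. Qed.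

Lemma measurable_drift : measurable_fun setT drift.
Proof.
apply: measurable_funM => //.
apply: measurable_comp_on (measurable_phi phi_incr) VX_joint _ => p.
by rewrite VX1// le_max lexx.
Qed.

Let drift_section (w : Om) : measurable_fun [set: measurableTypeR R]
  (fun r : R => (drift (w, r))%:E).
Proof.
apply/measurable_EFinP.
exact: (measurableT_comp measurable_drift (measurable_pair1 w)).
Qed.

Let drift_int D : measurable (D : set (measurableTypeR R)) ->
  measurable_fun [set: Om] (fun w => \int[mu]_(r in D) (drift (w, r))%:E)%E.
Proof.
move=> mD; apply: (measurable_section_integral (f := EFin \o drift)) => //.
- by apply/measurable_EFinP; exact: measurable_drift.
- by move=> p; rewrite lee_fin drift_ge0.
Qed.

(** After absorption the value of V at 0 is replaced by its lower bound 1. This only decreases the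
    process, and 1 is the least point of the domain of G(t, .). *)
Definition next_value t w : R := if (t%:E < tau w)%E then V (X t w) else 1.

Lemma next_value_ge1 t w : 0 <= t -> 1 <= next_value t w.
Proof. by move=> t0; rewrite /next_value; case: ifP => // _; exact: VX1. Qed.

Lemma measurable_next_value t : 0 <= t -> measurable_fun setT (next_value t).
Proof.
move=> t0; apply: measurable_fun_ifT => //; last exact: VX_measurable.
apply: (measurable_fun_bool true); rewrite setTI.
exact: (measurable_alive t0).
Qed.

Let drift_split w (s t : R) : 0 <= s -> s <= t ->
  (\int[mu]_(r in `[0%R, t]) (drift (w, r))%:E =
   \int[mu]_(r in `[0%R, s]) (drift (w, r))%:E +
   \int[mu]_(r in `]s, t]) (drift (w, r))%:E)%E.
Proof.
move=> s0 st; have -> : `[0, t]%classic = `[0, s] `|` `]s, t].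
  by apply: itv_bndbnd_setU; rewrite bnd_simp.
rewrite ge0_integral_setU//=.
- exact: measurable_funTS.
- by move=> r _; rewrite lee_fin drift_ge0.
- apply/disj_setPRL => r/=; rewrite !in_itv/= => /andP[sr _].
  by apply/negP; rewrite negb_and -!ltNge sr orbT.
Qed.

(* The process of which the Lyapunov condition makes a supermartingale. *)
Let W t w := ((V (X (stop_min t tau w) w))%:E +
  \int[mu]_(s in `[0%R, stop_min t tau w]) (phi (V (X s w)))%:E)%E.

Let X_section w : measurable_fun (`[0%R, +oo[%classic : set (measurableTypeR R))
  (fun r : R => (phi (V (X r w)))%:E).
Proof.
have mp : measurable_fun [set: Om * measurableTypeR R]
    (fun p => phi (V (X (Num.max 0 p.2) p.1))).
  apply: measurable_comp_on (measurable_phi phi_incr) VX_joint _ => p.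
  by rewrite VX1// le_max lexx.
have := measurableT_comp mp (measurable_pair1 w).
move=> /measurable_EFinP H.
apply: (@eq_measurable_fun _ _ _ _ _ (fun r : R =>
    (phi (V (X (Num.max 0 r) w)))%:E)).
  by move=> r; rewrite inE/= in_itv/= andbT => r0 /=; rewrite max_r.
exact: measurable_funTS.
Qed.

Let W_alive t w : 0 <= t -> alive t w ->
  W t w = ((V (X t w))%:E + \int[mu]_(r in `[0%R, t]) (drift (w, r))%:E)%E.
Proof.
move=> t0 tw; rewrite /W stop_min_lt//; congr (_ + _)%E.
apply: eq_integral => r; rewrite inE/= in_itv/= => /andP[r0 rt].
by rewrite driftE//; exact: alive_anti tw.
Qed.

Let le_drift_integral t r w : 0 <= t -> 0 <= r ->
  (forall z, 0 <= z -> z <= t -> alive z w -> z <= r) ->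
  (\int[mu]_(z in `[0%R, t]) (drift (w, z))%:E <=
   \int[mu]_(z in `[0%R, r]) (phi (V (X z w)))%:E)%E.
Proof.
move=> t0 r0 H; rewrite integral_mkcond [leRHS]integral_mkcond.
apply: ge0_le_integral => //=.
- by move=> z _; apply: erestrict_ge0 => ? _; rewrite lee_fin drift_ge0.
- apply/(measurable_restrictT _ (measurable_itv _)); exact: (measurable_funTS (drift_section w)).
- apply/(measurable_restrictT _ (measurable_itv _)).
  by apply: measurable_funS (X_section w) => //; apply: subset_itvl; rewrite bnd_simp.
- move=> z _; rewrite !patchE !mem_setE !in_itv/=.
  case: ifPn => [/andP[z0 zt]|_]; last first.
    case: ifPn => // /andP[z0 _]; by rewrite lee_fin phi_ge0// VX1.
  have [zw|zw] := pselect (alive z w); first by rewrite z0 H//= driftE.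
  rewrite drift_dead//; case: ifPn => // /andP[? _].
  by rewrite lee_fin phi_ge0// VX1.
Qed.

Let W_ge t w : 0 <= t ->
  ((next_value t w)%:E + \int[mu]_(r in `[0%R, t]) (drift (w, r))%:E <= W t w)%E.
Proof.
move=> t0; have sm0 : 0 <= stop_min t tau w.
  by apply: stop_min_ge => //; exact: (tau_stopping.1 w).
apply: leeD.
  rewrite lee_fin /next_value; case: ifPn => tw; last exact: VX1.
  by rewrite stop_min_lt.
by apply: le_drift_integral => // z z0 zt zw; exact: stop_min_ge_lt.
Qed.

(** Meant for paths whose localizing time falls between s and t: the stopped [W] still contains the
    drift up to s, which has to cancel against the same term in [W] at time s. *)
Let W_ge_past s t w : 0 <= s -> s <= t -> (s%:E <= tau w)%E ->
  (\int[mu]_(r in `[0%R, s]) (drift (w, r))%:E <= W t w)%E.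
Proof.
move=> s0 st sw; have sm := stop_min_ge st sw.
have sm0 := le_trans s0 sm.
rewrite -[leLHS]add0e; apply: leeD; first by rewrite lee_fin (le_trans ler01)// VX1.
by apply: le_drift_integral => // z _ zs _; exact: le_trans zs sm.
Qed.

(** On {s < tau}, [W] at time s is V(X s) plus the past drift, and [W] at time t is at least
    [next_value] plus the whole drift. The past drift is cancelled in the localized inequality, and
    the localization is removed by monotone convergence. *)
Lemma supermartingale_step (s t : R) (A : set Om) :
  0 <= s -> s <= t -> F s A -> A `<=` alive s ->
  (\int[Pr]_(w in A) ((next_value t w)%:E +
      \int[mu]_(r in `]s, t]) (drift (w, r))%:E) <=
   \int[Pr]_(w in A) (V (X s w))%:E)%E.
Proof.
move=> s0 st FA As; have t0 := le_trans s0 st.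
have mA := filtration_measurable F_filtration s0 FA.
pose D w := (\int[mu]_(r in `]s, t]) (drift (w, r))%:E)%E.
have D0 w : (0 <= D w)%E by apply: integral_ge0 => r _; rewrite lee_fin drift_ge0.
pose f w := ((next_value t w)%:E + D w)%E.
have f0 w : (0 <= f w)%E.
  by rewrite adde_ge0// lee_fin (le_trans ler01)// next_value_ge1.
have mf : measurable_fun setT f.
  apply: emeasurable_funD; last exact: drift_int.
  by apply/measurable_EFinP; exact: measurable_next_value.
pose I w := (\int[mu]_(r in `[0%R, s]) (drift (w, r))%:E)%E.
have I0 w : (0 <= I w)%E by apply: integral_ge0 => r _; rewrite lee_fin drift_ge0.
have mI : measurable_fun setT I by exact: drift_int.
have mVs : measurable_fun setT (fun w => (V (X s w))%:E).
  by apply/measurable_EFinP; exact: VX_measurable.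
have V0 w : (0 <= (V (X s w))%:E)%E by rewrite lee_fin (le_trans ler01)// VX1.
case: V_lyapunov => _ [taun [locst locae] sm].
pose E n := [set w | (t%:E < taun n w)%E].
have mE n : measurable (E n).
  apply: (filtration_measurable F_filtration t0).
  exact: stopping_time_gt.
have step n : (\int[Pr]_(w in A `&` E n) f w <= \int[Pr]_(w in A) (V (X s w))%:E)%E.
  (* {t < taun n} need not be in F s, so the supermartingale inequality is taken on the larger event
     B of F s; outside [E n] only the past drift is retained. *)
  pose B := A `&` [set w | (s%:E < taun n w)%E].
  have FB : F s B by apply: filtrationI => //; exact: stopping_time_gt.
  have mB := filtration_measurable F_filtration s0 FB.
  have AEB : A `&` E n `<=` B.
    by move=> w [Aw tw]; split => //=; apply: le_lt_trans tw; rewrite lee_fin.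
  have Ws w : B w -> stopped W (taun n) s w = ((V (X s w))%:E + I w)%E.
    move=> [Aw sw]; rewrite /stopped stop_min_lt// W_alive//; exact: As.
  have Wt w : B w -> ((f \_ (E n)) w + I w <= stopped W (taun n) t w)%E.
    move=> [Aw sw]; rewrite /stopped patchE; case: ifPn => [|_].
      rewrite inE => tw; rewrite stop_min_lt//; apply: le_trans (W_ge w t0).
      by rewrite (drift_split w s0 st) /f /D /I -addeA leeD// addeC.
    rewrite add0e; apply: W_ge_past => //; last exact/ltW/As.
    by apply: stop_min_ge => //; exact: ltW.
  have [_ intW supW] := sm n.
  have [Z [_ _ intZ ZE] Zle] := supW s t s0 st.
  have intWB r : 0 <= r -> Pr.-integrable B (stopped W (taun n) r).
    move=> r0; exact: integrableS (intW r r0).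
  have Wle : (\int[Pr]_(w in B) stopped W (taun n) t w <=
              \int[Pr]_(w in B) stopped W (taun n) s w)%E.
    rewrite -ZE//; apply: ae_le_integral => //.
    - exact: integrableS intZ.
    - exact: intWB.
    - by apply: filterS Zle => w Zw _.
  (* The stopped [W] at time s is integrable and dominates the past drift on B, which can therefore
     be cancelled. *)
  have IB : (\int[Pr]_(w in B) I w \is a fin_num)%E.
    rewrite ge0_fin_numE ?integral_ge0//.
    have := integrable_fin_num mB (intWB _ s0); rewrite ge0_fin_numE.
      apply: le_lt_trans; apply: ge0_le_integral => //.
      - exact: measurable_funTS.
      - exact: measurable_int (intWB _ s0).
      - by move=> w Bw; rewrite Ws// leeDr.
    by apply: integral_ge0 => w Bw; rewrite Ws// adde_ge0.
  have mfE : measurable_fun setT (f \_ (E n)).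
    apply/(measurable_restrictT _ (mE n)); exact: measurable_funTS.
  have fE0 w : (0 <= (f \_ (E n)) w)%E by apply: erestrict_ge0.
  have : (\int[Pr]_(w in B) ((f \_ (E n)) w + I w) <=
          \int[Pr]_(w in B) ((V (X s w))%:E + I w))%E.
    rewrite (_ : (\int[Pr]_(w in B) ((V (X s w))%:E + I w) =
        \int[Pr]_(w in B) stopped W (taun n) s w)%E); last first.
      by apply: eq_integral => w; rewrite inE => Bw; rewrite Ws.
    apply: le_trans Wle; apply: ge0_le_integral => //.
    - by move=> w _; rewrite adde_ge0.
    - by apply: emeasurable_funD; exact: measurable_funTS.
    - exact: measurable_int (intWB _ t0).
  have addI g : (forall w, 0 <= g w)%E -> measurable_fun setT g ->
      (\int[Pr]_(w in B) (g w + I w) =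
       \int[Pr]_(w in B) g w + \int[Pr]_(w in B) I w)%E.
    by move=> g0 mg; rewrite ge0_integralD//; exact: measurable_funTS.
  rewrite !addI// (leeD2rE _ _ IB) => H.
  apply: le_trans (_ : _ <= \int[Pr]_(w in B) (V (X s w))%:E)%E _; last first.
    by apply: ge0_subset_integral => //; [exact: measurable_funTS|exact: subIsetl].
  apply: le_trans H; rewrite -integral_mkcondr (_ : B `&` E n = A `&` E n)//.
  apply/seteqP; split => [w [[Aw _] Ew]//|w AEw].
  by split; [exact: AEB|case: AEw].
(* The localizing times are monotone only almost surely; the tail intersections of the [E m]
   increase everywhere, and almost every w is eventually in them. *)
pose H n := A `&` \bigcap_(m >= n) E m.
have mH n : measurable (H n).
  by apply: measurableI => //; apply: bigcap_measurable => [|m _]; [by exists n => /=|exact: mE].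
have H_step n : (\int[Pr]_(w in H n) f w <= \int[Pr]_(w in A) (V (X s w))%:E)%E.
  apply: le_trans (step n); apply: ge0_subset_integral => //.
  - exact: measurableI.
  - exact: measurable_funTS.
  - by move=> w [Aw Ew]; split => //; exact: (Ew n (leqnn n)).
have := @ge0_nondecreasing_set_cvg_integral _ _ _ H f Pr.
move=> /(_ _ mH (fun=> measurable_funTS mf) (fun n w _ => f0 w)) cvgH.
have {cvgH} cvgH : (\int[Pr]_(w in H n) f w @[n --> \oo] -->
    \int[Pr]_(w in \bigcup_n H n) f w)%E.
  apply: cvgH => m n mn; apply/subsetPset => w [Aw Ew]; split => // k /= nk.
  by apply: Ew; exact: leq_trans nk.
have UH : (\int[Pr]_(w in \bigcup_n H n) f w <=
    \int[Pr]_(w in A) (V (X s w))%:E)%E.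
  rewrite -(cvg_lim _ cvgH)//; apply: lime_le; first by apply/cvg_ex; eexists; exact: cvgH.
  by apply: nearW => n; exact: H_step.
apply: le_trans UH; rewrite -[leLHS]/(\int[Pr]_(w in A) f w)%E.
rewrite (_ : \bigcup_n H n = A `&` \bigcup_n \bigcap_(m >= n) E m);
  last by rewrite setI_bigcupr.
rewrite integral_mkcondr; apply: ae_ge0_le_integral => //.
- exact: measurable_funTS.
- by move=> w _; apply: erestrict_ge0.
- have mU : measurable (\bigcup_n \bigcap_(m in [set m | (n <= m)%N]) E m).
    apply: bigcup_measurable => n _.
    by apply: bigcap_measurable => [|m _]; [by exists n => /=|exact: mE].
  apply: measurable_funTS; apply/(measurable_restrictT _ mU).
  exact: measurable_funTS.
apply: filterS locae => w [_ /cvgeyPgt/(_ t)[n _ tauy]] Aw.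
by rewrite patchE mem_set//; exists n.
Qed.

Variable x : R.
Hypothesis x_ge0 : 0 <= x.
Hypothesis X_start : {ae Pr, forall w, X 0 w = x}.

Let Vx0 : 0 <= V x. Proof. exact: le_trans ler01 (V_ge1 x_ge0). Qed.

Let initial_integral (f : R -> R) (A : set Om) : measurable A ->
  measurable_fun setT (fun w => f (X 0 w)) ->
  (forall z, 0 <= z -> 0 <= f z) ->
  (\int[Pr]_(w in A) (f (X 0 w))%:E <= (f x)%:E)%E.
Proof.
move=> mA mf f0; apply: (@le_trans _ _ (\int[Pr]_(w in A) (f x)%:E)%E).
  apply: ae_ge0_le_integral => //.
  - by move=> w _; rewrite lee_fin f0// X_ge0.
  - by apply/measurable_EFinP; exact: measurable_funTS.
  - by move=> w _; rewrite lee_fin f0.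
  - by apply: filterS X_start => w ->.
rewrite integral_cst//= -[leRHS]mule1 lee_wpmul2l ?lee_fin ?f0//.
exact: probability_le1.
Qed.

Let VX_EFin s : 0 <= s -> measurable_fun setT (fun w => (V (X s w))%:E).
Proof. by move=> s0; apply/measurable_EFinP; exact: VX_measurable. Qed.

Let VX_ge0 s w : 0 <= s -> (0 <= (V (X s w))%:E)%E.
Proof. by move=> s0; rewrite lee_fin (le_trans ler01)// VX1. Qed.

Let drift_ge0E D w : (0 <= \int[mu]_(r in D) (drift (w, r))%:E)%E.
Proof. by apply: integral_ge0 => r _; rewrite lee_fin drift_ge0. Qed.

Let next_EFin t : 0 <= t -> measurable_fun setT (fun w => (next_value t w)%:E).
Proof. by move=> t0; apply/measurable_EFinP; exact: measurable_next_value. Qed.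

Let next_ge0 t w : 0 <= t -> (0 <= (next_value t w)%:E)%E.
Proof. by move=> t0; rewrite lee_fin (le_trans ler01)// next_value_ge1. Qed.

Lemma integral_V_alive s : 0 <= s ->
  (\int[Pr]_(w in alive s) (V (X s w))%:E <= (V x)%:E)%E.
Proof.
move=> s0; have m0 := measurable_alive (lexx 0).
apply: le_trans (initial_integral m0 (VX_measurable (lexx 0)) _); last first.
  by move=> z z0; rewrite (le_trans ler01)// V_ge1.
apply: le_trans (supermartingale_step (lexx 0) s0 (alive_filtration (lexx 0)) _) => //.
apply: (@le_trans _ _ (\int[Pr]_(w in alive 0) (next_value s w)%:E)%E).
  apply: (@le_trans _ _ (\int[Pr]_(w in alive s) (next_value s w)%:E)%E).
    rewrite le_eqVlt; apply/orP; left; apply/eqP; apply: eq_integral => w.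
    by rewrite inE /next_value => ->.
  apply: ge0_subset_integral => //.
  - exact: measurable_alive.
  - exact/measurable_funTS/next_EFin.
  - by move=> w _; exact: next_ge0.
  - exact: alive_anti.
apply: ge0_le_integral => //.
- by move=> w _; exact: next_ge0.
- exact/measurable_funTS/next_EFin.
- apply: emeasurable_funD; first exact/measurable_funTS/next_EFin.
  exact/measurable_funTS/drift_int.
- by move=> w _; rewrite leeDl.
Qed.

Let G := Gfun phi.

Let G_measurable t : 0 <= t ->
  measurable_fun (`[1, +oo[%classic : set (measurableTypeR R)) (G t).
Proof.
by move=> t0; apply: measurable_nondecreasing_on => u v u1 uv; exact: G_le.
Qed.

Let phiG_measurable t : 0 <= t ->
  measurable_fun (`[1, +oo[%classic : set (measurableTypeR R)) (phi \o G t).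
Proof.
move=> t0; apply: measurable_nondecreasing_on => u v u1 uv /=.
by apply: phi_incr; [exact: G_ge1|exact: G_le].
Qed.

(** Slope at V z of the supporting line of G(t, .). *)
Let slope t z := phi (G t (V z)) / phi (V z).

Let slope_ge0 t z : 0 <= t -> 0 <= z -> 0 <= slope t z.
Proof.
by move=> t0 z0; rewrite /slope divr_ge0// phi_ge0 ?G_ge1 ?V_ge1.
Qed.

Let slope_measurable t : 0 <= t ->
  measurable_fun (`[0, +oo[%classic : set (measurableTypeR R)) (slope t).
Proof.
move=> t0; pose V1 z := V (Num.max 0 z).
have V11 z : 1 <= V1 z by rewrite V_ge1// le_max lexx.
have mV1 : measurable_fun [set: measurableTypeR R] V1.
  apply: measurable_comp_on V_measurable _ _ => [|z]; first exact: measurable_maxr.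
  by rewrite le_max lexx.
apply: (@eq_measurable_fun _ _ _ _ _
    (fun z => (phi \o G t) (V1 z) * (phi (V1 z))^-1)).
  by move=> z; rewrite inE/= in_itv/= andbT => z0; rewrite /V1/= max_r.
apply: measurable_funTS; apply: measurable_funM.
  exact: measurable_comp_on (phiG_measurable t0) mV1 _.
apply: measurable_inv_ge0 => [|z _]; last exact: phi_ge0.
exact: measurable_comp_on (measurable_phi phi_incr) mV1 _.
Qed.

Let slope_filtration s t (B : set (measurableTypeR R)) : 0 <= s -> 0 <= t ->
  measurable B -> F s [set w | B (slope t (X s w))].
Proof.
move=> s0 t0 mB.
have mB' : measurable (`[0%R, +oo[ `&` slope t @^-1` B : set (measurableTypeR R)).
  exact: slope_measurable.
have := filtration_preimage (X_cadlag.1) s0 mB'.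
congr (F s); apply/seteqP; split => [w [_ //]|w Bw]; split => //=.
by rewrite in_itv/= X_ge0.
Qed.

(** The supporting line of G(t, .) at V(X s) is integrated against the supermartingale inequality.
    Its slope is known at time s and nonnegative, so it may serve as a weight. *)
Lemma G_step s t : 0 <= s -> s <= t ->
  (\int[Pr]_(w in alive s) ((G t (next_value t w))%:E + (slope t (X s w))%:E *
     \int[mu]_(r in `]s, t]) (drift (w, r))%:E) <=
   \int[Pr]_(w in alive s) (G t (V (X s w)))%:E)%E.
Proof.
move=> s0 st; have t0 := le_trans s0 st.
pose c w := slope t (X s w).
have c0 w : 0 <= c w by rewrite slope_ge0// X_ge0.
have mc : measurable_fun setT c.
  by apply: measurable_comp_on (slope_measurable t0) (mX s0) _ => w; exact: X_ge0.
pose D w := (\int[mu]_(r in `]s, t]) (drift (w, r))%:E)%E.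
have mD : measurable_fun setT D by exact: drift_int.
have D0 w : (0 <= D w)%E by exact: drift_ge0E.
have cE0 w : (0 <= (c w)%:E)%E by rewrite lee_fin.
have mcE : measurable_fun setT (EFin \o c) by exact/measurable_EFinP.
have mcM g : measurable_fun setT g -> measurable_fun setT (fun w => (c w)%:E * g w)%E.
  by move=> mg; exact: emeasurable_funM.
have mG (f : Om -> R) : measurable_fun setT f -> (forall w, 1 <= f w) ->
    measurable_fun setT (fun w => (G t (f w))%:E).
  move=> mf f1; apply/measurable_EFinP.
  exact: measurable_comp_on (G_measurable t0) mf f1.
have GE0 u : 1 <= u -> (0 <= (G t u)%:E)%E.
  by move=> u1; rewrite lee_fin (le_trans ler01)// G_ge1.
have mGN := mG _ (measurable_next_value t0) (fun w => next_value_ge1 w t0).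
have mGV := mG _ (VX_measurable s0) (fun w => VX1 w s0).
(* Bounding the slope by M makes the mean of slope times V(X s) finite; M tends to infinity at the
   end. *)
pose A M := alive s `&` [set w | c w <= M%:R].
have FA M : F s (A M).
  apply: filtrationI => //; first exact: alive_filtration.
  exact: (slope_filtration s0 t0 (measurable_itv `]-oo, M%:R])).
have mA M := filtration_measurable F_filtration s0 (FA M).
have step M : (\int[Pr]_(w in A M) ((G t (next_value t w))%:E + (c w)%:E * D w) <=
    \int[Pr]_(w in alive s) (G t (V (X s w)))%:E)%E.
  (* The events {y < c} lie in F s, so the supermartingale step holds on each of them, and the layer
     cake formula assembles them into the weight c. *)
  have w12 : (\int[Pr]_(w in A M) ((c w)%:E * ((next_value t w)%:E + D w)) <=
      \int[Pr]_(w in A M) ((c w)%:E * (V (X s w))%:E))%E.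
    apply: ge0_le_integral_weight => //.
    - by apply: emeasurable_funD => //; exact: next_EFin.
    - exact: VX_EFin.
    - by move=> w; rewrite adde_ge0// next_ge0.
    - by move=> w; exact: VX_ge0.
    - move=> y; apply: supermartingale_step => //.
        apply: filtrationI => //.
        have := slope_filtration s0 t0 (measurable_itv `]y, +oo[).
        by congr (F s); apply/seteqP; split => w /=; rewrite in_itv/= andbT.
      by move=> w [[]].
  have addI f g : (forall w, 0 <= f w)%E -> (forall w, 0 <= g w)%E ->
      measurable_fun setT f -> measurable_fun setT g ->
      (\int[Pr]_(w in A M) (f w + g w) =
       \int[Pr]_(w in A M) f w + \int[Pr]_(w in A M) g w)%E.
    by move=> f0 g0 mf mg; rewrite ge0_integralD//; exact: measurable_funTS.
  have fin : (\int[Pr]_(w in A M) ((c w)%:E * (V (X s w))%:E) \is a fin_num)%E.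
    rewrite ge0_fin_numE; last first.
      by apply: integral_ge0 => w _; rewrite mule_ge0// VX_ge0.
    apply: (@le_lt_trans _ _ (\int[Pr]_(w in alive s) (M%:R%:E * (V (X s w))%:E))%E).
      apply: (@le_trans _ _ (\int[Pr]_(w in A M) (M%:R%:E * (V (X s w))%:E))%E).
        apply: ge0_le_integral => //.
        - by move=> w _; rewrite mule_ge0// VX_ge0.
        - exact/measurable_funTS/mcM/VX_EFin.
        - exact/measurable_funTS/measurable_funeM/VX_EFin.
        - by move=> w [_ cM]; rewrite lee_wpmul2r ?VX_ge0// lee_fin.
      apply: ge0_subset_integral => //.
      - exact: measurable_alive.
      - exact/measurable_funTS/measurable_funeM/VX_EFin.
      - by move=> w _; rewrite mule_ge0 ?VX_ge0// lee_fin.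
      - exact: subIsetl.
    rewrite (ge0_integralZl _ (measurable_alive s0)) ?lee_fin//; last 2 first.
    - exact/measurable_funTS/VX_EFin.
    - by move=> w _; exact: VX_ge0.
    rewrite lte_mul_pinfty ?lee_fin//.
    exact: le_lt_trans (integral_V_alive s0) (ltry _).
  apply: (@le_trans _ _ (\int[Pr]_(w in A M) (G t (V (X s w)))%:E)%E); last first.
    apply: ge0_subset_integral => //.
    - exact: measurable_alive.
    - exact: measurable_funTS.
    - by move=> w _; exact/GE0/VX1.
    - exact: subIsetl.
  (* Pointwise, a1 + a2 <= a3 + a4 is the supporting line at V(X s) evaluated at [next_value],
     written without subtraction in [\bar R]. By [w12] the integral of a4 is at most that of a2,
     which is finite and cancels. *)
  pose a1 w := ((G t (next_value t w))%:E + (c w)%:E * D w)%E.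
  pose a2 w := ((c w)%:E * (V (X s w))%:E)%E.
  pose a3 w := (G t (V (X s w)))%:E.
  pose a4 w := ((c w)%:E * ((next_value t w)%:E + D w))%E.
  have a10 w : (0 <= a1 w)%E by rewrite adde_ge0 ?mule_ge0//; exact/GE0/next_value_ge1.
  have a20 w : (0 <= a2 w)%E by rewrite mule_ge0// VX_ge0.
  have a30 w : (0 <= a3 w)%E by exact/GE0/VX1.
  have a40 w : (0 <= a4 w)%E by rewrite mule_ge0// adde_ge0// next_ge0.
  have ma1 : measurable_fun setT a1 by apply: emeasurable_funD => //; exact: mcM.
  have ma2 : measurable_fun setT a2 by exact/mcM/VX_EFin.
  have ma4 : measurable_fun setT a4.
    by apply: mcM; apply: emeasurable_funD => //; exact: next_EFin.
  rewrite -(leeD2rE _ _ fin) -(addI a1 a2)// -(addI a3 a2)//.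
  apply: (@le_trans _ _ (\int[Pr]_(w in A M) (a3 w + a4 w))%E); last first.
    by rewrite !(addI a3)//; exact: leeD2l.
  apply: ge0_le_integral => //.
  - by move=> w _; rewrite adde_ge0.
  - by apply: measurable_funTS; apply: emeasurable_funD.
  - by apply: measurable_funTS; apply: emeasurable_funD.
  move=> w [sw _]; rewrite /a1 /a2 /a3 /a4 (ge0_muleDr _ (next_ge0 w t0) (D0 w)).
  rewrite addeAC [leRHS]addeA; move: ((c w)%:E * D w)%E => cD.
  apply: leeD2r; rewrite -!EFinM -!EFinD lee_fin.
  have := G_supporting_line phi_ge0 phi_concave phi_incr Phi_fin t0 (VX1 w s0)
    (phiV_gt0 (alive_gt0 s0 sw)) (next_value_ge1 w t0).
  by rewrite -/(slope t (X s w)) -/(c w) mulrBr -/G; lra.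
pose f w := ((G t (next_value t w))%:E + (c w)%:E * D w)%E.
have f0 w : (0 <= f w)%E.
  by rewrite adde_ge0 ?mule_ge0//; exact/GE0/next_value_ge1.
have mf : measurable_fun setT f by apply: emeasurable_funD => //; exact: mcM.
have := @ge0_nondecreasing_set_cvg_integral _ _ _ A f Pr.
move=> /(_ _ mA (fun=> measurable_funTS mf) (fun n w _ => f0 w)) cvgA.
have {cvgA} cvgA : (\int[Pr]_(w in A n) f w @[n --> \oo] -->
    \int[Pr]_(w in \bigcup_n A n) f w)%E.
  apply: cvgA => m n mn; apply/subsetPset => w [sw cm]; split => //=.
  by apply: le_trans cm _; rewrite ler_nat.
have UA : \bigcup_n A n = alive s.
  apply/seteqP; split => [w [n _ []]//|w sw].
  by exists (Num.truncn (c w)).+1 => //; split => //=; exact/ltW/truncnS_gt.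
rewrite -[leLHS]/(\int[Pr]_(w in alive s) f w)%E -UA -(cvg_lim _ cvgA)// UA.
apply: lime_le; first by apply/cvg_ex; eexists; exact: cvgA.
by apply: nearW => n; exact: step.
Qed.

Let integral_growth (f : R -> R) (C s : R) : 0 <= s -> 0 <= C ->
  measurable_fun (`[1, +oo[%classic : set (measurableTypeR R)) f ->
  (forall u, 1 <= u -> 0 <= f u) -> (forall u, 1 <= u -> f u <= C * u) ->
  (\int[Pr]_(w in alive s) (f (V (X s w)))%:E <= (C * V x)%:E)%E.
Proof.
move=> s0 C0 mf f0 fC; have ma := measurable_alive s0.
apply: (@le_trans _ _ (\int[Pr]_(w in alive s) (C%:E * (V (X s w))%:E))%E).
  apply: ge0_le_integral => //.
  - by move=> w _; rewrite lee_fin f0// VX1.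
  - apply: measurable_funTS; apply/measurable_EFinP.
    by apply: measurable_comp_on mf (VX_measurable s0) _ => w; exact: VX1.
  - exact/measurable_funTS/measurable_funeM/VX_EFin.
  - by move=> w _; rewrite -EFinM lee_fin fC// VX1.
rewrite (ge0_integralZl _ ma) ?lee_fin//; last 2 first.
- exact/measurable_funTS/VX_EFin.
- by move=> w _; exact: VX_ge0.
by rewrite EFinM lee_wpmul2l ?lee_fin// integral_V_alive.
Qed.

Let K s := (\int[Pr]_(w in alive s) (G s (V (X s w)))%:E)%E.

Let GE0 t u : 0 <= t -> 1 <= u -> (0 <= (G t u)%:E)%E.
Proof. by move=> t0 u1; rewrite lee_fin (le_trans ler01)// G_ge1. Qed.

Let phiGE0 t u : 0 <= t -> 1 <= u -> 0 <= phi (G t u).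
Proof. by move=> t0 u1; rewrite phi_ge0// G_ge1. Qed.

Let GV_measurable t s : 0 <= t -> 0 <= s ->
  measurable_fun setT (fun w => (G t (V (X s w)))%:E).
Proof.
move=> t0 s0; apply/measurable_EFinP.
by apply: measurable_comp_on (G_measurable t0) (VX_measurable s0) _ => w; exact: VX1.
Qed.

Let phiGV_measurable t s : 0 <= t -> 0 <= s ->
  measurable_fun setT (fun w => (phi (G t (V (X s w))))%:E).
Proof.
move=> t0 s0; apply/measurable_EFinP.
apply: (@measurable_comp_on _ _ _ _ (phi \o G t)) (VX_measurable s0) _.
  exact: phiG_measurable.
by move=> w; exact: VX1.
Qed.

Let GN_measurable t : 0 <= t ->
  measurable_fun setT (fun w => (G t (next_value t w))%:E).
Proof.
move=> t0; apply/measurable_EFinP.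
apply: measurable_comp_on (G_measurable t0) (measurable_next_value t0) _ => w.
exact: next_value_ge1.
Qed.

Let slopeE_measurable t s : 0 <= t -> 0 <= s ->
  measurable_fun setT (fun w => (slope t (X s w))%:E).
Proof.
move=> t0 s0; apply/measurable_EFinP.
by apply: measurable_comp_on (slope_measurable t0) (mX s0) _ => w; exact: X_ge0.
Qed.

Let slopeE_ge0 t s w : 0 <= t -> 0 <= s -> (0 <= (slope t (X s w))%:E)%E.
Proof. by move=> t0 s0; rewrite lee_fin slope_ge0// X_ge0. Qed.

Let K_next s t : 0 <= s -> s <= t ->
  (K t <= \int[Pr]_(w in alive s) (G t (next_value t w))%:E)%E.
Proof.
move=> s0 st; have t0 := le_trans s0 st.
rewrite [leLHS](_ : _ = \int[Pr]_(w in alive t) (G t (next_value t w))%:E)%E.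
  apply: ge0_subset_integral => //.
  - exact: measurable_alive.
  - exact: measurable_alive.
  - exact/measurable_funTS/GN_measurable.
  - by move=> w _; rewrite GE0// next_value_ge1.
  - exact: alive_anti.
by apply: eq_integral => w; rewrite inE /next_value => ->.
Qed.

Let K_le s t : 0 <= s -> s <= t ->
  (K t <= \int[Pr]_(w in alive s) (G t (V (X s w)))%:E)%E.
Proof.
move=> s0 st; have t0 := le_trans s0 st.
apply: le_trans (K_next s0 st) (le_trans _ (G_step s0 st)).
apply: ge0_le_integral => //.
- exact: measurable_alive.
- by move=> w _; rewrite GE0// next_value_ge1.
- exact/measurable_funTS/GN_measurable.
- apply: emeasurable_funD; first exact/measurable_funTS/GN_measurable.
  apply: measurable_funTS; apply: emeasurable_funM; first exact: slopeE_measurable.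
  exact: drift_int.
- by move=> w _; rewrite leeDl// mule_ge0// slopeE_ge0.
Qed.

Let K_ge0 s : 0 <= s -> (0 <= K s)%E.
Proof. by move=> s0; apply: integral_ge0 => w _; rewrite GE0// VX1. Qed.

Let K_initial t : 0 <= t -> (K t <= (G t (V x))%:E)%E.
Proof.
move=> t0; apply: le_trans (K_le (lexx 0) t0) _.
apply: (@initial_integral (G t \o V)).
- exact: measurable_alive.
- by apply/measurable_EFinP; exact: GV_measurable.
- by move=> z z0; rewrite -lee_fin GE0// V_ge1.
Qed.

(** * Time increments of E[G(s, V(X s)); s < tau] up to a fixed horizon *)

Section horizon.
Variable T : R.
Hypothesis T_ge0 : 0 <= T.

Let growth : exists2 C, 0 <= C & forall s t, 0 <= s -> 0 <= t -> t <= T ->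
  (\int[Pr]_(w in alive s) (G t (V (X s w)))%:E <= C%:E)%E /\
  (\int[Pr]_(w in alive s) (phi (G t (V (X s w))))%:E <= C%:E)%E.
Proof.
have [C C0 GC] := G_growth phi_ge0 phi_concave phi_incr Phi_fin T_ge0.
have p2 : 0 < phi 2 by apply: (phi_gt0 phi_ge0 phi_incr Phi_fin); lra.
have GT t u : 0 <= t -> t <= T -> 1 <= u -> G t u <= C * u.
  by move=> t0 tT u1; apply: le_trans (GC u u1); exact: G_le.
(* C is the linear growth constant of G(T, .), and phi contributes a further factor phi 2; 1 + phi 2
   dominates both 1 and phi 2. *)
exists ((1 + phi 2) * C * V x).
  by rewrite !mulr_ge0// addr_ge0// ltW.
move=> s t s0 t0 tT; split.
  apply: (le_trans (integral_growth (C := C) s0 C0 (G_measurable t0) _ _)).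
  - by move=> u u1; rewrite -lee_fin GE0.
  - by move=> u; exact: GT.
  - by rewrite lee_fin ler_wpM2r// ler_peMl// lerDl ltW.
apply: (le_trans (integral_growth (C := phi 2 * C) s0 _ (phiG_measurable t0) _ _)).
- by rewrite mulr_ge0// ltW.
- by move=> u u1; exact: phiGE0.
- move=> u u1 /=; apply: (le_trans (phi_growth phi_ge0 phi_concave phi_incr Phi_fin _)).
    exact: G_ge1.
  by rewrite -mulrA ler_wpM2l ?(ltW p2)// GT.
- by rewrite lee_fin ler_wpM2r// ler_wpM2r// lerDr.
Qed.

(* The fraction of its value at time s that the drift loses on average over
   ]s, s + h], weighted by the slope of G in u and integrated. *)
Let pos (p : Om * measurableTypeR R) : R := Num.max 0 p.2.
Let past h p : \bar R :=
  (\int[mu]_(r in `]pos p, (pos p + h)%R]) (drift (p.1, r))%:E)%E.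
Let weight (p : Om * measurableTypeR R) : R :=
  phi (G T (V (X (pos p) p.1))) * \1_(alive (pos p)) p.1.
Let loss h p : \bar R := ((weight p)%:E *
   maxe 0 (1 - ((h * phi (V (X (pos p) p.1)))^-1)%:E * past h p))%E.

Let pos_ge0 p : 0 <= pos p. Proof. by rewrite /pos le_max lexx. Qed.

Let weight_ge0 p : 0 <= weight p.
Proof. by rewrite /weight mulr_ge0// phiGE0// VX1. Qed.

Let loss_ge0 h p : (0 <= loss h p)%E.
Proof. by rewrite /loss mule_ge0 ?lee_fin// le_max lexx. Qed.

Let past_ge0 h p : (0 <= past h p)%E.
Proof. exact: drift_ge0E. Qed.

Let loss_le h p : 0 <= h -> (loss h p <= (weight p)%:E)%E.
Proof.
move=> h0; rewrite -[leRHS]mule1 lee_wpmul2l ?lee_fin//.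
rewrite ge_max lee_fin ler01/= -[leRHS]sube0 leeB// mule_ge0//.
by rewrite lee_fin invr_ge0 mulr_ge0// phi_ge0// VX1.
Qed.

Let weight_measurable : measurable_fun setT weight.
Proof.
apply: measurable_funM => //.
apply: (@measurable_comp_on _ _ _ _ (phi \o G T)) VX_joint _.
  exact: phiG_measurable.
by move=> p; apply: VX1; exact: pos_ge0.
Qed.

Let pos_measurable : measurable_fun setT pos.
Proof. exact: measurable_maxr. Qed.

Let past_measurable h : measurable_fun setT (past h).
Proof.
pose E := [set q : (Om * measurableTypeR R) * measurableTypeR R | pos q.1 < q.2] `&`
  [set q | q.2 <= pos q.1 + h].
have mp : measurable_fun [set: (Om * measurableTypeR R) * measurableTypeR R]
    (pos \o fst) by exact: measurableT_comp.
have mE : measurable E.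
  apply: measurableI; rewrite -[X in measurable X]setTI.
    have : measurable_fun [set: (Om * measurableTypeR R) * measurableTypeR R]
        (fun q => pos q.1 < q.2) by exact: measurable_fun_ltr.
    by move=> /(_ measurableT [set true]); exact.
  have : measurable_fun [set: (Om * measurableTypeR R) * measurableTypeR R]
      (fun q => q.2 <= pos q.1 + h).
    by apply: measurable_fun_ler => //; exact: measurable_funD.
  by move=> /(_ measurableT [set true]); exact.
pose f (q : (Om * measurableTypeR R) * measurableTypeR R) := (drift (q.1.1, q.2))%:E.
have mf : measurable_fun setT f.
  apply/measurable_EFinP; apply: (measurableT_comp measurable_drift).
  apply: measurable_fun_pair => //; exact: measurableT_comp measurable_fst measurable_fst.
have mfE : measurable_fun setT (f \_ E).
  exact/(measurable_restrictT _ mE)/measurable_funTS.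
have fE0 q : (0 <= (f \_ E) q)%E.
  by apply: erestrict_ge0 => ? _; rewrite lee_fin drift_ge0.
have := measurable_section_integral measurableT mfE fE0.
apply: eq_measurable_fun => p _; rewrite /past [RHS]integral_mkcond.
apply: eq_integral => r _; rewrite !patchE; congr (if _ then _ else _).
by apply/idP/idP; rewrite !inE/= in_itv/= => /andP.
Qed.

Let loss_measurable h : measurable_fun setT (loss h).
Proof.
apply: emeasurable_funM; first by apply/measurable_EFinP.
apply: measurable_maxe => //; apply: emeasurable_funB => //.
apply: emeasurable_funM => //; apply/measurable_EFinP.
have mphi : measurable_fun setT (fun p => phi (V (X (pos p) p.1))).
  by apply: measurable_comp_on (measurable_phi phi_incr) VX_joint _ => p; apply: VX1; exact: pos_ge0.
rewrite (_ : (fun p => _) = fun p => h^-1 * (phi (V (X (pos p) p.1)))^-1).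
  apply: measurable_funM => //; apply: measurable_inv_ge0 => // p _.
  by rewrite phi_ge0// VX1.
by apply/funext => p; rewrite invfM.
Qed.

(** Let t = s + h, g = phi(V(X s)), y = phi(G(t, V(X s))), and let D be the drift over ]s, t].
    Advancing the time in G costs at most h y by [G_time], while [G_step] returns (y / g) D. The
    balance h y (1 - D / (h g)) is at most h times the loss, since y <= phi(G(T, V(X s))). *)
Let K_increment s h : 0 <= s -> 0 < h -> s + h <= T ->
  (K (s + h) <= K s + h%:E * \int[Pr]_w loss h (w, s))%E.
Proof.
move=> s0 h0 shT; set t := s + h; have t0 : 0 <= t by rewrite addr_ge0// ltW.
have st : s <= t by rewrite lerDl ltW.
have [C C0 GC] := growth; have ma := measurable_alive s0.
pose D w := (\int[mu]_(r in `]s, t]) (drift (w, r))%:E)%E.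
pose a w := ((slope t (X s w))%:E * D w)%E.
have mD : measurable_fun setT D by exact: drift_int.
have D0 w : (0 <= D w)%E by exact: drift_ge0E.
have ma' : measurable_fun setT a.
  by apply: emeasurable_funM => //; exact: slopeE_measurable.
have a0 w : (0 <= a w)%E by rewrite mule_ge0// slopeE_ge0.
pose l w := loss h (w, s).
have ml : measurable_fun setT l.
  exact: (measurableT_comp (loss_measurable h) (measurable_pair2 s)).
have l0 w : (0 <= l w)%E by exact: loss_ge0.
have hl0 w : (0 <= h%:E * l w)%E by rewrite mule_ge0// lee_fin ltW.
have mhl : measurable_fun setT (fun w => h%:E * l w)%E by exact: measurable_funeM.
have addI f g : (forall w, 0 <= f w)%E -> (forall w, 0 <= g w)%E ->
    measurable_fun setT f -> measurable_fun setT g ->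
    (\int[Pr]_(w in alive s) (f w + g w) =
     \int[Pr]_(w in alive s) f w + \int[Pr]_(w in alive s) g w)%E.
  by move=> f0 g0 mf mg; rewrite ge0_integralD//; exact: measurable_funTS.
have GN0 w : (0 <= (G t (next_value t w))%:E)%E by rewrite GE0// next_value_ge1.
have mGN := GN_measurable t0.
have GVs0 w : (0 <= (G s (V (X s w)))%:E)%E by rewrite GE0// VX1.
have mGVs := GV_measurable s0 s0.
have step := G_step s0 st; rewrite -/t in step.
rewrite (addI (fun w => (G t (next_value t w))%:E) a)// in step.
have fina : (\int[Pr]_(w in alive s) a w \is a fin_num)%E.
  rewrite ge0_fin_numE ?integral_ge0//.
  apply: le_lt_trans (ltry C); apply: le_trans (GC s t s0 t0 shT).1.
  by apply: le_trans step; rewrite leeDr// integral_ge0.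
have up : (\int[Pr]_(w in alive s) (G t (V (X s w)))%:E <=
    K s + h%:E * \int[Pr]_w l w + \int[Pr]_(w in alive s) a w)%E.
  apply: (@le_trans _ _ (\int[Pr]_(w in alive s)
      ((G s (V (X s w)))%:E + h%:E * l w + a w))%E).
    apply: ge0_le_integral => //.
    - by move=> w _; rewrite GE0// VX1.
    - exact/measurable_funTS/GV_measurable.
    - apply: measurable_funTS; apply: emeasurable_funD => //.
      exact: emeasurable_funD.
    move=> w sw; pose g := phi (V (X s w)); pose y := phi (G t (V (X s w))).
    have g0 : 0 < g by apply: phiV_gt0; exact: alive_gt0.
    have y0 : 0 <= y by rewrite /y phiGE0// VX1.
    have yT : y <= phi (G T (V (X s w))).
      by apply: phi_incr; [rewrite G_ge1// VX1|rewrite G_le// VX1].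
    have Gt : G t (V (X s w)) <= G s (V (X s w)) + h * y.
      exact: (G_time phi_ge0 phi_concave phi_incr Phi_fin s0 (ltW h0) (VX1 w s0)).
    apply: (@le_trans _ _ ((G s (V (X s w)))%:E + (h * y)%:E)%E).
      by rewrite -EFinD lee_fin.
    rewrite -addeA leeD2l// /a /l /loss/= /weight /past.
    have -> : pos (w, s) = s by rewrite /pos/= max_r.
    rewrite indicE mem_set// mulr1 -/g -/(D w) /slope -/y -/g.
    move: (D0 w); case: (D w) => [r| |]// r0.
      rewrite -EFinM -EFinB -EFin_max -!EFinM -EFinD lee_fin.
      set m := Num.max 0 _.
      have m0 : 0 <= m by rewrite le_max lexx.
      have qm : 1 - (h * g)^-1 * r <= m by rewrite le_max lexx orbT.
      have e1 : h * (y * (1 - (h * g)^-1 * r)) = h * y - y / g * r.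
        by field; rewrite !gt_eqF.
      have e2 : h * (y * (1 - (h * g)^-1 * r)) <=
          h * (phi (G T (V (X s w))) * m).
        rewrite ler_pM2l//; apply: (@le_trans _ _ (y * m)).
          by rewrite ler_wpM2l.
        by rewrite ler_wpM2r.
      by move: e2; rewrite e1 lerBlDr.
    (* An infinite drift makes the right-hand side +oo, except when y = 0, and then the left-hand
       side is 0. *)
    have [->|yn0] := eqVneq y 0; first by rewrite mulr0 !(mul0r, mul0e) adde_ge0 ?mule_ge0 ?lee_fin ?phiGE0 ?VX1 ?le_max ?lexx ?(ltW h0).
    have yg : (0 < (y / g)%:E)%E by rewrite lte_fin divr_gt0// lt_neqAle eq_sym yn0.
    rewrite (gt0_muley yg).
    by rewrite addey ?leey// gt_eqF// (lt_le_trans (ltNyr 0))// mule_ge0 ?lee_fin ?(ltW h0)// mule_ge0 ?lee_fin ?phiGE0 ?VX1// le_max lexx.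
  rewrite (addI _ a)//; last 2 first.
  - by move=> w; rewrite adde_ge0.
  - exact: emeasurable_funD.
  apply: leeD2r; rewrite (addI _ (fun w => h%:E * l w)%E)//; apply: leeD2l.
  rewrite ge0_integralZl ?lee_fin ?(ltW h0)//; last exact: measurable_funTS.
  by rewrite lee_wpmul2l ?lee_fin ?(ltW h0)// ge0_subset_integral.
rewrite -(leeD2rE _ _ fina); apply: le_trans up; apply: le_trans step.
exact/leeD2r/K_next.
Qed.

Let K_fin s : 0 <= s -> s <= T -> K s \is a fin_num.
Proof.
move=> s0 sT; have [C C0 GC] := growth.
rewrite ge0_fin_numE ?K_ge0//; apply: le_lt_trans (ltry C).
exact: (GC s s s0 s0 sT).1.
Qed.

(** A one-sided Lipschitz bound. It makes s -> K s - C s nonincreasing, whence the measurability of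
    K, and it bounds K from below just before T. *)
Let K_growth : exists2 C, 0 <= C & forall s t, 0 <= s -> s <= t -> t <= T ->
  (K t <= K s + ((t - s) * C)%:E)%E.
Proof.
have [C C0 GC] := growth; exists C => // s t s0 st tT.
have t0 := le_trans s0 st; apply: (le_trans (K_le s0 st)).
have ma := measurable_alive s0.
have ts0 : 0 <= t - s by rewrite subr_ge0.
apply: (@le_trans _ _ (\int[Pr]_(w in alive s) ((G s (V (X s w)))%:E +
    (t - s)%:E * (phi (G t (V (X s w))))%:E))%E).
  apply: ge0_le_integral => //.
  - by move=> w _; rewrite GE0// VX1.
  - exact/measurable_funTS/GV_measurable.
  - apply: measurable_funTS; apply: emeasurable_funD; first exact: GV_measurable.
    by apply: measurable_funeM; exact: phiGV_measurable.
  - move=> w _; rewrite -EFinM -EFinD lee_fin.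
    have := G_time phi_ge0 phi_concave phi_incr Phi_fin s0 ts0 (VX1 w s0).
    by rewrite (addrC s) subrK.
rewrite ge0_integralD//; last 4 first.
- by move=> w _; rewrite GE0// VX1.
- exact/measurable_funTS/GV_measurable.
- by move=> w _; rewrite mule_ge0 ?lee_fin// phiGE0// VX1.
- by apply/measurable_funTS/measurable_funeM; exact: phiGV_measurable.
rewrite leeD2l// (ge0_integralZl _ ma) ?lee_fin//; last 2 first.
- exact/measurable_funTS/phiGV_measurable.
- by move=> w _; rewrite lee_fin phiGE0// VX1.
by rewrite EFinM lee_wpmul2l ?lee_fin// (GC s t s0 t0 tT).2.
Qed.

Let loss_dead h w s : 0 <= s -> ~ alive s w -> loss h (w, s) = 0%E.
Proof.
move=> s0 sw; rewrite /loss /weight.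
have -> : pos (w, s) = s by rewrite /pos/= max_r.
by rewrite indicE memNset// mulr0 mul0e.
Qed.

(** At almost every s < tau the average of the drift over ]s, s + h n] tends to phi(V(X s)) by
    Lebesgue differentiation, so the ratio in the loss tends to 1. The weight dominates the loss. *)
Let loss_vanish_at (h : R^nat) w : (forall n, 0 < h n) -> (forall n, h n <= T) ->
  h n @[n --> \oo] --> (0 : R) ->
  (\int[mu]_(s in `[0%R, T]) (weight (w, s))%:E < +oo)%E ->
  (\int[mu]_(r in `[0%R, (2 * T)%R]) (drift (w, r))%:E < +oo)%E ->
  (\int[mu]_(s in `[0%R, T]) loss (h n) (w, s))%E @[n --> \oo] --> 0%E.
Proof.
move=> h0 hT hc wfin dfin.
have mw : measurable_fun [set: measurableTypeR R] (fun s => weight (w, s)).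
  exact: (measurableT_comp weight_measurable (measurable_pair1 w)).
pose f r := drift (w, r).
(* The windows ]s, s + h n] with s <= T and h n <= T stay inside [0, 2 T]. *)
have intf : mu.-integrable `[0, 2 * T] (EFin \o f).
  apply/integrableP; split; first by apply: measurable_funTS; exact: (drift_section w).
  apply: le_lt_trans dfin; rewrite le_eqVlt; apply/orP; left; apply/eqP.
  by apply: eq_integral => r _ /=; rewrite ger0_norm// drift_ge0.
have := ae_right_average (integrable_locally (measurable_itv _) intf) h0 hc.
move=> avg.
have [] := @dominated_convergence _ _ _ mu `[0%R, T]%classic (measurable_itv _)
  (fun n s => loss (h n) (w, s)) (cst 0%E) (fun s => (weight (w, s))%:E).
- move=> n; apply: measurable_funTS.
  exact: (measurableT_comp (loss_measurable (h n)) (measurable_pair1 w)).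
- exact: measurable_cst.
- apply: filterS avg; first exact: (ae_filter_ringOfSetsType mu).
  move=> s avg /=; rewrite in_itv/= => /andP[s0 sT].
  have [sw|sw] := pselect (alive s w); last first.
    rewrite (_ : (fun n => _) = cst 0%E); first exact: cvg_cst.
    by apply/funext => n; exact: loss_dead.
  have ps : pos (w, s) = s by rewrite /pos/= max_r.
  pose g := phi (V (X s w)).
  have g0 : 0 < g by apply: phiV_gt0; exact: alive_gt0.
  pose u n := (g^-1%:E * ((h n)^-1%:E *
    \int[mu]_(r in `]s, (s + h n)%R]) (drift (w, r))%:E))%E.
  have cu : u n @[n --> \oo] --> 1%E.
    have -> : 1%E = (g^-1%:E * (f s)%:E)%E.
      by rewrite /f driftE// -EFinM mulVf// gt_eqF.
    have fs : (f \_ `[0, 2 * T]) s = f s.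
      by rewrite patchE mem_set//= in_itv/= s0; lra.
    apply: cvgeZl => //; move: avg; rewrite fs; apply: cvg_trans.
    apply: near_eq_cvg; apply: nearW => n; congr (_ * _)%E.
    apply: eq_integral => r; rewrite inE/= in_itv/= => /andP[sr rs].
    rewrite patchE mem_set//= in_itv/=; have := hT n; lra.
  apply: (@squeeze_cvge _ _ _ _ (cst 0%E) _
    (fun n => (weight (w, s))%:E * `|1 - u n|)%E).
  + apply: nearW => n; rewrite loss_ge0/= /loss lee_wpmul2l ?lee_fin//.
    rewrite /past ps/= -/g invfM (mulrC (h n)^-1) EFinM -muleA -/(u n).
    by rewrite ge_max abse_ge0/= lee_abs.
  + exact: cvg_cst.
  + rewrite -(mule0 (weight (w, s))%:E); apply: cvgeZl => //.
    apply/cvg_abse0P; rewrite -(@subee _ 1%E)//; apply: cvgeB => //.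
    exact: cvg_cst.
- apply/integrableP; split; first by apply/measurable_EFinP; exact: measurable_funTS.
  apply: le_lt_trans wfin; rewrite le_eqVlt; apply/orP; left; apply/eqP.
  by apply: eq_integral => r _ /=; rewrite ger0_norm.
- apply: aeW => s n _; rewrite gee0_abs//; apply: loss_le; exact: ltW.
by move=> _ _; rewrite integral0.
Qed.

(** The drift is dead off {0 < tau}, and on this event [supermartingale_step] over [0, 2 T] bounds
    its mean by V x. *)
Let past_integral : (\int[Pr]_w \int[mu]_(r in `[0%R, (2 * T)%R]) (drift (w, r))%:E < +oo)%E.
Proof.
have T2 : 0 <= 2 * T by rewrite mulr_ge0.
apply: le_lt_trans (ltry (V x)).
apply: (@le_trans _ _ (\int[Pr]_(w in alive 0) ((next_value (2 * T) w)%:E +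
    \int[mu]_(r in `]0%R, (2 * T)%R]) (drift (w, r))%:E)))%E.
  rewrite [leRHS]integral_mkcond; apply: ge0_le_integral => //.
  - exact: drift_int.
  - apply/(measurable_restrictT _ (measurable_alive (lexx 0))).
    apply: emeasurable_funD; first exact/measurable_funTS/next_EFin.
    exact/measurable_funTS/drift_int.
  - move=> w _; rewrite patchE; case: ifPn => [_|].
      rewrite -integral_itv_obnd_cbnd; last exact: (measurable_funTS (drift_section w)).
      by rewrite leeDr// next_ge0.
    rewrite notin_setE => w0; rewrite integral0_eq// => r; rewrite /= in_itv/=.
    by move=> /andP[r0 _]; rewrite drift_dead// => rw; exact/w0/(alive_anti r0).
apply: le_trans (supermartingale_step (lexx 0) T2 (alive_filtration (lexx 0)) _) _ => //.
by apply: integral_V_alive.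
Qed.

Let weight_integral : (\int[Pr]_w \int[mu]_(s in `[0%R, T]) (weight (w, s))%:E < +oo)%E.
Proof.
have [C C0 GC] := growth.
have [] := @fubini_tonelli_on _ _ _ Pr (EFin \o weight) `[0%R, T]%classic.
- exact: measurable_itv.
- exact/measurable_EFinP.
- by move=> p; rewrite lee_fin.
move=> mW <-; apply: (@le_lt_trans _ _ (\int[mu]_(s in `[0%R, T]) C%:E)%E).
  apply: ge0_le_integral => //.
  - by move=> s _; apply: integral_ge0 => w _; rewrite lee_fin.
  - move=> s; rewrite /= in_itv/= => /andP[s0 sT].
    apply: le_trans (GC s T s0 T_ge0 (lexx T)).2; rewrite [leRHS]integral_mkcond.
    rewrite le_eqVlt; apply/orP; left; apply/eqP; apply: eq_integral => w _.
    rewrite /= /weight patchE indicE.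
    have -> : pos (w, s) = s by rewrite /pos/= max_r.
    by case: ifPn; rewrite ?mulr1 ?mulr0.
rewrite integral_cst//= lebesgue_measure_itv/= lte_fin.
by case: (ltP 0 T) => _; [rewrite -EFinD -EFinM ltry|rewrite mule0 ltry].
Qed.

(** After Tonelli the time integral is inside the expectation. Almost every w satisfies the two
    finiteness conditions of [loss_vanish_at], and a second dominated convergence, under the
    expectation, concludes. *)
Let loss_vanish (h : R^nat) : (forall n, 0 < h n) -> (forall n, h n <= T) ->
  h n @[n --> \oo] --> (0 : R) ->
  (\int[mu]_(s in `[0%R, T]) \int[Pr]_w loss (h n) (w, s))%E @[n --> \oo] --> 0%E.
Proof.
move=> h0 hT hc.
have FT n := @fubini_tonelli_on _ _ _ Pr (loss (h n)) `[0%R, T]%classic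
  (measurable_itv _) (loss_measurable (h n)) (loss_ge0 (h n)).
under eq_cvg do rewrite (FT _).2.
have mJ n : measurable_fun setT (fun w => \int[mu]_(s in `[0%R, T]) loss (h n) (w, s))%E.
  exact: measurable_section_integral.
have mJw : measurable_fun setT (fun w => \int[mu]_(s in `[0%R, T]) (weight (w, s))%:E)%E.
  apply: (measurable_section_integral (f := EFin \o weight)) => //.
  by apply/measurable_EFinP.
have ae_fin (f : Om -> \bar R) : measurable_fun setT f -> (forall w, 0 <= f w)%E ->
    (\int[Pr]_w f w < +oo)%E -> {ae Pr, forall w, (f w < +oo)%E}.
  move=> mf f0 finf; have intf : Pr.-integrable setT f.
    apply/integrableP; split => //; apply: le_lt_trans finf.
    by rewrite le_eqVlt; apply/orP; left; apply/eqP/eq_integral => w _; rewrite gee0_abs.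
  by apply: filterS (integrable_ae measurableT intf) => w /(_ I) /fin_numPlt/andP[].
have Jw0 w : (0 <= \int[mu]_(s in `[0%R, T]) (weight (w, s))%:E)%E.
  by apply: integral_ge0 => s _; rewrite lee_fin.
have ae1 := ae_fin _ mJw Jw0 weight_integral.
have ae2 := ae_fin _ (drift_int (measurable_itv `[0%R, (2 * T)%R]))
  (fun w => drift_ge0E _ w) past_integral.
have [] := @dominated_convergence _ _ _ Pr setT measurableT
  (fun n w => \int[mu]_(s in `[0%R, T]) loss (h n) (w, s))%E (cst 0%E)
  (fun w => \int[mu]_(s in `[0%R, T]) (weight (w, s))%:E)%E mJ.
- exact: measurable_cst.
- by apply: filterS2 ae1 ae2 => w w1 w2 _; exact: loss_vanish_at.
- apply/integrableP; split => //; apply: le_lt_trans weight_integral.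
  by rewrite le_eqVlt; apply/orP; left; apply/eqP/eq_integral => w _; rewrite gee0_abs.
- apply: aeW => w n _; rewrite gee0_abs ?integral_ge0//; apply: ge0_le_integral => //.
  + apply: measurable_funTS.
    exact: (measurableT_comp (loss_measurable (h n)) (measurable_pair1 w)).
  + apply: measurable_funTS; apply/measurable_EFinP.
    exact: (measurableT_comp weight_measurable (measurable_pair1 w)).
  + by move=> s _; apply: loss_le; exact: ltW.
by move=> _ _; rewrite integral0.
Qed.

Let K_measurable : measurable_fun
  (`[0%R, T]%classic : set (measurableTypeR R)) (fun s => fine (K s)).
Proof.
have [C C0 KC] := K_growth.
pose clamp s := Num.min T (Num.max 0 s).
have clamp0 s : 0 <= clamp s by rewrite le_min T_ge0 le_max lexx.
have clampT s : clamp s <= T by rewrite ge_min lexx.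
have clamp_nd s t : s <= t -> clamp s <= clamp t.
  move=> st; rewrite le_min ge_min lexx/= ge_min; apply/orP; right.
  by rewrite ge_max !le_max lexx st orbT.
apply: (@eq_measurable_fun _ _ _ _ _
    (fun s => (fine (K (clamp s)) - C * clamp s) + C * clamp s)).
  move=> s; rewrite inE/= in_itv/= => /andP[s0 sT].
  by rewrite subrK /clamp max_r// min_r.
apply: measurable_funTS; apply: measurable_funD.
  apply: nonincreasing_measurable => // s t st.
  have := KC (clamp s) (clamp t) (clamp0 s) (clamp_nd _ _ st) (clampT t).
  have f1 := K_fin (clamp0 s) (clampT s); have f2 := K_fin (clamp0 t) (clampT t).
  rewrite -{1}(fineK f1) -{1}(fineK f2) -EFinD lee_fin.
  by rewrite mulrBl (mulrC C) (mulrC C); lra.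
apply: nondecreasing_measurable => // s t st.
by rewrite ler_wpM2l// clamp_nd.
Qed.

(* E[G(T, V(X_T)); T < tau_0] <= V(x): averaging K_increment over a window of
   length h shows that s |-> E[G(s, V(X_s)); s < tau_0] does not increase, up to
   errors that vanish with h; no path regularity of V(X) is needed. *)
Lemma integral_G_alive :
  (\int[Pr]_(w in alive T) (Gfun phi T (V (X T w)))%:E <= (V x)%:E)%E.
Proof.
have Vx1 := V_ge1 x_ge0.
have [T0|T0] := leP T 0.
  have Teq : T = 0 by apply/eqP; rewrite eq_le T0 T_ge0.
  apply: (le_trans (K_initial T_ge0)); rewrite Teq /G.
  by rewrite (G0 phi_ge0 phi_concave phi_incr Phi_fin).
(* The denominator n + 2 ensures 2 h n <= T, so that the two end windows do not overlap. *)
pose h n : R := T / n.+2%:R.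
have h0 n : 0 < h n by rewrite divr_gt0.
have h2 n : 2 * h n <= T.
  by rewrite /h mulrCA ler_piMr// ?(ltW T0)// ler_pdivrMr// mul1r ler_nat.
have hT n : h n <= T by have := h2 n; have := h0 n; lra.
have hc : h n @[n --> \oo] --> (0 : R).
  rewrite -(mulr0 T); apply: cvgMl_tmp.
  by have := @cvg_harmonic R; rewrite -cvg_shiftS.
have [C C0 GC] := growth; have [C' C'0 KC] := K_growth.
(* The first window costs at most h n times phi(G(T, V x)), by [G_time]; the last one at most h n
   times C', by [K_growth]. *)
pose c := C' + phi (G T (V x)).
pose E n := (\int[mu]_(s in `[0%R, T]) \int[Pr]_w loss (h n) (w, s))%E.
have bound n : (K T <= (V x)%:E + (h n * c)%:E + E n)%E.
  have Gh : G (h n) (V x) <= V x + h n * phi (G T (V x)).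
    have := G_time phi_ge0 phi_concave phi_incr Phi_fin (lexx 0) (ltW (h0 n)) Vx1.
    rewrite add0r (G0 phi_ge0 phi_concave phi_incr Phi_fin)// => /le_trans; apply.
    rewrite lerD2l ler_pM2l//; apply: phi_incr; first exact/G_ge1/Vx1/ltW/h0.
    by apply: G_le => //; exact: ltW.
  have := @averaged_increments R T (h n) C (G (h n) (V x)) (fine (K T) - h n * C')
    (fun s => fine (K s)) (fun s => \int[Pr]_w loss (h n) (w, s))%E
    (h0 n) (h2 n) K_measurable.
  have FT := @fubini_tonelli_on _ _ _ Pr (loss (h n)) `[0%R, T]%classic
    (measurable_itv _) (loss_measurable (h n)) (loss_ge0 (h n)).
  move=> /(_ _ FT.1 _ _ _ _); rewrite -/(E n) => H.
  have {H} : ((fine (K T) - h n * C')%:E <= (G (h n) (V x))%:E + E n)%E.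
    apply: H.
    - move=> s /andP[s0 sT]; rewrite fine_ge0 ?K_ge0//=.
      by rewrite -lee_fin fineK ?K_fin//; exact: (GC s s s0 s0 sT).1.
    - by move=> s; apply: integral_ge0.
    - move=> s /andP[s0 sT]; have sh : s + h n <= T by rewrite -lerBrDr.
      have hn := ltW (h0 n).
      rewrite !fineK ?K_fin//; [exact: K_increment|lra|lra].
    - move=> s /andP[s0 sh]; have sT := le_trans sh (hT n).
      rewrite -lee_fin fineK ?K_fin//; apply: (le_trans (K_initial s0)).
      by rewrite lee_fin; exact: G_le.
    - move=> s /andP[hs sT]; have s0 : 0 <= s by have := hT n; lra.
      rewrite lerBlDr -lee_fin EFinD !fineK ?K_fin//.
      apply: (le_trans (KC s T s0 sT (lexx T))); rewrite leeD2l// lee_fin.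
      by rewrite ler_wpM2r//; lra.
  rewrite EFinB fineK ?K_fin// leeBlDr// => /le_trans; apply.
  rewrite addeAC leeD2r// -!EFinD lee_fin /c mulrDr; lra.
have cv : ((V x)%:E + (h n * c)%:E + E n)%E @[n --> \oo] --> (V x)%:E.
  rewrite -[X in _ --> X]adde0 -[X in _ --> (X + _)%E]adde0.
  apply: cvgeD => //; last exact: loss_vanish.
  apply: cvgeD => //; first exact: cvg_cst.
  apply: cvg_EFin; first by apply: nearW.
  by rewrite -(mul0r c); exact: cvgMr_tmp.
by apply: (cvge_ge _ cv); exact: nearW.
Qed.

End horizon.

End lyapunov_estimate.

(** * Subtraction of measures and quantile coupling *)

Section measure_subtraction.
Local Open Scope ereal_scope.
Context {R : realType}.
Local Notation RR := (measurableTypeR R).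

Lemma itvNyc_splitE (m : {measure set RR -> \bar R}) (a b : R) : (a <= b)%R ->
  m `]-oo, b]%classic = m `]-oo, a]%classic + m `]a, b]%classic.
Proof.
move=> ab; rewrite -measureU//=.
  by congr (m _); apply: itv_bndbnd_setU; rewrite bnd_simp.
apply/seteqP; split => // u /=; rewrite !in_itv/= => -[ua /andP[au _]].
by move: ua; rewrite leNgt au.
Qed.

Lemma fin_measure_right_continuous (m : {measure set RR -> \bar R}) :
  m setT < +oo -> right_continuous (fun x : R => fine (m `]-oo, x]%classic)).
Proof.
move=> mT x; have mfin (B : set RR) : measurable B -> m B \is a fin_num.
  move=> mB; rewrite ge0_fin_numE//; apply: le_lt_trans mT.
  by apply: le_measure => //; rewrite inE.
apply/cvg_at_rightP => u [xu ux]; apply: fine_cvg; rewrite fineK ?mfin//.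
have mE y : m `]-oo, y]%classic = \int[m]_z (\1_(`]-oo, y]%classic : set RR) z)%:E.
  by rewrite integral_indic// setIT.
rewrite mE; under eq_cvg do rewrite mE.
apply: (@dominated_cvg _ _ _ m setT measurableT
  (fun n z => (\1_(`]-oo, u n]%classic : set RR) z)%:E)
  (fun z => (\1_(`]-oo, x]%classic : set RR) z)%:E) (cst 1)) => //.
- by move=> n; apply/measurable_EFinP.
- move=> z _; apply: cvg_near_cst; have [zx|xz] := leP z x.
    apply: nearW => n; rewrite !indicE !mem_set//= in_itv/= (le_trans zx)//.
    exact: ltW.
  have : \forall n \near \oo, (u n < z)%R by apply: (cvgr_lt x).
  apply: filterS => n unz; rewrite !indicE !memNset//= in_itv/=; apply/negP.
    by rewrite -ltNge.
  by rewrite -ltNge.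
- apply/integrableP; split => //=.
  by under eq_integral do rewrite normr1; rewrite integral_cst// mul1e.
- by move=> n z _; rewrite /= indicE; case: (z \in _); rewrite /= ?normr1 ?normr0 lee_fin.
Qed.

Section subtraction.
Variables m1 m2 : {measure set RR -> \bar R}.
Hypothesis m1_fin : m1 setT < +oo.
Hypothesis m2_fin : m2 setT < +oo.
Hypothesis m21 : forall a b : R, (a < b)%R ->
  m2 `]a, b]%classic <= m1 `]a, b]%classic.

Let mfin (m : {measure set RR -> \bar R}) (B : set RR) : m setT < +oo ->
  measurable B -> m B \is a fin_num.
Proof.
move=> mT mB; rewrite ge0_fin_numE//; apply: le_lt_trans mT.
by apply: le_measure => //; rewrite inE.
Qed.

Let cdf1 (x : R) : R := fine (m1 `]-oo, x]%classic).
Let cdf2 (x : R) : R := fine (m2 `]-oo, x]%classic).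
Let cdfB (x : R) : R := (cdf1 x - cdf2 x)%R.

Let cdf1B (a b : R) : (a <= b)%R -> (cdf1 b - cdf1 a)%:E = m1 `]a, b]%classic.
Proof.
move=> ab; rewrite EFinB !fineK ?mfin// (itvNyc_splitE m1 ab).
by rewrite addeAC subee ?add0e// mfin.
Qed.

Let cdf2B (a b : R) : (a <= b)%R -> (cdf2 b - cdf2 a)%:E = m2 `]a, b]%classic.
Proof.
move=> ab; rewrite EFinB !fineK ?mfin// (itvNyc_splitE m2 ab).
by rewrite addeAC subee ?add0e// mfin.
Qed.

Let cdf1_nd : nondecreasing cdf1.
Proof.
by move=> a b ab; rewrite -subr_ge0 -lee_fin cdf1B.
Qed.

Let cdfB_nd : nondecreasing cdfB.
Proof.
move=> a b; rewrite le_eqVlt => /predU1P[->//|ab].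
have := m21 ab; rewrite -cdf1B ?(ltW ab)// -cdf2B ?(ltW ab)// lee_fin /cdfB.
lra.
Qed.

Let cdf1_rc : right_continuous cdf1.
Proof. exact: fin_measure_right_continuous. Qed.

Let cdfB_rc : right_continuous cdfB.
Proof. by move=> x; apply: cvgB; exact: fin_measure_right_continuous. Qed.

#[local] HB.instance Definition _ := isCumulative.Build R _ R cdf1 cdf1_nd cdf1_rc.
#[local] HB.instance Definition _ := isCumulative.Build R _ R cdfB cdfB_nd cdfB_rc.

Let ls_itv (f : cumulative R R) (a b : R) : (a <= b)%R ->
  lebesgue_stieltjes_measure f `]a, b]%classic = (f b - f a)%:E.
Proof.
move=> ab; rewrite /lebesgue_stieltjes_measure /measure_extension/=.
by rewrite measurable_mu_extE/= ?wlength_itv_bnd//; exact: is_ocitv.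
Qed.

(** Domination on intervals ]a, b] says that the difference of the two distribution functions is
    nondecreasing. It is also right-continuous, and nu is its Stieltjes measure. *)
Lemma measure_subtraction : exists nu : {measure set RR -> \bar R},
  forall B : set RR, measurable B -> m1 B = nu B + m2 B.
Proof.
exists (lebesgue_stieltjes_measure cdfB) => B mB.
rewrite -measure_addE.
transitivity (lebesgue_stieltjes_measure cdf1 B).
  apply/esym; apply: lebesgue_stieltjes_measure_unique => // _ [[a b] _ <-]/=.
  have [ab|ba] := leP a b; first by rewrite ls_itv// cdf1B.
  by rewrite set_itv_ge ?measure0// bnd_simp -leNgt ltW.
apply: lebesgue_stieltjes_measure_unique => // _ [[a b] _ <-]/=.
apply: etrans (esym (measure_addE _ _ _)).
have [ab|ba] := leP a b; last first.
  by rewrite set_itv_ge ?measure0 ?adde0// bnd_simp -leNgt ltW.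
rewrite ls_itv// -[LHS]/((cdf1 b - cdf1 a)%:E).
transitivity ((cdfB b - cdfB a)%:E + (cdf2 b - cdf2 a)%:E).
  by rewrite -EFinD; congr (_%:E); rewrite /cdfB; lra.
by congr (_ + _); [exact/esym/ls_itv|exact: cdf2B].
Qed.

End subtraction.

End measure_subtraction.

(** * Quantile functions, the stochastic maximum and the weighted norm *)

Section quantile_coupling.
Context (R : realType).
Local Notation RR := (measurableTypeR R).
Local Notation Rp := (`[0%R, +oo[%classic : set RR).
Implicit Types rho : probability RR R.

Let mRp : measurable Rp. Proof. exact: measurable_itv. Qed.

(** Subtracting each measure from the other shows that each dominates the other on every measurable
    set. *)
Lemma eq_finite_measure (m1 m2 : {measure set RR -> \bar R}) :
  (m1 setT < +oo)%E -> (m2 setT < +oo)%E ->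
  (forall a b : R, a < b -> m1 `]a, b]%classic = m2 `]a, b]%classic) ->
  forall B : set RR, measurable B -> m1 B = m2 B.
Proof.
move=> m1T m2T m12 B mB.
have [|nu1 E1] := measure_subtraction m1T m2T; first by move=> a b ab; rewrite m12.
have [|nu2 E2] := measure_subtraction m2T m1T; first by move=> a b ab; rewrite m12.
apply/eqP; rewrite eq_le; apply/andP; split; [rewrite E2//|rewrite E1//]; exact: leeDr.
Qed.

Lemma half_line_setI (mu : {measure set RR -> \bar R}) (B : set RR) :
  on_half_line mu -> measurable B -> mu (B `&` Rp) = mu B.
Proof.
move=> hrho mB; rewrite -[in RHS](setIT B) -(setUv Rp) setIUr measureU//.
- rewrite [X in (_ + X)%E](_ : _ = 0%E) ?adde0//.
  apply: (subset_measure0 _ (measurableC mRp) _ hrho) => //.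
  by apply: measurableI => //; exact: measurableC.
- exact: measurableI.
- by apply: measurableI => //; exact: measurableC.
- by rewrite setIACA setICr setI0.
Qed.

Definition prob_cdf rho (x : R) : R := fine (rho `]-oo, x]%classic).

Lemma prob_cdfE rho x : (prob_cdf rho x)%:E = rho `]-oo, x]%classic.
Proof. by rewrite fineK// fin_num_measure. Qed.

Lemma prob_cdf_nd rho : {homo prob_cdf rho : x y / x <= y}.
Proof.
move=> x y xy; rewrite -lee_fin !prob_cdfE le_measure ?inE//.
exact: subset_itvl.
Qed.

Lemma prob_cdf_ge0 rho x : 0 <= prob_cdf rho x.
Proof. by rewrite -lee_fin prob_cdfE. Qed.

Lemma prob_cdf_le1 rho x : prob_cdf rho x <= 1.
Proof. by rewrite -lee_fin prob_cdfE probability_le1. Qed.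

Lemma prob_cdf_tail rho x : rho `]x, +oo[%classic = (1 - prob_cdf rho x)%:E.
Proof.
have -> : `]x, +oo[%classic = ~` (`]-oo, x]%classic : set RR).
  by rewrite setCitvl.
by rewrite probability_setC// EFinB prob_cdfE.
Qed.

Lemma prob_cdf_reaches rho u : u < 1 -> exists2 x, 0 <= x & u <= prob_cdf rho x.
Proof.
move=> u1; have cv : rho `]-oo, n%:R]%classic @[n --> \oo] --> rho (\bigcup_n `]-oo, n%:R]%classic).
  apply: (@nondecreasing_cvg_mu _ _ _ rho (fun n => `]-oo, n%:R]%classic)) => //.
    exact: bigcup_measurable.
  by move=> n m nm; rewrite subsetEset; apply: subset_itvl; rewrite bnd_simp ler_nat.
have bT : \bigcup_n `]-oo, n%:R]%classic = [set: R].
  apply/seteqP; split => // x _; exists (Num.trunc `|x|).+1 => //=.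
  rewrite in_itv/=; apply: (le_trans (ler_norm x)); apply/ltW.
  exact: truncnS_gt.
move: cv; rewrite bT probability_setT => cv.
have : \forall n \near \oo, (u%:E < rho `]-oo, n%:R]%classic)%E.
  by apply: (cv [set y | (u%:E < y)%E]); exact: open_ereal_gt'.
case=> N _ /(_ N (leqnn N)); rewrite /= -prob_cdfE lte_fin => uN.
by exists N%:R => //; exact: ltW.
Qed.

(** The infimum over x >= 0 keeps the values in R_+. The value 0 outside ]0,
    1[ is a filler: u is uniform on ]0, 1[. *)
Definition quantile rho (u : R) : R :=
  if 0 < u < 1 then inf [set x | 0 <= x /\ u <= prob_cdf rho x] else 0.

Lemma quantile_ge0 rho u : 0 <= quantile rho u.
Proof.
rewrite /quantile; case: ifP => // /andP[_ u1].
have [x x0 ux] := prob_cdf_reaches rho u1.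
by apply: lb_le_inf => [|y []//]; exists x.
Qed.

(** Right-continuity of the distribution function makes the infimum a minimum: if it were below u at
    the infimum, it would stay below u just to the right, where S has points. *)
Lemma quantile_le rho u x : 0 < u < 1 -> 0 <= x ->
  (quantile rho u <= x) = (u <= prob_cdf rho x).
Proof.
move=> u01 x0; rewrite /quantile u01; set S := [set y | _].
have lbS : has_lbound S by exists 0 => y [].
have /andP[_ u1] := u01.
have infS : has_inf S.
  by split => //; have [y y0 uy] := prob_cdf_reaches rho u1; exists y.
apply/idP/idP => [Sx|ux]; last by apply: ge_inf.
apply: le_trans (prob_cdf_nd rho Sx).
have rT : (rho setT < +oo)%E by rewrite [X in (X < _)%E](probability_setT rho) ltry.
have cF := @fin_measure_right_continuous R rho rT (inf S).
rewrite leNgt; apply/negP => Fu.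
have [e /= e0 He] : \forall y \near (inf S)^'+, prob_cdf rho y < u.
  by apply: (cvgr_lt (prob_cdf rho (inf S))).
have [y [y0 uy] ye] := inf_adherent e0 infS.
have := ge_inf lbS (conj y0 uy : S y); rewrite le_eqVlt => /predU1P[yE|Sy].
  by move: Fu; rewrite yE ltNge uy.
have := He y; rewrite /ball/= distrC ger0_norm ?subr_ge0 ?(ltW Sy)// ltrBlDl => /(_ ye Sy).
by rewrite ltNge uy.
Qed.

Let U01 : set RR := `]0%R, 1%R[%classic.

Let mU01 : measurable U01. Proof. exact: measurable_itv. Qed.

Let U01E u : U01 u = (0 < u < 1) :> Prop.
Proof. by rewrite /U01/= in_itv. Qed.

Lemma quantile_preimage rho x : 0 <= x ->
  U01 `&` [set u | quantile rho u <= x] = U01 `&` `]-oo, prob_cdf rho x]%classic.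
Proof.
move=> x0; apply/seteqP; split => [u [u01 qx]|u [u01 ux]]; split => //=;
  have u01' : 0 < u < 1 by rewrite -U01E.
  by rewrite in_itv/= -quantile_le.
by move: ux; rewrite quantile_le//= in_itv.
Qed.

Lemma measurable_quantile rho : measurable_fun [set: RR] (quantile rho : RR -> RR).
Proof.
rewrite (_ : quantile rho = quantile rho \_ U01); last first.
  apply/funext => u; rewrite patchE; case: ifPn => //; rewrite notin_setE /U01/= in_itv/=.
  by move=> /negP; rewrite /quantile => /negbTE ->.
apply/(measurable_restrictT _ mU01).
apply: (measurability _ (RGenOInfty.measurableE R)) => _ [_ [x ->] <-].
rewrite (_ : _ `&` _ = U01 `\` (U01 `&` [set u | quantile rho u <= x])); last first.
  apply/seteqP; split => [u [u01] /=|u [u01] /= H]; rewrite ?in_itv/= ?andbT.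
    by rewrite ltNge => /negP h; split => // -[].
  by split => //; rewrite ltNge; apply/negP => h; apply: H.
apply: measurableD => //; have [x0|x0] := leP 0 x.
  by rewrite quantile_preimage//; apply: measurableI.
rewrite (_ : _ `&` _ = set0)//; apply/seteqP; split => // u [_] /=.
by rewrite leNgt (lt_le_trans x0 (quantile_ge0 _ _)).
Qed.

Let lebesgue_below (c : R) : 0 <= c -> c <= 1 ->
  (lebesgue_measure (U01 `&` `]-oo, c]%classic) = c%:E :> \bar R).
Proof.
move=> c0 c1; have [c1'|] := ltP c 1; last first.
  move=> c1'; have -> : c = 1 by apply/eqP; rewrite eq_le c1 c1'.
  rewrite (_ : _ `&` _ = U01).
    by rewrite lebesgue_measure_itv/= lte_fin ltr01 sube0.
  by apply/setIidPl => u; rewrite /U01/= !in_itv/= => /andP[_ /ltW].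
rewrite (_ : _ `&` _ = `]0%R, c]%classic).
  rewrite lebesgue_measure_itv/= lte_fin; case: ltP => [_|]; first by rewrite sube0.
  by move=> c0'; congr (_%:E); apply/eqP; rewrite eq_le c0 c0'.
apply/seteqP; split => u; rewrite /U01/= !in_itv/=.
  by move=> [/andP[-> _] ->].
by move=> /andP[-> uc]; rewrite uc (le_lt_trans uc).
Qed.

(** Inverse transform sampling. By [quantile_le] the two measures agree on ]-oo, x] for x >= 0; for
    x < 0 both vanish there, rho being carried by R_+. Intervals ]a, b] follow by cancellation. *)
Lemma quantile_law rho (B : set RR) : on_half_line rho -> measurable B ->
  rho B = lebesgue_measure (U01 `&` quantile rho @^-1` B).
Proof.
move=> hrho mB; have mq := measurable_quantile rho.
pose push := (pushforward (mrestr (@lebesgue_measure R) mU01) (quantile rho : RR -> RR))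
  : {measure set RR -> \bar R}.
pose m := push mq.
have mE C : m C = lebesgue_measure (U01 `&` quantile rho @^-1` C).
  by rewrite /m/push/= /pushforward/= /mrestr setIC.
have rT : (rho setT < +oo)%E by rewrite [X in (X < _)%E](probability_setT rho) ltry.
have mT : (m setT < +oo)%E.
  rewrite mE preimage_setT setIT /U01 lebesgue_measure_itv/= lte_fin ltr01.
  by rewrite -EFinB ltry.
have mcdf x : m `]-oo, x]%classic = rho `]-oo, x]%classic.
  rewrite mE; have [x0|x0] := leP 0 x.
    rewrite (_ : quantile rho @^-1` _ = [set u | quantile rho u <= x]); last first.
      by apply/seteqP; split => u /=; rewrite in_itv.
    by rewrite quantile_preimage// lebesgue_below ?prob_cdfE ?prob_cdf_ge0 ?prob_cdf_le1.
  rewrite (_ : _ `&` _ = set0); last first.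
    apply/seteqP; split => // u [_] /=; rewrite in_itv/= leNgt.
    by rewrite (lt_le_trans x0 (quantile_ge0 _ _)).
  rewrite measure0; apply/esym; apply: (subset_measure0 _ (measurableC mRp) _ hrho) => //.
  move=> u /=; rewrite !in_itv/= andbT => ux; apply/negP; rewrite -ltNge.
  exact: le_lt_trans x0.
rewrite -mE; apply: eq_finite_measure => // a b ab.
have fin (n : {measure set RR -> \bar R}) (C : set RR) : (n setT < +oo)%E -> measurable C ->
    n C \is a fin_num.
  move=> nT mC; rewrite ge0_fin_numE//; apply: le_lt_trans nT.
  by apply: le_measure => //; rewrite inE.
have cancel (x y z : \bar R) : (x + y = x + z)%E -> x \is a fin_num ->
    y \is a fin_num -> z \is a fin_num -> y = z.
  by case: x y z => [x| |] [y| |] [z| |]//= [] h _ _ _; congr (_%:E); apply: (addrI x).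
have := mcdf b; rewrite (itvNyc_splitE m (ltW ab)) (itvNyc_splitE rho (ltW ab)) mcdf.
by move=> /cancel-> //; exact: fin.
Qed.

Lemma integral_quantile rho (S : RR -> \bar R) : on_half_line rho ->
  measurable_fun [set: RR] S -> (forall x, 0 <= S x)%E ->
  (\int[rho]_(x in Rp) S x = \int[lebesgue_measure]_(u in U01) S (quantile rho u))%E.
Proof.
move=> hrho mS S0; have mq := measurable_quantile rho.
transitivity (\int[rho]_(y in Rp) \int[\d_y]_z S z)%E.
  by apply: eq_integral => y _; rewrite integral_dirac// diracT mul1e.
rewrite (@eq_ge0_integral_mixture _ _ _ _ _ _ _ rho (@lebesgue_measure R)
  (fun y : RR => \d_y) (fun u : RR => \d_(quantile rho u : RR)) Rp U01)//.
- by apply: eq_integral => w _; rewrite integral_dirac// diracT mul1e.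
- by move=> B mB; exact: measurable_fun_dirac.
- by move=> B mB; exact: (measurableT_comp (measurable_fun_dirac mB) mq).
- move=> B mB; rewrite (integral_indic rho mRp mB) [LHS](half_line_setI hrho mB).
  rewrite [LHS](quantile_law hrho mB) setIC -(integral_indic _ mU01)//.
  by rewrite -[X in measurable X]setTI; exact: mq.
Qed.

(** The larger of two tails corresponds to the smaller of two distribution functions, and
    [quantile_le] exchanges this minimum for the maximum of the quantiles. *)
Lemma quantile_stoch_max rho1 rho2 rho12 u : is_stoch_max rho1 rho2 rho12 ->
  0 < u < 1 -> quantile rho12 u = Num.max (quantile rho1 u) (quantile rho2 u).
Proof.
move=> [_ tails] u01.
have cdfE x : 0 <= x -> prob_cdf rho12 x = Num.min (prob_cdf rho1 x) (prob_cdf rho2 x).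
  move=> x0; have := tails x x0; rewrite !prob_cdf_tail -EFin_max => -[].
  move: (prob_cdf rho12 x) (prob_cdf rho1 x) (prob_cdf rho2 x) => a b c.
  have [bc|/ltW cb] := leP b c; first by rewrite max_l ?lerD2l ?lerN2// => /addrI/oppr_inj.
  by rewrite max_r ?lerD2l ?lerN2// => /addrI/oppr_inj.
have qE x : 0 <= x -> (quantile rho12 u <= x) =
    (Num.max (quantile rho1 u) (quantile rho2 u) <= x).
  by move=> x0; rewrite ge_max !quantile_le// cdfE// le_min.
apply/eqP; rewrite eq_le qE ?lexx; last by rewrite le_max quantile_ge0.
by rewrite -qE ?lexx// quantile_ge0.
Qed.

(** For u uniform on ]0, 1[ the two quantiles form a coupling of rho1 and rho2 whose maximum has law
    rho12, so the bound by V at the larger point integrates to the mean of V under rho12. The bound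
    K gives the integrability that merges the two integrals. *)
Lemma stoch_max_integral_difference rho1 rho2 rho12 (S V : R -> R) (K c : R) :
  on_half_line rho1 -> on_half_line rho2 -> is_stoch_max rho1 rho2 rho12 ->
  measurable_fun [set: RR] (S : RR -> RR) -> (forall x, 0 <= S x) ->
  (forall x, S x <= K) ->
  measurable_fun [set: RR] (V : RR -> RR) -> (forall x, 0 <= V x) -> 0 <= c ->
  (forall x y, 0 <= x -> x <= y -> `|S x - S y| <= c * V y) ->
  (`|\int[rho1]_(x in Rp) (S x)%:E - \int[rho2]_(x in Rp) (S x)%:E| <=
   c%:E * \int[rho12]_(x in Rp) (V x)%:E)%E.
Proof.
move=> h1 h2 max12 mS S0 SK mV V0 c0 SV; have h12 := max12.1.
have mSE : measurable_fun [set: RR] (fun x => (S x)%:E) by exact/measurable_EFinP.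
have mVE : measurable_fun [set: RR] (fun x => (V x)%:E) by exact/measurable_EFinP.
have SE0 x : (0 <= (S x)%:E)%E by rewrite lee_fin.
have VE0 x : (0 <= (V x)%:E)%E by rewrite lee_fin.
rewrite !integral_quantile//.
have mSq rho : measurable_fun U01 (fun u => (S (quantile rho u))%:E).
  by apply: measurable_funTS; exact: (measurableT_comp mSE (measurable_quantile rho)).
have iSq rho : lebesgue_measure.-integrable U01 (fun u => (S (quantile rho u))%:E).
  apply: (@le_integrable _ _ _ lebesgue_measure U01 mU01 _ (cst K%:E)) => //.
    by move=> u _; rewrite /= lee_fin !ger0_norm// (le_trans (S0 0)).
  apply/integrableP; split => //=; rewrite integral_cst//.
  have : (lebesgue_measure U01 < +oo :> \bar R)%E.
    by rewrite /U01 lebesgue_measure_itv/= lte_fin ltr01 -EFinB ltry.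
  by move=> U1; rewrite lte_mul_pinfty.
rewrite -integralB//; apply: le_trans (le_abse_integral _ _ _) _ => //.
  exact: emeasurable_funB.
have mVq : measurable_fun U01 (fun u => (V (quantile rho12 u))%:E).
  by apply: measurable_funTS; exact: (measurableT_comp mVE (measurable_quantile rho12)).
rewrite -ge0_integralZl//; apply: ge0_le_integral => //.
- by apply: measurableT_comp => //; exact: emeasurable_funB.
- exact: measurable_funeM.
move=> u; rewrite /U01/= in_itv/= => u01.
rewrite (quantile_stoch_max max12 u01) -EFinM lee_fin.
have q1 := quantile_ge0 rho1 u; have q2 := quantile_ge0 rho2 u.
by have [le12|/ltW le21] := leP (quantile rho1 u) (quantile rho2 u);
  [exact: SV|rewrite distrC; exact: SV].
Qed.


Lemma integral_kact (k : R.-pker RR ~> RR) rho (f : RR -> \bar R) :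
  (forall x, 0 <= x -> on_half_line (k x)) -> measurable_fun [set: RR] f ->
  (forall x, 0 <= f x)%E ->
  (\int[kact k rho]_(y in Rp) f y = \int[rho]_(x in Rp) \int[k x]_y f y)%E.
Proof.
move=> hk mf f0.
rewrite (@eq_ge0_integral_mixture _ _ _ _ _ _ _ rho (kact k rho)
  (fun x => k x) (fun y : RR => \d_y) Rp Rp)//.
- by apply: eq_integral => y _; rewrite integral_dirac// diracT mul1e.
- by move=> B mB; exact: measurable_kernel.
- by move=> B mB; exact: measurable_fun_dirac.
- move=> B mB; rewrite (integral_indic (kact k rho) mRp mB).
  apply: eq_integral => x /set_mem; rewrite /= in_itv/= andbT => x0.
  by rewrite half_line_setI//; exact: hk.
Qed.

(** A test function is extended to the line by clamping its argument at 0 and truncated at level n;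
    its integrability under both measures lets n tend to infinity by dominated convergence. *)
Lemma wnorm_diff_le (U : R -> R) (m1 m2 : {measure set RR -> \bar R}) (C : \bar R) :
  (forall (f : R -> R) (M : R), measurable_fun [set: RR] (f : RR -> RR) ->
     (forall y, `|f y| <= M) -> (forall y, `|f y| <= U (Num.max 0 y)) ->
     (`|\int[m1]_(y in Rp) (f y)%:E - \int[m2]_(y in Rp) (f y)%:E| <= C)%E) ->
  (wnorm_diff U m1 m2 <= C)%E.
Proof.
move=> H; apply: ge_ereal_sup => _ [f [mf fU i1 i2] <-]; rewrite /pairing.
pose g y := f (Num.max 0 y).
pose fN n y := Num.max (- n%:R) (Num.min n%:R (g y)) : R.
have mg : measurable_fun [set: RR] (g : RR -> RR).
  apply: measurable_comp_on mf _ _; first exact: measurable_maxr.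
  by move=> y; rewrite le_max lexx.
have fNg n y : `|fN n y| <= `|g y|.
  have n0 : 0 <= n%:R :> R by [].
  rewrite /fN; have [gn|ng] := leP n%:R (g y).
    by rewrite max_r ?ger0_norm//; [exact: le_trans n0 gn|lra].
  have [h|h] := leP (- n%:R) (g y); first by [].
  by rewrite normrN ger0_norm// ltr0_norm; lra.
have fNn n y : `|fN n y| <= n%:R.
  have n0 : 0 <= n%:R :> R by [].
  rewrite /fN ler_norml; apply/andP; split; first by rewrite le_max lexx.
  by rewrite ge_max ge_min lexx andbT; lra.
have mfN n : measurable_fun [set: RR] (fN n : RR -> RR).
  by apply: measurable_maxr => //; exact: measurable_minr.
have cv (m : {measure set RR -> \bar R}) : m.-integrable Rp (EFin \o f) ->
    (\int[m]_(y in Rp) (fN n y)%:E)%E @[n --> \oo] --> (\int[m]_(y in Rp) (f y)%:E)%E.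
  move=> im; apply: (@dominated_cvg _ _ _ m Rp mRp (fun n y => (fN n y)%:E)
    (fun y => (f y)%:E) (fun y => `|(f y)%:E|%E)) => //.
  - by move=> n; apply: measurable_funTS; apply/measurable_EFinP; exact: mfN.
  - move=> y; rewrite /= in_itv/= andbT => y0; apply: cvg_near_cst.
    have gy : g y = f y by rewrite /g max_r.
    have := nbhs_infty_ger `|f y|; apply: filterS => n; rewrite ler_norml => /andP[h1 h2].
    by rewrite /fN gy min_r// max_r.
  - exact: integrable_abse.
  - move=> n y; rewrite /= in_itv/= andbT => y0; rewrite lee_fin.
    by apply: le_trans (fNg n y) _; rewrite /g max_r.
have f1 := integrable_fin_num mRp i1; have f2 := integrable_fin_num mRp i2.
have cvD : (`|\int[m1]_(y in Rp) (fN n y)%:E - \int[m2]_(y in Rp) (fN n y)%:E|)%E @[n --> \oo] -->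
    (`|\int[m1]_(y in Rp) (f y)%:E - \int[m2]_(y in Rp) (f y)%:E|)%E.
  apply: cvg_abse; apply: cvgeB; [|exact: cv|exact: cv].
  by apply: fin_num_adde_defl; rewrite fin_numN.
apply: (cvge_le _ cvD); apply: nearW => n; apply: (H _ n%:R) => //.
move=> y; apply: le_trans (fNg n y) _; apply: fU.
by rewrite le_max lexx.
Qed.


(** Adding the constant M makes f nonnegative without changing the difference of its means under two
    laws, so results on nonnegative functions apply. *)
Lemma integral_shift (m : {measure set RR -> \bar R}) (D : set RR) (f : R -> R) (M : R) :
  measurable D -> m D = 1%E -> measurable_fun [set: RR] (f : RR -> RR) ->
  (forall y, `|f y| <= M) -> exists a : R,
  (\int[m]_(y in D) (f y)%:E = a%:E /\ \int[m]_(y in D) (f y + M)%:E = (a + M)%:E)%E.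
Proof.
move=> mD mD1 mf fM.
have mfE : measurable_fun D (fun y => (f y)%:E).
  by apply: measurable_funTS; apply/measurable_EFinP.
have M0 : 0 <= M by exact: le_trans (normr_ge0 _) (fM 0).
have iM : m.-integrable D (cst M%:E).
  by apply/integrableP; split => //=; rewrite integral_cst// mD1 mule1 ltry.
have fi : m.-integrable D (fun y => (f y)%:E).
  apply: (le_integrable mD mfE _ iM) => y _.
  by rewrite /= lee_fin (ger0_norm M0).
have ff := integrable_fin_num mD fi.
exists (fine (\int[m]_(y in D) (f y)%:E)%E); split; first by rewrite fineK.
under eq_integral do rewrite EFinD.
by rewrite integralD// integral_cst// mD1 mule1 EFinD fineK.
Qed.

Lemma integral_half_line (m : {measure set RR -> \bar R}) (f : R -> R) (M : R) :
  (m setT < +oo)%E -> on_half_line m ->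
  measurable_fun [set: RR] (f : RR -> RR) -> (forall y, `|f y| <= M) ->
  (\int[m]_(y in Rp) (f y)%:E = \int[m]_y (f y)%:E)%E.
Proof.
move=> mT hm mf fM; have M0 : 0 <= M by exact: le_trans (normr_ge0 _) (fM 0).
rewrite [RHS](negligible_integral (measurableC mRp) measurableT _ hm).
  by rewrite setTD setCK.
apply: (@le_integrable _ _ _ m _ measurableT _ (cst M%:E)).
- exact/measurable_EFinP.
- by move=> y _; rewrite /= lee_fin (ger0_norm M0).
- apply/integrableP; split => //=; rewrite integral_cst//.
  by rewrite lte_mul_pinfty.
Qed.

End quantile_coupling.

(** * Comparison with the absorbed process *)

(* For tau in ]s (i-1), s i] with i <= k, the lag is H - s i, so that
   tau + lag lies within one mesh of H, and the lag is deterministic on each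
   event {s (i-1) < tau <= s i}, where the Markov property at tau applies. *)
Fixpoint grid_lag (R : realType) (s : nat -> R) (H : R) (tau : \bar R) (k : nat) : R :=
  if k is j.+1 then if (tau <= (s j)%:E)%E then grid_lag s H tau j else H - s k
  else H - s 0%N.

Lemma grid_lag_ge0 (R : realType) (s : nat -> R) (H : R) (tau : \bar R) (k : nat) :
  {homo s : i j / (i <= j)%N >-> i <= j} -> s k <= H -> 0 <= grid_lag s H tau k.
Proof.
move=> s_nd; elim: k => [|k IH] /= sH; first by rewrite subr_ge0.
by case: ifP => _; [apply/IH/(le_trans (s_nd _ _ (leqnSn k)))|rewrite subr_ge0].
Qed.

Lemma grid_lag_bound (R : realType) (s : nat -> R) (H e : R) (tau : R) (k : nat) :
  0 <= tau -> 0 <= e -> s 0%N = 0 -> (forall j, s j.+1 - s j <= e) -> tau <= s k ->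
  H - e <= tau + grid_lag s H tau%:E k <= H.
Proof.
move=> tau0 e0 s0 se; elim: k => [|k IH] /= tauk.
  by rewrite s0 subr0; apply/andP; split; lra.
rewrite lee_fin; case: ifPn => [/IH//|]; rewrite -ltNge => ktau.
by have := se k; move=> *; apply/andP; split; lra.
Qed.

Lemma probability_bounded_cvg (R : realType) d (Om : measurableType d)
    (Pr : probability Om R) (D : set Om) (v : nat -> Om -> R) (v0 : Om -> R) :
  measurable D -> (forall n, measurable_fun [set: Om] (v n)) ->
  (forall n w, 0 <= v n w) -> (forall n w, v n w <= 1) ->
  (forall w, D w -> (v n w)%:E @[n --> \oo] --> (v0 w)%:E) ->
  (\int[Pr]_(w in D) (v n w)%:E)%E @[n --> \oo] --> (\int[Pr]_(w in D) (v0 w)%:E)%E.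
Proof.
move=> mD mv v00 v1 cv.
apply: (@dominated_cvg _ _ _ Pr D mD (fun n w => (v n w)%:E) (fun w => (v0 w)%:E)
  (cst 1%E)) => //.
- by move=> n; apply/measurable_funTS/measurable_EFinP.
- apply/integrableP; split => //=.
  under eq_integral do rewrite normr1; rewrite integral_cst// mul1e.
  exact: le_lt_trans (probability_le1 Pr mD) (ltry _).
- by move=> n w _; rewrite /= ger0_norm// lee_fin.
Qed.

Section ramp.
Context (R : realType).

(** Approximates the indicator of ]a, +oo[. Continuity serves the passage to the limit along
    right-continuous paths, monotonicity the use of the stochastic order. *)
Definition ramp (a : R) (n : nat) (y : R) : R :=
  Num.min 1 (Num.max 0 (n%:R * (y - a))).

Lemma ramp_ge0 a n y : 0 <= ramp a n y.
Proof. by rewrite /ramp le_min ler01 le_max lexx. Qed.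

Lemma ramp_le1 a n y : ramp a n y <= 1.
Proof. by rewrite /ramp ge_min lexx. Qed.

Lemma ramp_nd a n : {homo ramp a n : x y / x <= y}.
Proof.
move=> x y xy; rewrite /ramp le_min2// le_max2//.
by rewrite ler_wpM2l// lerD2r.
Qed.

Lemma ramp_anti a b n y : a <= b -> ramp b n y <= ramp a n y.
Proof.
move=> ab; rewrite /ramp le_min2// le_max2//.
by rewrite ler_wpM2l// lerD2l lerN2.
Qed.

Lemma ramp_continuous a n : continuous (ramp a n).
Proof.
move=> y; apply: (@continuous_min R _ (cst 1)
  (fun y => Num.max 0 (n%:R * (y - a)))); first exact: cvg_cst.
apply: (@continuous_max R _ (cst 0) (fun y => n%:R * (y - a))); first exact: cvg_cst.
by apply: cvgMl_tmp; apply: cvgB; [exact: cvg_id|exact: cvg_cst].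
Qed.

Lemma ramp_cvg a y : ramp a n y @[n --> \oo] --> (\1_(`]a, +oo[%classic : set R) y : R).
Proof.
apply: cvg_near_cst; have [ya|ay] := leP y a.
  apply: nearW => n; rewrite indicE memNset ?in_itv/= ?andbT; last by rewrite in_itv/= ltNge ya.
  by rewrite /ramp max_l ?min_r// mulr_ge0_le0// subr_le0.
have := nbhs_infty_ger (y - a)^-1; apply: filterS => n ny.
rewrite indicE mem_set/= ?in_itv/= ?ay// /ramp min_l// le_max; apply/orP; right.
by rewrite -ler_pdivrMr ?subr_gt0// mul1r.
Qed.

End ramp.

Section comparison_with_absorbed_process.
Context (R : realType) d (Om : measurableType d) (Pr : probability Om R).
Local Notation RR := (measurableTypeR R).
Context (F : R -> set (set Om)) (F_filtration : filtration F).
Context (P : R -> R.-pker RR ~> RR).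
Hypothesis P_half_line : forall t x : R, 0 <= t -> 0 <= x -> on_half_line (P t x).
Context (X : R -> R -> Om -> R).
Hypothesis X_ge0 : forall x t w, 0 <= x -> 0 <= t -> 0 <= X x t w.
Hypothesis X_start : forall x, 0 <= x -> {ae Pr, forall w, X x 0 w = x}.
Hypothesis X_cadlag : forall x, 0 <= x -> cadlag_adapted F (X x).
Hypothesis X_markov : forall x, 0 <= x -> strong_markov Pr F P (X x).
Hypothesis P_ordered : stochastically_ordered P.
Hypothesis tau_stopping : forall x, 0 <= x -> stopping_time F (hitting_time0 (X x)).

Implicit Types (f : RR -> \bar R).

Let mX x t : 0 <= x -> 0 <= t -> measurable_fun setT (X x t).
Proof.
by move=> x0 t0; exact: (adapted_measurable F_filtration (X_cadlag x0).1).
Qed.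

Let kernel_measurable t (B : set RR) : measurable B ->
  measurable_fun [set: RR] (fun x => P t x B).
Proof. exact: measurable_kernel. Qed.

Let integral_kernel_measurable t f : (forall y, 0 <= f y)%E ->
  measurable_fun setT f -> measurable_fun [set: RR] (fun x => \int[P t x]_y f y)%E.
Proof.
move=> f0 mf; apply: measurable_fun_integral_kernel => // B mB.
exact: kernel_measurable.
Qed.

Let integral_transport (A : set Om) (g : Om -> RR) (l : Om -> {measure set RR -> \bar R}) f :
  measurable A -> measurable_fun setT g ->
  (forall B, measurable B -> measurable_fun setT (fun w => l w B)) ->
  (forall B, measurable B -> (\int[Pr]_(w in A) l w B = Pr (A `&` g @^-1` B))%E) ->
  (forall y, 0 <= f y)%E -> measurable_fun setT f ->
  (\int[Pr]_(w in A) \int[l w]_y f y = \int[Pr]_(w in A) f (g w))%E.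
Proof.
move=> mA mg ml H f0 mf.
rewrite (@eq_ge0_integral_mixture _ _ _ _ _ _ _ Pr Pr l (fun w => \d_(g w)) A A)//.
- by apply: eq_integral => w _; rewrite integral_dirac// diracT mul1e.
- by move=> B mB; exact: (measurableT_comp (measurable_fun_dirac mB) mg).
- move=> B mB; rewrite H//.
  rewrite (eq_integral (fun w => (\1_(g @^-1` B) w)%:E))//.
  rewrite integral_indic// 1?setIC//.
  by rewrite -[X in measurable X]setTI; exact: mg.
Qed.

(** The Markov property at the constant stopping time s, whose stopped sigma-algebra contains every
    event of F s. *)
Let markov_fixed x s r (A : set Om) f : 0 <= x -> 0 <= s -> 0 <= r -> F s A ->
  (forall y, 0 <= f y)%E -> measurable_fun setT f ->
  (\int[Pr]_(w in A) \int[P r (X x s w)]_y f y =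
   \int[Pr]_(w in A) f (X x (s + r) w))%E.
Proof.
move=> x0 s0 r0 FA f0 mf.
have mA := filtration_measurable F_filtration s0 FA.
apply: integral_transport => //.
- by apply: mX => //; rewrite addr_ge0.
- by move=> B mB; exact: (measurableT_comp (kernel_measurable r mB) (mX x0 s0)).
move=> B mB; have st : stopping_time F (fun=> s%:E : \bar R).
  split=> [w|t t0]; first by rewrite lee_fin.
  have [st|ts] := leP s t.
    rewrite (_ : [set _ | _] = setT); first exact: filtrationT.
    by apply/seteqP; split => // w _ /=; rewrite lee_fin.
  rewrite (_ : [set _ | _] = set0); first by have [/(_ t t0)[]] := F_filtration.
  by apply/seteqP; split => // w /=; rewrite lee_fin leNgt ts.
have [_ _ _ H] := X_markov x0 st r0 mB.
have := H A; rewrite /= (_ : (s%:E < +oo)%E = true) ?ltry//.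
move=> ->.
  rewrite (eq_integral (fun w => (\1_(X x (s + r) @^-1` B) w)%:E)); last first.
    by move=> w _; rewrite !indicE; congr (_%:R%:E); congr nat_of_bool;
      apply/idP/idP => /set_mem => [[_ Bw]|Bw]; apply/mem_set => //=; rewrite ltry.
  rewrite integral_indic// 1?setIC//.
  by rewrite -[X in measurable X]setTI; apply: mX => //; rewrite addr_ge0.
split => // t t0; have [st'|ts] := leP s t.
  rewrite (_ : _ `&` _ = A); first exact: (filtration_mono F_filtration s0 st').
  by apply/seteqP; split => [w []//|w Aw]; split => //=; rewrite lee_fin.
rewrite (_ : _ `&` _ = set0); first by have [/(_ t t0)[]] := F_filtration.
by apply/seteqP; split => // w /= [_]; rewrite lee_fin leNgt ts.
Qed.


Let tau x := hitting_time0 (X x).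

Let tau_ge0 x w : 0 <= x -> (0 <= tau x w)%E.
Proof. by move=> x0; have [+ _] := tau_stopping x0; exact. Qed.

Let tau_measurable x : 0 <= x -> measurable_fun [set: Om] (tau x).
Proof.
move=> x0; apply: (measurability _ (ErealGenOInfty.measurableE R)).
move=> /= _ [_ [a ->]] <-; apply: measurableI => //; rewrite preimage_itvoy.
have [a0|a0] := leP 0 a.
  exact: (filtration_measurable F_filtration a0
    (stopping_time_gt F_filtration (tau_stopping x0) a0)).
rewrite (_ : [set _ | _] = setT)//; apply/seteqP; split => // w _ /=.
by apply: lt_le_trans (tau_ge0 w x0); rewrite lte_fin.
Qed.

Let absorption_time x w : R := fine (tau x w).

Let absorption_time_measurable x : 0 <= x ->
  measurable_fun [set: Om] (absorption_time x).
Proof. by move=> x0; apply: measurableT_comp (tau_measurable x0). Qed.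

Let absorption_time_ge0 x w : 0 <= x -> 0 <= absorption_time x w.
Proof. by move=> x0; apply: fine_ge0; exact: tau_ge0. Qed.

Let absorption_timeE x w : 0 <= x -> (tau x w < +oo)%E ->
  (absorption_time x w)%:E = tau x w.
Proof. by move=> x0 tw; rewrite fineK// ge0_fin_numE// tau_ge0. Qed.

(** The infimum defining tau is attained: were X nonzero there, right-continuity would keep it
    nonzero just after, where zeros have to accumulate. *)
Let X_absorption x w : 0 <= x -> (tau x w < +oo)%E ->
  X x (absorption_time x w) w = 0.
Proof.
move=> x0 tw; set s := absorption_time x w; apply/eqP/negPn/negP => Xs.
have s0 : 0 <= s by exact: absorption_time_ge0.
have cX : X x ^~ w @ s^'+ --> X x s w by have [_ /(_ w)[+ _]] := X_cadlag x0; exact.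
have [e /= e0 He] : \forall t \near s^'+, X x t w != 0.
  exact: cvgr_neq0 cX Xs.
have : (tau x w < (s + e)%:E)%E by rewrite -absorption_timeE// lte_fin ltrDl.
move=> /ereal_inf_lt[_ [t [t0 Xt] <-]]; rewrite lte_fin => tse.
have : (tau x w <= t%:E)%E by apply: ereal_inf_lbound; exists t.
rewrite -absorption_timeE// lee_fin -/s le_eqVlt => /predU1P[st|st].
  by rewrite st Xt eqxx in Xs.
have := He t; rewrite Xt eqxx => H; suff: false by []. apply: H => //=.
by rewrite distrC ger0_norm ?subr_ge0 ?(ltW st)// ltrBlDl.
Qed.

Let random_time_measurable x (l : Om -> R) : 0 <= x ->
  measurable_fun [set: Om] l -> (forall w, 0 <= l w) ->
  measurable_fun [set: Om] (fun w => X x (l w) w).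
Proof.
move=> x0 ml l0.
have mXj : measurable_fun [set: Om * measurableTypeR R]
    (fun p => X x (Num.max 0 p.2) p.1).
  apply: measurable_right_continuous_process; first by move=> t; exact: mX.
  by move=> w t t0; have [_ /(_ w)[+ _]] := X_cadlag x0; exact.
rewrite (_ : (fun w => _) = (fun p => X x (Num.max 0 p.2) p.1) \o
    (fun w => (w, l w : measurableTypeR R))).
  exact: (measurableT_comp mXj (measurable_fun_pair _ ml)).
by apply/funext => w /=; rewrite (max_idPr _).
Qed.

Let lagged_measurable x r : 0 <= x -> 0 <= r ->
  measurable_fun [set: Om] (fun w => X x (absorption_time x w + r) w).
Proof.
move=> x0 r0; apply: random_time_measurable => // [|w].
  by apply: measurable_funD => //; exact: absorption_time_measurable.
by rewrite addr_ge0// absorption_time_ge0.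
Qed.

(** At tau the state is 0, so the conditional law given the past is the fixed measure P^r(0, .). *)
Let markov_hitting x r (A : set Om) f : 0 <= x -> 0 <= r ->
  stopped_sigma_algebra F (tau x) A -> A `<=` [set w | (tau x w < +oo)%E] ->
  (forall y, 0 <= f y)%E -> measurable_fun setT f ->
  (\int[Pr]_(w in A) \int[P r 0%R]_y f y =
   \int[Pr]_(w in A) f (X x (absorption_time x w + r) w))%E.
Proof.
move=> x0 r0 FA Atau f0 mf; have mA := FA.1.
apply: (@integral_transport A _ (fun=> P r 0)) => //; first exact: lagged_measurable.
move=> B mB; have [_ _ _ H] := X_markov x0 (tau_stopping x0) r0 mB.
rewrite (_ : Pr _ = \int[Pr]_(w in A)
   (\1_[set w | (tau x w < +oo)%E /\ B (X x (fine (tau x w) + r) w)] w)%:E)%E.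
  rewrite -H//; apply: eq_integral => w /set_mem/Atau tw.
  by rewrite tw -[fine _]/(absorption_time x w) X_absorption.
rewrite (eq_integral (fun w =>
    (\1_((fun w => X x (absorption_time x w + r) w) @^-1` B) w)%:E)); last first.
  move=> w /set_mem/Atau tw; rewrite !indicE; congr (_%:R%:E); congr nat_of_bool.
  by apply/idP/idP => /set_mem; [move=> [_ Bw]|move=> Bw]; apply/mem_set.
rewrite integral_indic// 1?setIC//.
by rewrite -[X in measurable X]setTI; exact: lagged_measurable.
Qed.

Let kernel_law x t f : 0 <= x -> 0 <= t ->
  (forall y, 0 <= f y)%E -> measurable_fun setT f ->
  (\int[P t x]_y f y = \int[Pr]_w f (X x t w))%E.
Proof.
move=> x0 t0 f0 mf.
have := @markov_fixed x 0 t setT f x0 (lexx _) t0 (filtrationT F_filtration (lexx _)) f0 mf.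
rewrite add0r => <-; transitivity (\int[Pr]_w \int[P t x]_y f y)%E.
  move: (\int[P t x]_y f y)%E => c.
  by rewrite (integral_cst Pr)// [X in (_ * X)%E](probability_setT Pr) mule1.
apply: ae_eq_integral => //.
- exact: (measurableT_comp (integral_kernel_measurable t f0 mf) (mX x0 (lexx 0))).
- by apply: filterS (X_start x0) => w /= -> _.
Qed.

Let measurable_X_preimage x t (B : set RR) : 0 <= x -> 0 <= t ->
  measurable B -> measurable (X x t @^-1` B).
Proof.
by move=> x0 t0 mB; rewrite -[X in measurable X]setTI; exact: (mX x0 t0 measurableT).
Qed.

Let kernel_preimage x t (B : set RR) : 0 <= x -> 0 <= t -> measurable B ->
  P t x B = Pr (X x t @^-1` B).
Proof.
move=> x0 t0 mB.
have mB1 : measurable_fun [set: RR] (fun y => (\1_B y)%:E : \bar R).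
  exact/measurable_EFinP/measurable_indic.
rewrite -[X in P t x X]setIT -integral_indic// kernel_law//.
rewrite -[X in _ = Pr X]setIT -(integral_indic Pr measurableT)//.
exact: measurable_X_preimage.
Qed.

Let chapman_kolmogorov x s t f : 0 <= x -> 0 <= s -> 0 <= t ->
  (forall y, 0 <= f y)%E -> measurable_fun setT f ->
  (\int[P (s + t) x]_y f y = \int[P s x]_y \int[P t y]_z f z)%E.
Proof.
move=> x0 s0 t0 f0 mf; rewrite kernel_law// ?addr_ge0//.
rewrite -(@markov_fixed x s t setT)//; last exact: filtrationT.
rewrite kernel_law//; last exact: integral_kernel_measurable.
by move=> y; exact: integral_ge0.
Qed.


(** Stationarity is stated for t > 0; this identity supplies the time 0 in (c). *)
Lemma kernel_initial x (B : set RR) : 0 <= x -> measurable B ->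
  P 0 x B = (\1_B x)%:E.
Proof.
move=> x0 mB; rewrite kernel_preimage// -[X in Pr X]setIT -(integral_indic Pr measurableT); last first.
  exact: measurable_X_preimage.
transitivity (\int[Pr]_w cst (\1_B x)%:E w)%E.
  apply: ae_eq_integral => //.
    by apply/measurable_EFinP/measurable_indic; exact: measurable_X_preimage.
  by apply: filterS (X_start x0) => w Xw _; rewrite /= -[in RHS]Xw.
by rewrite integral_cst// [X in (_ * X)%E](probability_setT Pr) mule1.
Qed.

Let half_lineE t x (B : set RR) : 0 <= t -> 0 <= x -> measurable B ->
  P t x B = P t x (B `&` `[0%R, +oo[%classic).
Proof. by move=> t0 x0 mB; rewrite half_line_setI//; exact: P_half_line. Qed.

(** Within R_+ an up-set is empty, a closed half-line or an open one, and an open half-line is an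
    increasing union of closed ones, to which the order applies. *)
Let P_upset t x y (B : set RR) : 0 <= t -> 0 <= x -> x <= y -> measurable B ->
  (forall u v : R, B u -> u <= v -> B v) -> (P t x B <= P t y B)%E.
Proof.
move=> t0 x0 xy mB upB; have y0 := le_trans x0 xy.
rewrite half_lineE// (half_lineE t0 y0)//; set C := B `&` _.
have [->|/set0P C0] := eqVneq C set0; first by rewrite !measure0.
have lbC : lbound C 0 by move=> u [_]; rewrite /= in_itv/= andbT.
have infC0 : 0 <= inf C by exact: lb_le_inf.
have Cup u : C u -> `[u, +oo[ `<=` C.
  move=> Cu v /=; rewrite in_itv/= andbT => uv; split.
    by apply: upB uv; exact: Cu.1.
  by rewrite /= in_itv/= andbT (le_trans (lbC _ Cu)).
have Cinf u : C u -> inf C <= u by move=> Cu; apply: ge_inf => //; exists 0.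
have [Ci|Ci] := pselect (C (inf C)).
  suff -> : C = `[inf C, +oo[%classic by exact: P_ordered.
  by apply/seteqP; split => [u Cu|]; [rewrite /= in_itv/= andbT Cinf|exact: Cup].
have -> : C = `]inf C, +oo[%classic.
  apply/seteqP; split => [u Cu|u]; rewrite /= in_itv/= andbT.
    rewrite lt_neqAle Cinf// andbT; apply/negP => /eqP E; apply: Ci.
    by rewrite E.
  move=> Cu; have [e0 Hi] : 0 < u - inf C /\ has_inf C.
    by split; [rewrite subr_gt0|split => //; exists 0].
  have [c Cc] := inf_adherent e0 Hi; rewrite addrC subrK => cu.
  by apply: (Cup c) => //=; rewrite in_itv/= (ltW cu).
rewrite itvoyEbigcup.
pose A n : set RR := `[(inf C + n.+1%:R^-1)%R, +oo[%classic.
have cv z : P t z (A n) @[n --> \oo] --> P t z (\bigcup_n A n).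
  have mA n : measurable (A n) by exact: measurable_itv.
  apply: (@nondecreasing_cvg_mu _ _ _ (P t z)) => //; first exact: bigcup_measurable.
  move=> n m nm; rewrite subsetEset; apply: subset_itvr; rewrite bnd_simp lerD2l.
  by rewrite lef_pV2 ?posrE ?ltr0n// ler_nat.
rewrite -(cvg_lim _ (cv x))// -(cvg_lim _ (cv y))//; apply: lee_lim.
- by apply/cvg_ex; eexists; exact: cv.
- by apply/cvg_ex; eexists; exact: cv.
- by apply: nearW => n; apply: P_ordered => //; rewrite addr_ge0.
Qed.

(** The superlevel sets of a nondecreasing function are up-sets, and the layer cake formula
    integrates [P_upset] over the levels. *)
Let integral_monotone t x y (f : R -> R) : 0 <= t -> 0 <= x -> x <= y ->
  {homo f : u v / u <= v} -> (forall u, 0 <= f u) ->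
  (\int[P t x]_u (f u)%:E <= \int[P t y]_u (f u)%:E)%E.
Proof.
move=> t0 x0 xy fnd f0; have y0 := le_trans x0 xy.
have mf : measurable_fun [set: RR] (f : RR -> RR) by exact: nondecreasing_measurable.
have mfX z : 0 <= z -> measurable_fun [set: Om] (fun w => f (X z t w)).
  by move=> z0; apply: (measurableT_comp mf); exact: mX.
have mB (u : R) : measurable ([set v | u < f v] : set RR).
  have := mf measurableT `]u, +oo[%classic.
  by rewrite setTI preimage_itvoy; exact.
have E z : 0 <= z ->
  measurable_fun (`[0%R, +oo[%classic : set RR) (fun u => P t z [set v | (u < f v)%R]) /\
  (\int[P t z]_u (f u)%:E =
    \int[lebesgue_measure]_(u in `[0%R, +oo[) P t z [set v | (u < f v)%R])%E.
  move=> z0; rewrite kernel_law//; last exact/measurable_EFinP.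
  have H u : (\int[Pr]_(w in setT `&` [set w | (u < f (X z t w))%R]) cst 1 w =
      P t z [set v | (u < f v)%R])%E.
    rewrite setTI integral_cst ?mul1e; last exact: (measurable_X_preimage z0 t0 (mB u)).
    exact/esym/kernel_preimage.
  have [mL HL] := layer_cake Pr measurableT (mfX z z0) (fun w => f0 _)
    (measurable_cst 1%E) (fun=> lee01).
  split; first by apply: eq_measurable_fun mL => u _; rewrite H.
  transitivity (\int[Pr]_w ((f (X z t w))%:E * cst 1 w))%E.
    by apply: eq_integral => w _; rewrite /cst mule1.
  by rewrite HL; apply: eq_integral => u _; rewrite H.
have [mPx ->] := E x x0; have [mPy ->] := E y y0; apply: ge0_le_integral => //.
by move=> u _; apply: P_upset => // v v' /= uv vv'; exact: lt_le_trans (fnd _ _ vv').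
Qed.


(* A path coupling of the copies started from x1 <= x2 would give
   E f(X^x1_H) >= E[f(X^x2_H); tau <= H] for every f >= 0. The infimum low of the
   semigroup below the current state replaces the coupling: along a grid,
   low (H - s_k) (X_{s_k}) is a supermartingale until tau, and when f = f1 - f2
   with f1 and f2 nondecreasing, it dominates at tau the mean of f1 started from
   0 minus the mean of f2 started from the current state. *)
Section grid_comparison.
Variables f1 f2 : R -> R.
Hypothesis f1_nd : {homo f1 : u v / u <= v}.
Hypothesis f2_nd : {homo f2 : u v / u <= v}.
Hypothesis f2_ge0 : forall u, 0 <= f2 u.
Hypothesis f21 : forall u, f2 u <= f1 u.
Hypothesis f1_le1 : forall u, f1 u <= 1.

Let f u := f1 u - f2 u.

Let f1_ge0 u : 0 <= f1 u. Proof. exact: le_trans (f2_ge0 u) (f21 u). Qed.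
Let f2_le1 u : f2 u <= 1. Proof. exact: le_trans (f21 u) (f1_le1 u). Qed.
Let f_ge0 u : 0 <= f u. Proof. by rewrite subr_ge0. Qed.
Let f_le1 u : f u <= 1.
Proof. by rewrite lerBlDr (le_trans (f1_le1 u))// lerDl. Qed.

Let mf1 : measurable_fun [set: RR] (f1 : RR -> RR).
Proof. exact: nondecreasing_measurable. Qed.
Let mf2 : measurable_fun [set: RR] (f2 : RR -> RR).
Proof. exact: nondecreasing_measurable. Qed.
Let mf : measurable_fun [set: RR] (f : RR -> RR).
Proof. exact: measurable_funB. Qed.

Let mean (g : R -> R) r z : R := fine (\int[P r z]_y (g y)%:E)%E.

Let meanE (g : R -> R) r z : measurable_fun [set: RR] (g : RR -> RR) ->
  (forall u, 0 <= g u) -> (forall u, g u <= 1) ->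
  (mean g r z)%:E = (\int[P r z]_y (g y)%:E)%E.
Proof.
move=> mg g0 g1; rewrite fineK// ge0_fin_numE; last first.
  by apply: integral_ge0 => y _; rewrite lee_fin.
apply: (@le_lt_trans _ _ (\int[P r z]_y 1)%E); last first.
  by rewrite integral_cst// mul1e prob_kernel ltry.
apply: ge0_le_integral => //; first by move=> y _; rewrite lee_fin.
  exact/measurable_EFinP.
by move=> y _; rewrite lee_fin.
Qed.

Let mean_ge0 (g : R -> R) r z : (forall u, 0 <= g u) -> 0 <= mean g r z.
Proof. by move=> g0; apply/fine_ge0/integral_ge0 => y _; rewrite lee_fin. Qed.

Let mean_le1 (g : R -> R) r z : measurable_fun [set: RR] (g : RR -> RR) ->
  (forall u, 0 <= g u) -> (forall u, g u <= 1) -> mean g r z <= 1.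
Proof.
move=> mg g0 g1; rewrite -lee_fin meanE//.
have <- : (\int[P r z]_y 1 = 1)%E by rewrite integral_cst// mul1e prob_kernel.
apply: ge0_le_integral => //; first by move=> y _; rewrite lee_fin.
  exact/measurable_EFinP.
by move=> y _; rewrite lee_fin.
Qed.

(** Clamping x at 0 keeps the set nonempty for every real x, so that [low r] is nonincreasing, hence
    measurable, on the whole line. *)
Let low r x : R := inf [set mean f r z | z in `[0, Num.max 0 x]].

Let low_lb r x : lbound [set mean f r z | z in `[0, Num.max 0 x]] 0.
Proof. by move=> _ [z _ <-]; exact: mean_ge0. Qed.

Let low_le r x z : 0 <= z -> z <= x -> low r x <= mean f r z.
Proof.
move=> z0 zx; apply: ge_inf; first by exists 0; exact: low_lb.
by exists z => //=; rewrite in_itv/= z0 le_max zx orbT.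
Qed.

Let low_glb r x c : 0 <= x -> (forall z, 0 <= z -> z <= x -> c <= mean f r z) ->
  c <= low r x.
Proof.
move=> x0 H; apply: lb_le_inf.
  by exists (mean f r 0), 0 => //=; rewrite in_itv/= lexx le_max lexx.
by move=> _ [z /= + <-]; rewrite in_itv/= (max_idPr x0) => /andP[z0 zx]; exact: H.
Qed.

Let low_max r x : low r x = low r (Num.max 0 x).
Proof. by rewrite /low maxA maxxx. Qed.

Let low_anti r x y : x <= y -> low r y <= low r x.
Proof.
move=> yx; rewrite low_max [leRHS]low_max.
have x0 : 0 <= Num.max 0 x by rewrite le_max lexx.
apply: low_glb => // z z0 zx; apply: low_le => //; apply: le_trans zx _.
by rewrite ge_max !le_max lexx/= yx orbT.
Qed.

Let low_ge0 r x : 0 <= low r x.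
Proof.
rewrite low_max; apply: low_glb => [|z _ _]; first by rewrite le_max lexx.
exact: mean_ge0.
Qed.

Let low_le1 r x : low r x <= 1.
Proof.
rewrite low_max; apply: (@le_trans _ _ (mean f r 0)); last exact: mean_le1.
by apply: low_le; rewrite // le_max lexx.
Qed.

Let low_measurable r : measurable_fun [set: RR] (low r : RR -> RR).
Proof. by apply: nonincreasing_measurable => // x y; exact: low_anti. Qed.

(** For z <= x the mean of the nonincreasing [low r] from x is at most its mean from z. There
    [low r] is at most the mean of f after time r, and Chapman-Kolmogorov gives the mean of f from z
    after time s + r. The infimum over z concludes. *)
Let integral_low_le s r x : 0 <= s -> 0 <= r -> 0 <= x ->
  (\int[P s x]_y (low r y)%:E <= (low (s + r) x)%:E)%E.
Proof.
move=> s0 r0 x0; rewrite -meanE//.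
rewrite lee_fin; apply: low_glb => // z z0 zx.
have mlow : measurable_fun [set: RR] (fun u => (low r u)%:E).
  by apply/measurable_EFinP; exact: low_measurable.
have mlowB : measurable_fun [set: RR] (fun u => 1 - low r u : RR).
  by apply: measurable_funB => //; exact: low_measurable.
have mlowBE : measurable_fun [set: RR] (fun u => (1 - low r u)%:E).
  exact/measurable_EFinP.
apply: (@le_trans _ _ (mean (low r) s z)).
  (* [integral_monotone] takes nonnegative nondecreasing functions, so it is applied to 1 -
     [low r]. *)
  have lowB0 u : 0 <= 1 - low r u by rewrite subr_ge0.
  have lowB1 u : 1 - low r u <= 1 by rewrite lerBlDr lerDl.
  have E y : mean (low r) s y + mean (fun u => 1 - low r u) s y = 1.
    apply/EFin_inj; rewrite EFinD !meanE//.
    rewrite -ge0_integralD//; try by move=> u _; rewrite lee_fin.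
    under eq_integral do rewrite -EFinD addrC subrK.
    by rewrite integral_cst// mul1e prob_kernel.
  have : mean (fun u => 1 - low r u) s z <= mean (fun u => 1 - low r u) s x.
    rewrite -lee_fin !meanE//.
    apply: integral_monotone => // u v uv; rewrite lerD2l lerN2; exact: low_anti.
  have := E x; have := E z; move: (mean _ _ x) (mean _ _ z) (mean _ _ x) (mean _ _ z).
  by move=> *; lra.
have mfE : measurable_fun [set: RR] (fun u => (f u)%:E) by exact/measurable_EFinP.
have fE0 y : (0 <= (f y)%:E)%E by rewrite lee_fin.
have mSE := integral_kernel_measurable r fE0 mfE.
rewrite -lee_fin !meanE// chapman_kolmogorov//.
rewrite (kernel_law z0 s0 _ mlow) ?(kernel_law z0 s0 _ mSE); last 2 first.
- by move=> y; exact: integral_ge0.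
- by move=> y; rewrite lee_fin.
apply: ge0_le_integral => //.
- by move=> w _; rewrite lee_fin.
- exact: (measurableT_comp mlow (mX z0 s0)).
- exact: (measurableT_comp mSE (mX z0 s0)).
- by move=> w _; rewrite -meanE// lee_fin low_le// X_ge0.
Qed.


(** For z in [0, y] the mean of f1 from 0 is at most that from z, which is the mean of f plus that
    of f2 from z, and the latter is at most the mean of f2 from y. The infimum over z leaves
    [low r y]. *)
Let mean_absorb r y : 0 <= r -> 0 <= y -> mean f1 r 0 <= low r y + mean f2 r y.
Proof.
move=> r0 y0; rewrite -lerBlDr; apply: low_glb => // z z0 zy.
have le1 : mean f1 r 0 <= mean f1 r z.
  by rewrite -lee_fin !meanE//; exact: integral_monotone.
have le2 : mean f2 r z <= mean f2 r y.
  by rewrite -lee_fin !meanE//; exact: integral_monotone.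
have : mean f1 r z = mean f r z + mean f2 r z.
  apply/EFin_inj; rewrite EFinD !meanE//.
  have mfE : measurable_fun [set: RR] (fun u => (f u)%:E) by exact/measurable_EFinP.
  have mf2E : measurable_fun [set: RR] (fun u => (f2 u)%:E) by exact/measurable_EFinP.
  rewrite -(ge0_integralD _ measurableT _ mfE _ mf2E); last 2 first.
  - by move=> u _; rewrite lee_fin.
  - by move=> u _; rewrite lee_fin.
  by apply: eq_integral => u _; rewrite -EFinD subrK.
by move=> E; rewrite lerBlDr; apply: (le_trans le1); rewrite E lerD2l.
Qed.

Variables (x : R) (x0 : 0 <= x).

Let dead s := [set w | (tau x w <= s%:E)%E].
Let alive s := [set w | (s%:E < tau x w)%E].

Let dead_filtration s : 0 <= s -> F s (dead s).
Proof. by move=> s0; have [_ ] := tau_stopping x0; exact. Qed.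

Let dead_measurable s : 0 <= s -> measurable (dead s).
Proof. by move=> s0; exact: (filtration_measurable F_filtration s0 (dead_filtration s0)). Qed.

Let alive_filtration s : 0 <= s -> F s (alive s).
Proof. by move=> s0; exact: (stopping_time_gt F_filtration (tau_stopping x0) s0). Qed.

Let alive_measurable s : 0 <= s -> measurable (alive s).
Proof. by move=> s0; exact: (filtration_measurable F_filtration s0 (alive_filtration s0)). Qed.

Let mgX (g : R -> R) s : measurable_fun [set: RR] (g : RR -> RR) -> 0 <= s ->
  measurable_fun [set: Om] (fun w => (g (X x s w))%:E).
Proof.
move=> mg s0; apply/measurable_EFinP.
exact: (measurableT_comp mg (mX x0 s0)).
Qed.

(** [mean_absorb] at the state X s is integrated over E. The left-hand side comes from the Markov
    property at tau, the f2 term from that at s; the conditions on E place it in the sigma-algebra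
    stopped at tau. *)
Let absorb_step s r (E : set Om) : 0 <= s -> 0 <= r -> F s E -> E `<=` dead s ->
  (forall t, 0 <= t -> t < s -> F t (E `&` dead t)) ->
  (\int[Pr]_(w in E) (f1 (X x (absorption_time x w + r) w))%:E <=
   \int[Pr]_(w in E) (low r (X x s w))%:E +
   \int[Pr]_(w in E) (f2 (X x (s + r) w))%:E)%E.
Proof.
move=> s0 r0 FE Es Et; have mE := filtration_measurable F_filtration s0 FE.
have F1 : stopped_sigma_algebra F (tau x) E.
  split=> // t t0; have [st|ts] := leP s t; last exact: Et.
  rewrite -[X in F t X]/(E `&` dead t) (_ : _ `&` _ = E).
    exact: (filtration_mono F_filtration s0 st).
  apply/seteqP; split => [w []//|w Ew]; split => //.
  by apply: (le_trans (Es _ Ew)); rewrite lee_fin.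
have fin w : E w -> (tau x w < +oo)%E by move=> /Es/le_lt_trans; apply; rewrite ltry.
have f10 y : (0 <= (f1 y)%:E)%E by rewrite lee_fin.
have f20 y : (0 <= (f2 y)%:E)%E by rewrite lee_fin.
have mf1E : measurable_fun [set: RR] (fun y => (f1 y)%:E) by exact/measurable_EFinP.
have mf2E : measurable_fun [set: RR] (fun y => (f2 y)%:E) by exact/measurable_EFinP.
rewrite -(markov_hitting x0 r0 F1 fin f10 mf1E).
rewrite -(markov_fixed x0 s0 r0 FE f20 mf2E).
have mS2 : measurable_fun setT (fun w => \int[P r (X x s w)]_y (f2 y)%:E)%E.
  exact: (measurableT_comp (integral_kernel_measurable r f20 mf2E) (mX x0 s0)).
have mlow : measurable_fun setT (fun w => (low r (X x s w))%:E).
  by apply: mgX => //; exact: low_measurable.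
rewrite -(ge0_integralD Pr mE); last 4 first.
- by move=> w _; rewrite lee_fin.
- exact: measurable_funTS.
- by move=> w _; exact: integral_ge0.
- exact: measurable_funTS.
apply: ge0_le_integral => //.
- by move=> w _; exact: integral_ge0.
- by apply: measurable_funTS; exact: emeasurable_funD.
- by move=> w _; rewrite -!meanE// -EFinD lee_fin mean_absorb// X_ge0.
Qed.

Let integral_split (A B C : set Om) (g : Om -> \bar R) : measurable A ->
  measurable B -> C = A `|` B -> (forall w, A w -> ~ B w) ->
  measurable_fun [set: Om] g -> (forall w, 0 <= g w)%E ->
  (\int[Pr]_(w in C) g w = \int[Pr]_(w in A) g w + \int[Pr]_(w in B) g w)%E.
Proof.
move=> mA mB -> AB mg g0; apply: ge0_integral_setU => //; first exact: measurable_funTS.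
by apply/disj_setPS => w [Aw Bw]; case: (AB w).
Qed.

Section fixed_grid.
Variables (s : nat -> R) (H : R).
Hypothesis s_start : s 0%N = 0.
Hypothesis s_nd : {homo s : i j / (i <= j)%N >-> i <= j}.

Let s_ge0 k : 0 <= s k. Proof. by rewrite -s_start; exact: s_nd. Qed.

Let lagged k w := X x (absorption_time x w + grid_lag s H (tau x w) k) w.

Lemma lagged_grid_measurable k : s k <= H -> measurable_fun [set: Om] (lagged k).
Proof.
move=> sH; apply: random_time_measurable => // [|w]; last first.
  by rewrite addr_ge0 ?grid_lag_ge0// absorption_time_ge0.
apply: measurable_funD; first exact: absorption_time_measurable.
elim: k {sH} => [|k IH]; first exact: measurable_cst.
apply: measurable_fun_ifT => //; apply: measurable_fun_lee => //.
exact: tau_measurable.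
Qed.

(** Paths alive at s k either reach 0 by s k.+1 or survive. The mean of [low] over both groups does
    not increase in the step; on the first group [absorb_step] then exchanges it for f1 at the
    lagged time, at the cost of f2 at time H. *)
Lemma grid_induction k : s k <= H ->
  (\int[Pr]_(w in dead (s k)) (f1 (lagged k w))%:E +
   \int[Pr]_(w in alive (s k)) (low (H - s k) (X x (s k) w))%:E <=
   (low H x)%:E + \int[Pr]_(w in dead (s k)) (f2 (X x H w))%:E)%E.
Proof.
elim: k => [|k IH] sH.
  rewrite s_start in sH *; rewrite subr0.
  have mlow : measurable_fun [set: Om] (fun w => (low H (X x 0 w))%:E).
    by apply: mgX => //; exact: low_measurable.
  have low0 w : (0 <= (low H (X x 0 w))%:E)%E by rewrite lee_fin.
  have TE : [set: Om] = dead 0 `|` alive 0.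
    by apply/seteqP; split => // w _ /=; have [|] := leP (tau x w) 0%:E; [left|right].
  have dE w : dead 0 w -> ~ alive 0 w by rewrite /dead/alive/= leNgt => /negP.
  have := integral_split (dead_measurable (lexx 0)) (alive_measurable (lexx 0)) TE dE mlow low0.
  have -> : (\int[Pr]_w (low H (X x 0 w))%:E = (low H x)%:E)%E.
    transitivity (\int[Pr]_w (cst (low H x)%:E w))%E.
      apply: ae_eq_integral => //.
      by apply: filterS (X_start x0) => w /= -> _.
    by rewrite integral_cst// [X in (_ * X)%E](probability_setT Pr) mule1.
  move=> ->; rewrite [leRHS]addeAC; apply: leeD2r.
  have := @absorb_step 0 H (dead 0) (lexx 0) sH (dead_filtration (lexx 0)) (@subset_refl _ _).
  rewrite add0r /lagged/= s_start subr0; apply => t t0 t0'.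
  by have := le_lt_trans t0 t0'; rewrite ltxx.
have skH : s k <= H by apply: le_trans sH; exact: s_nd.
have H0 : 0 <= H by exact: le_trans (s_ge0 k) skH.
have ss : s k <= s k.+1 by exact: s_nd.
have {IH} := IH skH.
pose E := alive (s k) `&` dead (s k.+1).
have FE : F (s k.+1) E.
  apply: filtrationI => //; last exact: dead_filtration.
  exact: (filtration_mono F_filtration _ ss (alive_filtration _)).
have mE : measurable E := filtration_measurable F_filtration (s_ge0 _) FE.
have mf2H := mgX mf2 H0.
have f2H w : (0 <= (f2 (X x H w))%:E)%E by rewrite lee_fin.
have mlag : measurable_fun [set: Om] (fun w => (f1 (lagged k.+1 w))%:E).
  by apply/measurable_EFinP; apply: (measurableT_comp mf1); exact: lagged_grid_measurable.
have deadS : dead (s k.+1) = dead (s k) `|` E.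
  apply/seteqP; split => [w /= ws|w /= [|[]//]].
    by have [wk|kw] := leP (tau x w) (s k)%:E; [left|right; split].
  by move=> /le_trans; apply; rewrite lee_fin.
have dE w : dead (s k) w -> ~ E w by move=> wk [+ _]; rewrite /alive/= ltNge => /negP; exact.
rewrite (integral_split (dead_measurable _) mE deadS dE mlag) => [|//|w]; last by rewrite lee_fin.
rewrite (integral_split (dead_measurable _) mE deadS dE mf2H) => [|//|//].
have mlow : measurable_fun [set: Om] (fun w => (low (H - s k.+1) (X x (s k.+1) w))%:E).
  by apply: mgX => //; exact: low_measurable.
have low0 w : (0 <= (low (H - s k.+1) (X x (s k.+1) w))%:E)%E by rewrite lee_fin.
have aliveS : alive (s k) = E `|` alive (s k.+1).
  apply/seteqP; split => [w /= ws|w /= [[]//|]].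
    by have [wk|kw] := leP (tau x w) (s k.+1)%:E; [left; split|right].
  by apply: le_lt_trans; rewrite lee_fin.
have aE w : E w -> ~ alive (s k.+1) w.
  by case=> _; rewrite /dead/alive/= leNgt => /negP.
have lowS := integral_split mE (alive_measurable (s_ge0 k.+1)) aliveS aE mlow low0.
have lowstep : (\int[Pr]_(w in alive (s k)) (low (H - s k.+1) (X x (s k.+1) w))%:E <=
   \int[Pr]_(w in alive (s k)) (low (H - s k) (X x (s k) w))%:E)%E.
  have d0 : 0 <= s k.+1 - s k by rewrite subr_ge0.
  have r0 : 0 <= H - s k.+1 by rewrite subr_ge0.
  have lowE0 y : (0 <= (low (H - s k.+1) y)%:E)%E by rewrite lee_fin.
  have mlowE : measurable_fun [set: RR] (fun y => (low (H - s k.+1) y)%:E).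
    by apply/measurable_EFinP; exact: low_measurable.
  have := markov_fixed x0 (s_ge0 k) d0 (alive_filtration (s_ge0 k)) lowE0 mlowE.
  rewrite (_ : s k + (s k.+1 - s k) = s k.+1); last by rewrite addrC subrK.
  move=> <-; apply: ge0_le_integral => //.
  - exact: alive_measurable.
  - by move=> w _; exact: integral_ge0.
  - apply: measurable_funTS.
    exact: (measurableT_comp (integral_kernel_measurable _ lowE0 mlowE) (mX x0 (s_ge0 k))).
  - apply: measurable_funTS; apply: mgX => //; exact: low_measurable.
  - move=> w _; have Xw : 0 <= X x (s k) w by exact: X_ge0.
    apply: (le_trans (integral_low_le d0 r0 Xw)).
    by rewrite (_ : s k.+1 - s k + (H - s k.+1) = H - s k)//; ring.
have absorbE : (\int[Pr]_(w in E) (f1 (lagged k.+1 w))%:E <=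
   \int[Pr]_(w in E) (low (H - s k.+1) (X x (s k.+1) w))%:E +
   \int[Pr]_(w in E) (f2 (X x H w))%:E)%E.
  have r0 : 0 <= H - s k.+1 by rewrite subr_ge0.
  rewrite (_ : \int[Pr]_(w in E) (f1 (lagged k.+1 w))%:E = \int[Pr]_(w in E)
      (f1 (X x (absorption_time x w + (H - s k.+1)) w))%:E)%E; last first.
    apply: eq_integral => w /set_mem[+ _]; rewrite /alive/= ltNge => /negbTE ks.
    by rewrite /lagged/= ks.
  have EH : s k.+1 + (H - s k.+1) = H by rewrite addrC subrK.
  have := @absorb_step (s k.+1) (H - s k.+1) E (s_ge0 _) r0 FE (@subIsetr _ _ _).
  rewrite EH; apply => t t0 ts.
  have [kt|tk] := leP (s k) t.
    rewrite (_ : _ `&` _ = alive (s k) `&` dead t).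
      apply: filtrationI => //; last exact: dead_filtration.
      exact: (filtration_mono F_filtration (s_ge0 k) kt (alive_filtration _)).
    apply/seteqP; split => [w [[]//]|w [wk wt]]; split => //; split => //.
    by apply: (le_trans wt); rewrite lee_fin ltW.
  rewrite (_ : _ `&` _ = set0); first by have [/(_ t t0)[]] := F_filtration.
  apply/seteqP; split => // w [[+ _]]; rewrite /alive/dead/= => wk /(lt_le_trans wk).
  by rewrite lte_fin ltNge (ltW tk).
rewrite lowS in lowstep.
(* A path absorbed by s k keeps its lag when the grid is extended. *)
have -> : (\int[Pr]_(w in dead (s k)) (f1 (lagged k.+1 w))%:E =
  \int[Pr]_(w in dead (s k)) (f1 (lagged k w))%:E)%E.
  by apply: eq_integral => w /set_mem wk; rewrite /lagged/= wk.
move: absorbE lowstep.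
set a := (\int[Pr]_(w in dead (s k)) (f1 _)%:E)%E.
set c := (\int[Pr]_(w in alive (s k)) _)%E.
set e := (\int[Pr]_(w in E) (f1 _)%:E)%E.
set e1 := (\int[Pr]_(w in E) (low _ _)%:E)%E.
set e2 := (\int[Pr]_(w in E) (f2 _)%:E)%E.
set b := (\int[Pr]_(w in alive (s k.+1)) _)%E.
clearbody a b c e e1 e2.
move=> he hc IH; apply: (@le_trans _ _ (a + c + e2)%E); last first.
  by rewrite [leRHS]addeA; exact: leeD2r.
rewrite -!addeA; apply: leeD2l; apply: le_trans (leeD he (lexx b)) _.
by rewrite [leLHS]addeAC; exact: leeD2r.
Qed.

End fixed_grid.

Hypothesis f1_continuous : continuous f1.
Hypothesis f2_continuous : continuous f2.

(** The grid has n + 1 steps of length t / (n + 1) and ends at t. The lagged times tend to t from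
    the right, so right-continuity of the paths and continuity of f1 and f2 give the limit of each
    term. *)
Lemma absorbed_comparison t x1 : 0 <= t -> 0 <= x1 -> x1 <= x ->
  (\int[Pr]_(w in dead t) (f1 (X x t w))%:E <=
   \int[P t x1]_y (f y)%:E + \int[Pr]_(w in dead t) (f2 (X x t w))%:E)%E.
Proof.
move=> t0 x10 x1x.
pose e n : R := n.+1%:R^-1; pose dl n : R := t * e n; pose s n k : R := k%:R * dl n.
(* The lagged time may fall short of H by one mesh [dl n]; the further [e n] keeps it strictly above
   t, also when t = 0 and the mesh is 0. *)
pose H n : R := t + dl n + e n.
have e0 n : 0 < e n by rewrite invr_gt0.
have dl0 n : 0 <= dl n by rewrite mulr_ge0// ltW.
have s_start n : s n 0%N = 0 by rewrite /s mul0r.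
have s_nd n : {homo s n : i j / (i <= j)%N >-> i <= j}.
  by move=> i j ij; rewrite ler_wpM2r// ler_nat.
have sn n : s n n.+1 = t by rewrite /s /dl mulrCA mulfV ?mulr1.
have tH n : t < H n by rewrite /H -addrA ltrDl ltr_wpDl.
have ce : e n @[n --> \oo] --> (0 : R) by exact: cvg_harmonic.
have cH : H n @[n --> \oo] --> t.
  rewrite -[X in _ --> X]addr0; apply: cvgD (ce).
  rewrite -[X in _ --> X]addr0; apply: cvgD; first exact: cvg_cst.
  rewrite -[X in _ --> X](mulr0 t). exact: cvgMl_tmp.
pose T n w := absorption_time x w + grid_lag (s n) (H n) (tau x w) n.+1.
have sH n : s n n.+1 <= H n by rewrite sn ltW.
have ineq n : (\int[Pr]_(w in dead t) (f1 (X x (T n w) w))%:E <=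
    \int[Pr]_w (f (X x1 (H n) w))%:E + \int[Pr]_(w in dead t) (f2 (X x (H n) w))%:E)%E.
  have H0 : 0 <= H n by rewrite (le_trans t0)// ltW.
  have := grid_induction (s_start n) (s_nd n) (sH n); rewrite sn => h.
  have {}h := le_trans (leeDl _ _) h.
  apply: (le_trans (h _)).
    by apply: integral_ge0 => w _; rewrite lee_fin.
  apply: leeD2r; have fE0 y : (0 <= (f y)%:E)%E by rewrite lee_fin.
  have mfE : measurable_fun [set: RR] (fun y => (f y)%:E) by exact/measurable_EFinP.
  by rewrite -(kernel_law x10 H0 fE0 mfE) -meanE// lee_fin low_le.
have cX z w : 0 <= z -> X z ^~ w @ t^'+ --> X z t w.
  by move=> z0; have [_ /(_ w)[+ _]] := X_cadlag z0; exact.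
have cT w (u : nat -> R) (g : R -> R) z : 0 <= z -> continuous g ->
    (forall n, t < u n) -> u n @[n --> \oo] --> t ->
    (g (X z (u n) w))%:E @[n --> \oo] --> (g (X z t w))%:E.
  move=> z0 cg tu ut; apply: cvg_EFin; first exact: nearW.
  apply: (@cvg_comp _ _ _ (fun n => X z (u n) w) g _ (nbhs (X z t w))); last exact: cg.
  by have /cvg_at_rightP := cX z w z0; apply.
have lim := probability_bounded_cvg (Pr := Pr).
have H0 n : 0 <= H n by rewrite (le_trans t0)// ltW.
have mgXz (g : R -> R) z r : measurable_fun [set: RR] (g : RR -> RR) -> 0 <= z -> 0 <= r ->
    measurable_fun [set: Om] (fun w => g (X z r w)).
  by move=> mg z0 r0; exact: (measurableT_comp mg (mX z0 r0)).
have mT n : measurable_fun [set: Om] (fun w => X x (T n w) w).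
  by have := lagged_grid_measurable (s_nd n) (sH n).
have lim1 : (\int[Pr]_(w in dead t) (f1 (X x (T n w) w))%:E)%E @[n --> \oo] -->
    (\int[Pr]_(w in dead t) (f1 (X x t w))%:E)%E.
  apply: lim => //; first exact: dead_measurable.
    by move=> n; exact: (measurableT_comp mf1 (mT n)).
  move=> w wt; have tw : (tau x w < +oo)%E by apply: (le_lt_trans wt); rewrite ltry.
  have Tn n : H n - dl n <= T n w <= H n.
    rewrite /T -absorption_timeE//; apply: grid_lag_bound => //.
    - exact: absorption_time_ge0.
    - by move=> j; rewrite /s -mulrBl -natrB// subSnn mul1r.
    - by rewrite -lee_fin absorption_timeE// sn.
  have tT n : t < T n w.
    by have /andP[+ _] := Tn n; apply: lt_le_trans; rewrite /H addrAC addrK ltrDl.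
  apply: cT => //; apply: (squeeze_cvgr _ (cvg_cst t) cH).
  by apply: nearW => n; rewrite (ltW (tT n)); case/andP: (Tn n).
have lim2 : (\int[Pr]_w (f (X x1 (H n) w))%:E)%E @[n --> \oo] -->
    (\int[Pr]_w (f (X x1 t w))%:E)%E.
  apply: lim => //; first by move=> n; exact: mgXz.
  by move=> w _; apply: cT => // u; apply: cvgB; [exact: f1_continuous|exact: f2_continuous].
have lim3 : (\int[Pr]_(w in dead t) (f2 (X x (H n) w))%:E)%E @[n --> \oo] -->
    (\int[Pr]_(w in dead t) (f2 (X x t w))%:E)%E.
  apply: lim => //; first exact: dead_measurable.
    by move=> n; exact: mgXz.
  by move=> w _; exact: cT.
have fE0 y : (0 <= (f y)%:E)%E by rewrite lee_fin.
have mfE : measurable_fun [set: RR] (fun y => (f y)%:E) by exact/measurable_EFinP.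
rewrite (kernel_law x10 t0 fE0 mfE).
have lim23 : ((\int[Pr]_w (f (X x1 (H n) w))%:E)%E +
     \int[Pr]_(w in dead t) (f2 (X x (H n) w))%:E)%E @[n --> \oo] -->
    (\int[Pr]_w (f (X x1 t w))%:E + \int[Pr]_(w in dead t) (f2 (X x t w))%:E)%E.
  apply: cvgeD => //; apply: ge0_adde_def; rewrite inE.
    by apply: integral_ge0 => w _; rewrite lee_fin.
  by apply: integral_ge0 => w _; rewrite lee_fin.
rewrite -(cvg_lim _ lim1)// -(cvg_lim _ lim23)//; apply: lee_lim.
- by apply/cvg_ex; eexists; exact: lim1.
- by apply/cvg_ex; eexists; exact: lim23.
- exact: nearW.
Qed.

End grid_comparison.

(** * From the comparison to a bound on the difference of two kernels *)

Let dead x t := [set w | (tau x w <= t%:E)%E].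

Let measurable_dead x t : 0 <= x -> 0 <= t -> measurable (dead x t).
Proof.
move=> x0 t0; have [_ /(_ t t0) Fd] := tau_stopping x0.
exact: (filtration_measurable F_filtration t0 Fd).
Qed.

(** [absorbed_comparison] is applied to the ramps at a and b. In the limit f1 - f2 is the indicator
    of ]a, b], and the finite mass above b is cancelled. *)
Let absorbed_le t x1 x a b : 0 <= t -> 0 <= x1 -> x1 <= x -> a <= b ->
  (Pr (dead x t `&` X x t @^-1` `]a, b]%classic) <= P t x1 `]a, b]%classic)%E.
Proof.
move=> t0 x10 x1x ab; have x0 := le_trans x10 x1x.
have mB (B : set RR) z : measurable B -> 0 <= z -> measurable (X z t @^-1` B).
  by move=> mB z0; exact: measurable_X_preimage.
have mD := measurable_dead x0 t0.
have mX1 c n z : 0 <= z -> measurable_fun [set: Om] (fun w => ramp c n (X z t w)).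
  move=> z0; have mr : measurable_fun [set: RR] (ramp c n : RR -> RR).
    by apply: nondecreasing_measurable => //; exact: ramp_nd.
  exact: (measurableT_comp mr (mX z0 t0)).
have ineq n := @absorbed_comparison (ramp a n) (ramp b n) (@ramp_nd _ a n)
  (@ramp_nd _ b n) (ramp_ge0 b n) (fun u => ramp_anti n u ab) (ramp_le1 a n) x x0
  (@ramp_continuous _ a n) (@ramp_continuous _ b n) t x1 t0 x10 x1x.
have cvr (D : set Om) c : measurable D ->
    (\int[Pr]_(w in D) (ramp c n (X x t w))%:E)%E @[n --> \oo] -->
    Pr (D `&` X x t @^-1` `]c, +oo[%classic).
  move=> mD'; rewrite setIC -(integral_indic Pr mD')//; last exact: mB.
  apply: probability_bounded_cvg => //.
  - by move=> n; exact: mX1.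
  - by move=> n w; exact: ramp_ge0.
  - by move=> n w; exact: ramp_le1.
  - by move=> w _; apply: cvg_EFin; [exact: nearW|exact: ramp_cvg].
have cvB : (\int[P t x1]_y (ramp a n y - ramp b n y)%:E)%E @[n --> \oo] -->
    P t x1 `]a, b]%classic.
  rewrite kernel_preimage// -[X in _ --> Pr X]setIT -(integral_indic Pr measurableT); last exact: mB.
  rewrite (_ : (fun n => _) = (fun n =>
      \int[Pr]_w (ramp a n (X x1 t w) - ramp b n (X x1 t w))%:E)%E); last first.
    apply/funext => n; rewrite kernel_law//.
      by move=> y; rewrite lee_fin subr_ge0 ramp_anti.
    apply/measurable_EFinP/measurable_funB;
      by apply: nondecreasing_measurable => //; exact: ramp_nd.
  apply: probability_bounded_cvg => //.
  - by move=> n; apply: measurable_funB; exact: mX1.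
  - by move=> n w; rewrite subr_ge0 ramp_anti.
  - by move=> n w; rewrite lerBlDr (le_trans (ramp_le1 _ _ _))// lerDl ramp_ge0.
  - move=> w _; apply: cvg_EFin; first exact: nearW.
    rewrite (_ : \1__ w = \1_(`]a, +oo[%classic : set R) (X x1 t w) -
        \1_(`]b, +oo[%classic : set R) (X x1 t w)).
      by apply: cvgB; exact: ramp_cvg.
    transitivity (\1_(`]a, b]%classic : set R) (X x1 t w) : R); first by [].
    rewrite !indicE !mem_setE !in_itv/= !andbT.
    have [ya|ay] := leP (X x1 t w) a; first by rewrite ltNge (le_trans ya ab)/= subrr.
    by have [yb|by_] := leP (X x1 t w) b; rewrite /= ?subr0 ?subrr.
have cvL := cvr _ a mD.
have cvR : (\int[P t x1]_y (ramp a n y - ramp b n y)%:E +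
     \int[Pr]_(w in dead x t) (ramp b n (X x t w))%:E)%E @[n --> \oo] -->
    (P t x1 `]a, b]%classic + Pr (dead x t `&` X x t @^-1` `]b, +oo[%classic))%E.
  by apply: cvgeD => //; [apply: ge0_adde_def; rewrite inE|exact: cvr].
have : (Pr (dead x t `&` X x t @^-1` `]a, +oo[%classic) <=
    P t x1 `]a, b]%classic + Pr (dead x t `&` X x t @^-1` `]b, +oo[%classic))%E.
  rewrite -(cvg_lim _ cvL)// -(cvg_lim _ cvR)//; apply: lee_lim.
  - by apply/cvg_ex; eexists; exact: cvL.
  - by apply/cvg_ex; eexists; exact: cvR.
  - exact: nearW.
rewrite (_ : dead x t `&` X x t @^-1` `]a, +oo[%classic =
    (dead x t `&` X x t @^-1` `]a, b]%classic) `|`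
    (dead x t `&` X x t @^-1` `]b, +oo[%classic)); last first.
  rewrite -setIUr -preimage_setU; congr (_ `&` _ @^-1` _).
  by rewrite -itv_bndbnd_setU// bnd_simp.
rewrite measureU; first by rewrite leeD2rE// fin_num_measure//; apply: measurableI => //; exact: mB.
- by apply: measurableI => //; exact: mB.
- by apply: measurableI => //; exact: mB.
apply/seteqP; split => // w [[_ /= +] [_ /= +]]; rewrite !in_itv/= andbT => /andP[_ h].
by rewrite ltNge h.
Qed.

Let absorbed_decomposition t x1 x : 0 <= t -> 0 <= x1 -> x1 <= x ->
  exists nu : {measure set RR -> \bar R}, forall f, (forall y, 0 <= f y)%E ->
    measurable_fun setT f -> (\int[P t x1]_y f y =
    \int[nu]_y f y + \int[Pr]_(w in dead x t) f (X x t w))%E.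
Proof.
move=> t0 x10 x1x; have x0 := le_trans x10 x1x.
have mD := measurable_dead x0 t0.
have mXt : measurable_fun [set: Om] (X x t : Om -> RR) := mX x0 t0.
pose push := (pushforward (mrestr Pr mD) (X x t : Om -> RR)) : {measure set RR -> \bar R}.
pose kappa := push mXt.
have kappaE B : kappa B = Pr (dead x t `&` X x t @^-1` B).
  by rewrite /kappa/push/= /pushforward/= /mrestr setIC.
have [||a b ab|nu nuE] := @measure_subtraction R (P t x1) kappa.
- by rewrite prob_kernel ltry.
- by rewrite kappaE (le_lt_trans (probability_le1 _ _)) ?ltry// preimage_setT setIT.
- by rewrite kappaE; apply: absorbed_le => //; exact: ltW.
exists nu => f f0 mf.
rewrite (@eq_measure_integral _ _ _ setT (measure_add nu kappa) (P t x1)); last first.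
  by move=> B mB _; rewrite nuE//; exact/esym/measure_addE.
rewrite ge0_integral_measure_add//; congr (_ + _)%E.
transitivity (\int[kappa]_y \int[\d_y]_z f z)%E.
  by apply: eq_integral => y _; rewrite integral_dirac// diracT mul1e.
rewrite (@eq_ge0_integral_mixture _ _ _ _ _ _ _ kappa Pr
  (fun y : RR => \d_y) (fun w => \d_(X x t w : RR)) setT (dead x t))//.
- by apply: eq_integral => w _; rewrite integral_dirac// diracT mul1e.
- by move=> B mB; exact: measurable_fun_dirac.
- by move=> B mB; exact: (measurableT_comp (measurable_fun_dirac mB) mXt).
- move=> B mB; rewrite (integral_indic kappa measurableT mB) setIT kappaE.
  rewrite setIC -(integral_indic Pr mD)//.
  exact: measurable_X_preimage.
Qed.

Let fin_split (a b : \bar R) (r : R) : (0 <= a)%E -> (0 <= b)%E ->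
  (r%:E = a + b)%E -> exists a' b' : R, [/\ a = a'%:E, b = b'%:E & r = a' + b'].
Proof.
case: a => [a'| |]; case: b => [b'| |]// _ _; rewrite -EFinD => -[->].
by exists a', b'.
Qed.

(** Write P^t(x1, .) = nu + kappa, with kappa the law of X t on {tau <= t}. The kappa parts cancel;
    what remains is bounded by (nu, W) and E[W(X t); t < tau], and the order applied to W makes the
    first at most the second, hence the factor 2. As the decomposition speaks of nonnegative
    functions, f is written (f + W) - W. *)
Lemma kernel_difference_bound t x1 x2 (f W : R -> R) (M : R) :
  0 <= t -> 0 <= x1 -> x1 <= x2 -> measurable_fun [set: RR] (f : RR -> RR) ->
  (forall y, `|f y| <= W y) -> {homo W : x y / x <= y} -> (forall y, W y <= M) ->
  (`|\int[P t x1]_y (f y)%:E - \int[P t x2]_y (f y)%:E| <=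
   2%:E * \int[Pr]_(w in [set w | (t%:E < hitting_time0 (X x2) w)%E])
     (W (X x2 t w))%:E)%E.
Proof.
move=> t0 x10 x12 mf fW Wnd WM; have x20 := le_trans x10 x12.
set alive := [set w | _].
have W0 y : 0 <= W y by exact: le_trans (normr_ge0 _) (fW y).
have mW : measurable_fun [set: RR] (W : RR -> RR) by exact: nondecreasing_measurable.
have mfW : measurable_fun [set: RR] (fun y => f y + W y : RR) by exact: measurable_funD.
have mWE : measurable_fun [set: RR] (fun y => (W y)%:E) by exact/measurable_EFinP.
have mfWE : measurable_fun [set: RR] (fun y => (f y + W y)%:E) by exact/measurable_EFinP.
have mfE : measurable_fun [set: RR] (fun y => (f y)%:E) by exact/measurable_EFinP.
have fW0 y : 0 <= f y + W y by have := fW y; rewrite ler_norml => /andP[]; lra.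
have fW2 y : f y + W y <= 2 * W y by have := fW y; rewrite ler_norml => /andP[]; lra.
have WE0 y : (0 <= (W y)%:E)%E by rewrite lee_fin.
have fWE0 y : (0 <= (f y + W y)%:E)%E by rewrite lee_fin.
have iW z : (P t z).-integrable setT (fun y => (W y)%:E).
  apply: (@le_integrable _ _ _ (P t z) _ measurableT _ (cst M%:E)) => //.
    by move=> y _; rewrite /= lee_fin !ger0_norm// (le_trans (W0 y)).
  apply/integrableP; split => //=.
  by rewrite integral_cst// prob_kernel mule1 ltry.
have iF z : (P t z).-integrable setT (fun y => (f y)%:E).
  apply: (le_integrable measurableT _ _ (iW z)) => // y _.
  by rewrite /= lee_fin (ger0_norm (W0 y)).
have fin z : exists i j : R, [/\ (\int[P t z]_y (f y + W y)%:E = i%:E)%E,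
    (\int[P t z]_y (W y)%:E = j%:E)%E & (\int[P t z]_y (f y)%:E = (i - j)%:E)%E].
  have fW_ := integrable_fin_num measurableT (iW z).
  have ff_ := integrable_fin_num measurableT (iF z).
  exists (fine (\int[P t z]_y (f y)%:E)%E + fine (\int[P t z]_y (W y)%:E)%E),
    (fine (\int[P t z]_y (W y)%:E)%E); split.
  - rewrite EFinD !fineK// -integralD//.
  - by rewrite fineK.
  - by rewrite addrK fineK.
have mD := measurable_dead x20 t0.
have mA : measurable alive.
  have := stopping_time_gt F_filtration (tau_stopping x20) t0.
  exact: filtration_measurable.
have dA : [disjoint dead x2 t & alive].
  by apply/disj_setPS => w []; rewrite /dead/alive/= leNgt => /negP.
have DA : [set: Om] = dead x2 t `|` alive.
  by apply/seteqP; split => // w _ /=; have [|] := leP (tau x2 w) t%:E; [left|right].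
have split2 (g : R -> R) : measurable_fun [set: RR] (fun y => (g y)%:E) ->
    (forall y, 0 <= (g y)%:E)%E -> (\int[P t x2]_y (g y)%:E =
    \int[Pr]_(w in dead x2 t) (g (X x2 t w))%:E + \int[Pr]_(w in alive) (g (X x2 t w))%:E)%E.
  move=> mg g0; rewrite kernel_law// DA ge0_integral_setU// -DA.
  exact: (measurableT_comp mg (mX x20 t0)).
have [nu nuE] := absorbed_decomposition t0 x10 x12.
have [i1 [j1 [Ei1 Ej1 ->]]] := fin x1; have [i2 [j2 [Ei2 Ej2 ->]]] := fin x2.
have mWX : measurable_fun [set: Om] (fun w => (W (X x2 t w))%:E).
  exact: (measurableT_comp mWE (mX x20 t0)).
have mfWX : measurable_fun [set: Om] (fun w => (f (X x2 t w) + W (X x2 t w))%:E).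
  exact: (measurableT_comp mfWE (mX x20 t0)).
have N2 : (\int[nu]_y (f y + W y)%:E <= 2%:E * \int[nu]_y (W y)%:E)%E.
  rewrite -ge0_integralZl//; apply: ge0_le_integral => //.
    by apply: measurable_funeM.
  by move=> y _; rewrite -EFinM lee_fin.
have A2 : (\int[Pr]_(w in alive) (f (X x2 t w) + W (X x2 t w))%:E <=
    2%:E * \int[Pr]_(w in alive) (W (X x2 t w))%:E)%E.
  rewrite -ge0_integralZl//; last exact: measurable_funTS.
  apply: ge0_le_integral => //.
  - exact: measurable_funTS.
  - by apply: measurable_funeM; exact: measurable_funTS.
  - by move=> w _; rewrite -EFinM lee_fin.
have := integral_monotone t0 x10 x12 Wnd W0; rewrite Ej1 Ej2 lee_fin => j12.
have := nuE _ fWE0 mfWE; have := nuE _ WE0 mWE.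
have := split2 _ mfWE fWE0; have := split2 _ mWE WE0.
rewrite Ei1 Ei2 Ej1 Ej2 => /fin_split[||d0 [a0 [Ed0 Ea0 J2]]]; try exact: integral_ge0.
move=> /fin_split[||d1 [a1 [Ed1 Ea1 I2]]]; try exact: integral_ge0.
move=> /fin_split[||n0 [d0' [En0 Ed0' J1]]]; try exact: integral_ge0.
move=> /fin_split[||n1 [d1' [En1 Ed1' I1]]]; try exact: integral_ge0.
have A1ge0 : (0 <= a1%:E)%E by rewrite -Ea1; exact: integral_ge0.
have N1ge0 : (0 <= n1%:E)%E by rewrite -En1; exact: integral_ge0.
move: N2 A2; rewrite Ea0 Ea1 En0 En1 -!EFinM !lee_fin in A1ge0 N1ge0 * => N2 A2.
have d0E : d0 = d0' by apply/EFin_inj; rewrite -Ed0 -Ed0'.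
have d1E : d1 = d1' by apply/EFin_inj; rewrite -Ed1 -Ed1'.
by rewrite ler_norml; apply/andP; split; lra.
Qed.

End comparison_with_absorbed_process.

(** * The three estimates *)

Theorem theorem1 (R : realType) (phi : R -> R)
  (phi_ge0 : forall u : R, 1 <= u -> 0 <= phi u)
  (phi_concave : convex_function (`[1, +oo[%classic : set R) (fun u => - phi u))
  (phi_incr : forall u v : R, 1 <= u -> u <= v -> phi u <= phi v)
  (Phi_fin : forall s : R, 1 < s -> (ePhi phi s < +oo)%E)
  (* the filtered probability space *)
  (d : measure_display) (Om : measurableType d) (Pr : probability Om R)
  (F : R -> set (set Om)) (F_filtration : filtration F)
  (* the transition kernel on R_+ and, for each x >= 0, the copy X x of the
     process started from x *)
  (P : R -> R.-pker (measurableTypeR R) ~> (measurableTypeR R))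
  (P_half_line : forall t x : R, 0 <= t -> 0 <= x -> on_half_line (P t x))
  (X : R -> R -> Om -> R)
  (X_ge0 : forall x t w, 0 <= x -> 0 <= t -> 0 <= X x t w)
  (X_start : forall x, 0 <= x -> {ae Pr, forall w, X x 0 w = x})
  (X_semimartingale : forall x, 0 <= x -> semimartingale Pr F (X x))
  (X_markov : forall x, 0 <= x -> strong_markov Pr F P (X x))
  (P_ordered : stochastically_ordered P)
  (V : R -> R)
  (V_measurable : measurable_fun (`[0, +oo[%classic : set (measurableTypeR R))
                    (V : measurableTypeR R -> measurableTypeR R))
  (V_ge1 : forall x : R, 0 <= x -> 1 <= V x)
  (V_lyapunov : forall x, 0 <= x -> lyapunov Pr F phi (X x) V)
  (phiV_gt0 : forall x : R, 0 < x -> 0 < phi (V x))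
  (U h : R -> R)
  (U_ge0 : forall x : R, 0 <= x -> 0 <= U x)
  (h_ge0 : forall t : R, 0 <= t -> 0 <= h t)
  (U_nondecr : forall x y : R, 0 <= x -> x <= y -> U x <= U y)
  (h_nondecr : forall s t : R, 0 <= s -> s <= t -> h s <= h t)
  (hUG : forall t x : R, 0 <= t -> 0 <= x -> h t * U x <= Gfun phi t (V x)) :
  [/\ (* (a) *)
      forall x1 x2 t : R, 0 <= x1 -> x1 <= x2 -> 0 <= t ->
        (wnorm_diff U (P t x1) (P t x2) <= 2%:E / (h t)%:E * (V x2)%:E)%E,
      (* (b) *)
      forall rho1 rho2 rho12 : probability (measurableTypeR R) R,
        on_half_line rho1 -> on_half_line rho2 ->
        is_stoch_max rho1 rho2 rho12 ->
        forall t : R, 0 <= t ->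
        (wnorm_diff U (kact (P t) rho1) (kact (P t) rho2)
           <= 2%:E / (h t)%:E * pairing rho12 V)%E
    & (* (c) *)
      forall rho pi pimax : probability (measurableTypeR R) R,
        on_half_line rho -> (pairing rho V < +oo)%E ->
        on_half_line pi -> stationary P pi ->
        (forall pi' : probability (measurableTypeR R) R,
           on_half_line pi' -> stationary P pi' ->
           forall B : set (measurableTypeR R), measurable B -> pi' B = pi B) ->
        (pairing pi V < +oo)%E ->
        is_stoch_max pi rho pimax ->
        forall t : R, 0 <= t ->
        (wnorm_diff U (kact (P t) rho) pi
           <= 2%:E / (h t)%:E * pairing pimax V)%E ].
Proof.
have X_cadlag x : 0 <= x -> cadlag_adapted F (X x) by move=> /X_semimartingale[].
have tau_stopping x : 0 <= x -> stopping_time F (hitting_time0 (X x)).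
  by move=> /V_lyapunov[].
have mRp : measurable (`[0%R, +oo[%classic : set (measurableTypeR R)).
  exact: measurable_itv.
pose V0 x := V (Num.max 0 x).
have V01 x : 1 <= V0 x by rewrite /V0 V_ge1// le_max lexx.
have mV0 : measurable_fun [set: measurableTypeR R]
    (V0 : measurableTypeR R -> measurableTypeR R).
  apply: measurable_comp_on V_measurable _ _; first exact: measurable_maxr.
  by move=> x; rewrite le_max lexx.
have bound t x1 x2 (f : R -> R) (M : R) : 0 <= t -> 0 < h t -> 0 <= x1 -> x1 <= x2 ->
    measurable_fun [set: measurableTypeR R] (f : measurableTypeR R -> measurableTypeR R) ->
    (forall y, `|f y| <= M) -> (forall y, `|f y| <= U (Num.max 0 y)) ->
    (`|\int[P t x1]_y (f y)%:E - \int[P t x2]_y (f y)%:E| <= (2 / h t * V x2)%:E)%E.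
  move=> t0 ht x10 x12 mf fM fU; have x20 := le_trans x10 x12.
  (* A bounded nondecreasing majorant of |f|; as it is at most U on R_+, h t times it is at most
     G(t, V). *)
  pose W y := Num.min (U (Num.max 0 y)) M.
  have Wnd : {homo W : x y / x <= y}.
    by move=> x y xy; rewrite /W le_min2// U_nondecr// ?le_max2// le_max lexx.
  have fW y : `|f y| <= W y by rewrite /W le_min fU fM.
  have WM y : W y <= M by rewrite /W ge_min lexx orbT.
  have W0 y : 0 <= W y by exact: le_trans (normr_ge0 _) (fW y).
  have := kernel_difference_bound F_filtration P_half_line X_ge0 X_start X_cadlag
    X_markov P_ordered tau_stopping t0 x10 x12 mf fW Wnd WM.
  move=> /le_trans; apply; rewrite -mulrA EFinM lee_pmul2l// EFinM.
  have := integral_G_alive phi_ge0 phi_concave phi_incr Phi_fin F_filtration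
    (fun t w t0 => X_ge0 x2 t w x20 t0) (X_cadlag x2 x20) V_measurable V_ge1
    (V_lyapunov x2 x20) phiV_gt0 x20 (X_start x2 x20) t0.
  set A := alive (X x2) t; rewrite -[[set w | _]]/A => GV.
  have mX : measurable_fun [set: Om] (X x2 t).
    exact: (adapted_measurable F_filtration (X_cadlag x2 x20).1 t0).
  have mA : measurable A.
    apply: (filtration_measurable F_filtration t0).
    exact: (stopping_time_gt F_filtration (tau_stopping x2 x20) t0).
  have mW : measurable_fun [set: Om] (fun w => (W (X x2 t w))%:E).
    apply/measurable_EFinP; apply: (measurableT_comp _ mX).
    exact: nondecreasing_measurable.
  have hW : ((h t)%:E * \int[Pr]_(w in A) (W (X x2 t w))%:E <= (V x2)%:E)%E.
    apply: le_trans GV.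
    rewrite -ge0_integralZl//; [|exact: measurable_funTS| |by rewrite lee_fin ltW].
      apply: ge0_le_integral => //.
      - by move=> w _; rewrite -EFinM lee_fin mulr_ge0// ltW.
      - by apply: measurable_funeM; exact: measurable_funTS.
      - apply: measurable_funTS; apply/measurable_EFinP.
        have mG : measurable_fun (`[1, +oo[%classic : set (measurableTypeR R)) (Gfun phi t).
          by apply: measurable_nondecreasing_on => u v u1 uv; exact: G_le.
        have VX1 w : 1 <= V (X x2 t w) by rewrite V_ge1// X_ge0.
        apply: measurable_comp_on mG _ VX1; apply: measurable_comp_on V_measurable mX _ => w.
        exact: X_ge0.
      - move=> w _; rewrite -EFinM lee_fin; apply: le_trans (hUG t _ t0 (X_ge0 x2 t w x20 t0)).
        rewrite ler_wpM2l ?(ltW ht)// /W max_r ?X_ge0//.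
        by rewrite ge_min lexx.
    by move=> w _; rewrite lee_fin.
  rewrite -(@lee_pmul2l _ (h t)%:E) ?lte_fin//; apply: (le_trans hW).
  by rewrite -!EFinM mulrA mulfV ?gt_eqF// mul1r.
(* If h t = 0 the quotient is +oo and V >= 1 makes the whole right-hand side +oo; otherwise the
   quotient is a real number. *)
have infinite t (v : \bar R) : h t = 0 -> (1 <= v)%E -> (2%:E / (h t)%:E * v = +oo)%E.
  move=> -> v1; rewrite inver eqxx gt0_muley ?lte_fin// gt0_mulye//.
  exact: lt_le_trans v1.
have finite t : h t != 0 -> (2%:E / (h t)%:E = (2 / h t)%:E)%E.
  by move=> ht; rewrite inver (negbTE ht).
have probR (rho : probability (measurableTypeR R) R) : on_half_line rho ->
    rho (`[0%R, +oo[%classic) = 1%E.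
  move=> /half_line_setI/(_ measurableT); rewrite setTI => ->.
  exact: probability_setT.
have pairing_ge1 (rho : probability (measurableTypeR R) R) : on_half_line rho ->
    (1 <= pairing rho V)%E.
  move=> hrho; have <- : (\int[rho]_(x in `[0%R, +oo[) 1 = 1 :> \bar R)%E.
    by rewrite integral_cst// mul1e; exact: probR.
  apply: ge0_le_integral => //.
  - exact/measurable_EFinP.
  - by move=> x; rewrite /= in_itv/= andbT => x0; rewrite lee_fin V_ge1.
have kernelR t x : 0 <= t -> 0 <= x -> P t x (`[0%R, +oo[%classic) = 1%E.
  move=> t0 x0; have := half_line_setI (P_half_line t x t0 x0) measurableT.
  by rewrite setTI => ->; exact: prob_kernel.
have kactR t (rho : probability (measurableTypeR R) R) : 0 <= t -> on_half_line rho ->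
    kact (P t) rho (`[0%R, +oo[%classic) = 1%E.
  move=> t0 hrho; transitivity (\int[rho]_(x in `[0%R, +oo[) 1 : \bar R)%E.
    by apply: eq_integral => x /set_mem; rewrite /= in_itv/= andbT => x0; exact: kernelR.
  by rewrite integral_cst// mul1e; exact: probR.
(* S x below is the mean of f + M started from x. By (a) it varies by at most (2 / h t) V(y) between
   x <= y, which is the hypothesis of [stoch_max_integral_difference]. *)
have boundB t (rho1 rho2 rho12 : probability (measurableTypeR R) R) (f : R -> R) (M : R) :
    0 <= t -> on_half_line rho1 -> on_half_line rho2 -> is_stoch_max rho1 rho2 rho12 ->
    measurable_fun [set: measurableTypeR R] (f : measurableTypeR R -> measurableTypeR R) ->
    (forall y, `|f y| <= M) -> (forall y, `|f y| <= U (Num.max 0 y)) ->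
    (`|\int[kact (P t) rho1]_(y in `[0%R, +oo[) (f y)%:E -
       \int[kact (P t) rho2]_(y in `[0%R, +oo[) (f y)%:E| <=
       2%:E / (h t)%:E * pairing rho12 V)%E.
  move=> t0 h1 h2 h12 mf fM fU.
  have [ht|ht] := eqVneq (h t) 0.
    by rewrite infinite ?leey//; apply: pairing_ge1; exact: h12.1.
  have ht0 : 0 < h t by rewrite lt_neqAle eq_sym ht h_ge0.
  have mfM : measurable_fun [set: measurableTypeR R] (fun y => f y + M : measurableTypeR R).
    exact: measurable_funD.
  have mfME : measurable_fun [set: measurableTypeR R] (fun y => (f y + M)%:E).
    exact/measurable_EFinP.
  have fM0 y : 0 <= f y + M by have := fM y; rewrite ler_norml => /andP[]; lra.
  have fME0 y : (0 <= (f y + M)%:E)%E by rewrite lee_fin.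
  have fM2 y : f y + M <= 2 * M by have := fM y; rewrite ler_norml => /andP[]; lra.
  pose S x := fine (\int[P t x]_y (f y + M)%:E)%E.
  have sh x := integral_shift measurableT (prob_kernel x : P t x setT = 1%E) mf fM.
  have SE x : (S x)%:E = (\int[P t x]_y (f y + M)%:E)%E.
    by have [a [_ E]] := sh x; rewrite /S E.
  have S0 x : 0 <= S x by rewrite -lee_fin SE; exact: integral_ge0.
  have S2 x : S x <= 2 * M.
    rewrite -lee_fin SE; have <- : (\int[P t x]_y (2 * M)%:E = (2 * M)%:E)%E.
      by rewrite integral_cst// prob_kernel mule1.
    by apply: ge0_le_integral => // y _; rewrite lee_fin.
  have mS : measurable_fun [set: measurableTypeR R]
      (S : measurableTypeR R -> measurableTypeR R).
    apply: measurableT_comp => //; apply: measurable_fun_integral_kernel => // B mB.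
    exact: measurable_kernel.
  have SV x y : 0 <= x -> x <= y -> `|S x - S y| <= 2 / h t * V0 y.
    move=> x0 xy; have y0 := le_trans x0 xy.
    have := bound t x y f M t0 ht0 x0 xy mf fM fU.
    have [a [-> Ex]] := sh x; have [b [-> Ey]] := sh y.
    rewrite /S Ex Ey /V0 max_r//= lee_fin => ab.
    by rewrite (_ : a + M - (b + M) = a - b)//; ring.
  have c0 : 0 <= 2 / h t by rewrite divr_ge0// ltW.
  have := stoch_max_integral_difference h1 h2 h12 mS S0 S2 mV0
    (fun x => le_trans ler01 (V01 x)) c0 SV.
  have [a1 [-> E1]] := integral_shift mRp (kactR t rho1 t0 h1) mf fM.
  have [a2 [-> E2]] := integral_shift mRp (kactR t rho2 t0 h2) mf fM.
  have kS (rho : probability (measurableTypeR R) R) :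
      (\int[kact (P t) rho]_(y in `[0%R, +oo[) (f y + M)%:E =
       \int[rho]_(x in `[0%R, +oo[) (S x)%:E)%E.
    rewrite integral_kact//; first by apply: eq_integral => x _; rewrite SE.
    by move=> x x0; exact: P_half_line.
  rewrite -!kS E1 E2 -!EFinB (_ : a1 + M - (a2 + M) = a1 - a2); last by ring.
  rewrite finite// /pairing => /le_trans; apply; rewrite le_eqVlt; apply/orP; left; apply/eqP.
  congr (_ * _)%E; apply: eq_integral => x /set_mem; rewrite /= in_itv/= andbT => x0.
  by rewrite /V0 max_r.
split.
- move=> x1 x2 t x10 x12 t0; have x20 := le_trans x10 x12.
  apply: wnorm_diff_le => f M mf fM fU.
  have [ht|ht] := eqVneq (h t) 0.
    by rewrite infinite ?leey// lee_fin V_ge1.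
  have ht0 : 0 < h t by rewrite lt_neqAle eq_sym ht h_ge0.
  have PT z : (P t z setT < +oo)%E by rewrite prob_kernel ltry.
  rewrite finite// -EFinM !(integral_half_line (PT _) _ mf fM); try exact: P_half_line.
  exact: bound mf fM fU.
- move=> rho1 rho2 rho12 h1 h2 h12 t t0; apply: wnorm_diff_le => f M mf fM fU.
  exact: boundB h12 mf fM fU.
- move=> rho pi pimax hrho _ hpi stat _ _ hmax t t0.
  apply: wnorm_diff_le => f M mf fM fU.
  have piE (B : set (measurableTypeR R)) : measurable B -> kact (P t) pi B = pi B.
    (* At t = 0 the kernel is the Dirac mass at the starting point and leaves pi unchanged. *)
    have [->|tn0] := eqVneq t 0; last by apply: stat; rewrite lt_neqAle eq_sym tn0.
    move=> mB; transitivity (\int[pi]_(x in `[0%R, +oo[) (\1_B x)%:E)%E.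
      apply: eq_integral => x /set_mem; rewrite /= in_itv/= andbT => x0.
      exact: (kernel_initial F_filtration X_start X_cadlag X_markov).
    by rewrite integral_indic// half_line_setI.
  have hmax' : is_stoch_max rho pi pimax.
    by split; [exact: hmax.1|move=> x x0; rewrite maxC; exact: hmax.2].
  have -> : (\int[pi]_(y in `[0%R, +oo[) (f y)%:E =
      \int[kact (P t) pi]_(y in `[0%R, +oo[) (f y)%:E)%E.
    by apply: eq_measure_integral => B mB _; exact/esym/piE.
  exact: boundB hmax' mf fM fU.
Qed.
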